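(* Let $(X,\mathcal V)$ be a regular dynamic pair on a manifold $M$, let $c\colon[0,T]\to M$ be an integral curve of $X$ which is not a closed orbit, and let $g$ be an invariant metric on $\mathcal V$ along $c$. Let $K$ be the curvature operator of $(X,\mathcal V)$ and let $k(v)=g(Kv,v)/g(v,v)$ be the directional curvature. If there exists $\lambda\in\mathbb R$ such that one of the following equivalent estimates holds: $$g(Kv,v)\le\lambda\, g(v,v)\quad\text{for } v\in\mathcal V(c(t)),\ t\in[0,T],$$ or, using directional curvature, $$k(v)\le\lambda,\quad v\in\mathcal V(c(t))\setminus\{0\},\ t\in[0,T],$$ then there are no conjugate times in $(0,T]$ if $\lambda\le 0$, and there are no conjugate times in the interval $(0,t_c)$, $t_c=\min\{T,\pi/\sqrt\lambda\}$, if $\lambda>0$.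
   Context: All data are $C^\infty$. A dynamic pair $(X,\mathcal V)$ on a manifold $M$ consists of a vector field $X$ and a smooth distribution $\mathcal V\subset TM$ of rank $m$. Put $\mathcal D=\mathcal V+[X,\mathcal V]$ (spanned by the sections $V$ of $\mathcal V$ and the brackets $[X,V]$). The pair is regular if $X(x)\ne0$ for all $x$, $\operatorname{rk}\mathcal D=2m$, and $[X,\mathcal D]\subset\mathcal D$. Curvature. For a local frame $\hat W=(W_1,\dots,W_m)$ of $\mathcal V$ (a row vector) there are unique $m\times m$ matrices of functions $H_0,H_1$ with $[X,[X,\hat W]]=\hat W H_0+[X,\hat W]H_1$. The matrix $-H_0+\frac12X(H_1)-\frac14H_1^2$ is, in the frame $\hat W$, the matrix of a well-defined (frame-independent) bundle endomorphism $K\colon\mathcal V\to\mathcal V$, the curvature operator. Covariant derivative. The distribution $\mathcal H=\operatorname{span}\{[X,\hat W]-\frac12\hat W H_1\}$ does not depend on the frame and $\mathcal D=\mathcal V\oplus\mathcal H$, with projection $\pi_{\mathcal V}\colon\mathcal D\to\mathcal V$. For a section $V$ of $\mathcal V$, $D_XV:=\pi_{\mathcal V}[X,V]$; thus $D_XW_j=\frac12\sum_i(H_1)^i_jW_i$. For sections along an integral curve $c$ of $X$, $D_X\big(\sum_jf^jW_j\big)=\sum_j\frac{df^j}{dt}W_j+\frac12\sum_{i,j}f^j(H_1)^i_jW_i$, where $f^j$ are functions of $t$. Invariant metric. A metric $g$ on $\mathcal V$ along $c$ is called invariant if $X(g(Y,Z))=g(D_XY,Z)+g(Y,D_XZ)$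 for all sections $Y,Z$ of $\mathcal V$ along $c$ (where $X$ acts as $d/dt$ along $c$). Given a metric $g$ on $\mathcal V$, the directional curvature $k(v)=g(Kv,v)/g(v,v)$ is defined for $v\in\mathcal V$ with $g(v,v)\neq0$. Conjugate times. A number $t^*\in(0,T]$ is a conjugate time along $c$ if $\exp(t^*X)_*\mathcal V(c(0))\cap\mathcal V(c(t^* ))\ne\{0\}$, where $\exp(tX)$ is the flow of $X$. *)

(* Defs.v *)
From HB Require Import structures.
From mathcomp Require Import all_boot all_order all_algebra.
From mathcomp Require Import all_classical all_reals all_analysis.

Set Implicit Arguments.
Unset Strict Implicit.
Unset Printing Implicit Defensive.
Import Order.TTheory GRing.Theory Num.Theory numFieldNormedType.Exports.
Local Open Scope classical_set_scope.
Local Open Scope ring_scope.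

(* Every set U to which [Ck] and [smooth_on] are applied below is open. *)
Fixpoint Ck {R : realType} {E F : normedModType R}
    (k : nat) (U : set E) (f : E -> F) : Prop :=
  match k with
  | 0%N => forall x, U x -> {for x, continuous f}
  | k'.+1 => (forall x, U x -> differentiable f x) /\
             (forall v, Ck k' U ('D_v f))
  end.

Definition smooth_on {R : realType} {E F : normedModType R}
  (U : set E) (f : E -> F) : Prop := forall k, Ck k U f.

(* Derivative relative to A: one-sided at the endpoints of a closed interval. *)
Definition has_deriv_within {R : realType} {F : normedModType R}
    (A : set R) (f : R -> F) (t : R) (l : F) : Prop :=
  (s - t)^-1 *: (f s - f t) @[s --> within A t^'] --> l.

(* D k is the k-th derivative of f, relative to A. *)
Definition smooth_curve_on {R : realType} {F : normedModType R}
    (A : set R) (f : R -> F) : Prop :=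
  exists D : nat -> R -> F,
    (forall t, A t -> D 0%N t = f t) /\
    (forall k t, A t -> has_deriv_within A (D k) t (D k.+1 t)).

(* [cinv] is meaningful only on the open set [cmap @` cdom]. *)
Record chart (R : realType) (n : nat) (M : topologicalType) := Chart {
  cdom : set M;
  cmap : M -> 'rV[R]_n;
  cinv : 'rV[R]_n -> M;
  open_cdom : open cdom;
  open_cimg : open (cmap @` cdom);
  cmap_continuous : forall p, cdom p -> {for p, continuous cmap};
  cinv_continuous : forall y, (cmap @` cdom) y -> {for y, continuous cinv};
  cmapK : forall p, cdom p -> cinv (cmap p) = p
}.

Definition compatible (R : realType) (n : nat) (M : topologicalType)
    (a b : chart R n M) : Prop :=
  smooth_on (cmap a @` (cdom a `&` cdom b)) (cmap b \o cinv a).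

(* Smooth n-manifolds without boundary. As usual with a fixed preferred chart
   [chart_at p] around each p, the tangent space T_pM is R^n: a tangent vector
   at p is given by its coordinates in [chart_at p]. *)
Record manifold (R : realType) (n : nat) := Manifold {
  carrier :> topologicalType;
  manifold_hausdorff : hausdorff_space carrier;
  manifold_second_countable : @second_countable carrier;
  atlas : set (chart R n carrier);
  atlas_compatible : forall a b, atlas a -> atlas b -> compatible a b;
  chart_at : carrier -> chart R n carrier;
  chart_at_atlas : forall p, atlas (chart_at p);
  chart_at_dom : forall p, cdom (chart_at p) p
}.

Definition vfield (R : realType) (n : nat) (M : manifold R n) : Type :=
  M -> 'rV[R]_n.

(* Coordinates in the chart a of the tangent vector v at p. *)
Definition in_chart (R : realType) (n : nat) (M : manifold R n)
    (a : chart R n M) (p : M) (v : 'rV[R]_n) : 'rV[R]_n :=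
  'D_v (cmap a \o cinv (chart_at p)) (cmap (chart_at p) p).

Definition vrep (R : realType) (n : nat) (M : manifold R n)
    (a : chart R n M) (X : vfield M) (y : 'rV[R]_n) : 'rV[R]_n :=
  in_chart a (cinv a y) (X (cinv a y)).

Definition smooth_vfield (R : realType) (n : nat) (M : manifold R n)
    (O : set M) (X : vfield M) : Prop :=
  forall a : chart R n M, atlas a -> smooth_on (cmap a @` (cdom a `&` O)) (vrep a X).

Definition bracket (R : realType) (n : nat) (M : manifold R n)
    (X Y : vfield M) : vfield M := fun p =>
  let a := chart_at p in
  'D_(X p) (vrep a Y) (cmap a p) - 'D_(Y p) (vrep a X) (cmap a p).

Definition lie_derive (R : realType) (n : nat) (M : manifold R n)
    (X : vfield M) (f : M -> R^o) (p : M) : R :=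
  'D_(X p) (f \o cinv (chart_at p)) (cmap (chart_at p) p).

Definition pushforward (R : realType) (n : nat) (M : manifold R n)
    (f : M -> M) (p : M) (v : 'rV[R]_n) : 'rV[R]_n :=
  'D_v (cmap (chart_at (f p)) \o f \o cinv (chart_at p)) (cmap (chart_at p) p).

Definition integral_curve (R : realType) (n : nat) (M : manifold R n)
    (X : vfield M) (A : set R) (c : R -> M) : Prop :=
  forall t, A t ->
    (c s @[s --> within A (nbhs t)] --> c t) /\
    has_deriv_within A (cmap (chart_at (c t)) \o c) t (X (c t)).

(* The maximal flow of X: [Phi t p] stands for exp(tX)(p), defined for
   (t, p) in [dom]. *)
Record is_flow (R : realType) (n : nat) (M : manifold R n)
    (X : vfield M) (dom : set (R * M)) (Phi : R -> M -> M) : Prop := IsFlow {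
  flow_open : open dom;
  flow_interval : forall p, is_interval [set t | dom (t, p)];
  flow_dom0 : forall p, dom (0, p);
  flow0 : forall p, Phi 0 p = p;
  flow_curve : forall p, integral_curve X [set t | dom (t, p)] (Phi ^~ p);
  flow_continuous : forall t p, dom (t, p) ->
    {for (t, p), continuous (fun z : R * M => Phi z.1 z.2)};
  flow_smooth : forall t p, dom (t, p) ->
    exists U : set (R * 'rV[R]_n),
      [/\ open U, U (t, cmap (chart_at p) p) &
          smooth_on U (fun z : R * 'rV[R]_n =>
            cmap (chart_at (Phi t p)) (Phi z.1 (cinv (chart_at p) z.2)))];
  flow_maximal : forall (A : set R) (c : R -> M) p,
    is_interval A -> A 0 -> c 0 = p -> integral_curve X A c ->
    forall t, A t -> dom (t, p) /\ c t = Phi t p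
}.

Definition tangent_distribution (R : realType) (n : nat) (M : manifold R n) : Type :=
  M -> {vspace 'rV[R]_n}.

Definition local_frame (R : realType) (n m : nat) (M : manifold R n)
    (V : tangent_distribution M) (O : set M) (W : 'I_m -> vfield M) : Prop :=
  [/\ open O, forall j, smooth_vfield O (W j) &
      forall p, O p -> basis_of (V p) [seq W j p | j : 'I_m]].

(* X is a vector field and V a smooth distribution of rank m. *)
Definition dynamic_pair (R : realType) (n m : nat) (M : manifold R n)
    (X : vfield M) (V : tangent_distribution M) : Prop :=
  smooth_vfield setT X /\
  forall p, exists O (W : 'I_m -> vfield M), O p /\ local_frame V O W.

Definition local_section (R : realType) (n : nat) (M : manifold R n)
    (S : M -> set 'rV[R]_n) (O : set M) (Y : vfield M) : Prop :=
  [/\ open O, smooth_vfield O Y & forall p, O p -> S p (Y p)].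

(* D = V + [X, V], as a subset of each tangent space: the linear span of the
   values of the local sections Y of V and of the brackets [X, Y]. *)
Definition bracket_span (R : realType) (n : nat) (M : manifold R n)
    (X : vfield M) (V : tangent_distribution M) (p : M) : set 'rV[R]_n :=
  [set w | exists s : seq 'rV[R]_n,
     (forall u, u \in s -> exists O Y,
        [/\ O p, local_section (fun q => [set` V q]) O Y &
            u = Y p \/ u = bracket X Y p]) /\
     w \in span s].

Definition regular_pair (R : realType) (n m : nat) (M : manifold R n)
    (X : vfield M) (V : tangent_distribution M) : Prop :=
  [/\ forall p, X p != 0,
      forall p, exists2 U : {vspace 'rV[R]_n},
        \dim U = (2 * m)%N & bracket_span X V p = [set` U] &
      forall O Y p, local_section (bracket_span X V) O Y -> O p ->
        bracket_span X V p (bracket X Y p)].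

(* [X,[X,W]] = W H0 + [X,W] H1 on O, where W is a row of vector fields. *)
Definition structure_matrices (R : realType) (n m : nat) (M : manifold R n)
    (X : vfield M) (O : set M) (W : 'I_m -> vfield M)
    (H0 H1 : M -> 'M[R]_m) : Prop :=
  forall p j, O p ->
    bracket X (bracket X (W j)) p =
      \sum_i H0 p i j *: W i p + \sum_i H1 p i j *: bracket X (W i) p.

Definition curvature_matrix (R : realType) (n m : nat) (M : manifold R n)
    (X : vfield M) (H0 H1 : M -> 'M[R]_m) (p : M) : 'M[R]_m :=
  - H0 p + 2^-1 *: (\matrix_(i, j) lie_derive X (fun q => H1 q i j) p)
  - 4^-1 *: (H1 p *m H1 p).

(* K is an endomorphism of V; the values of [K p] outside [V p] are
   irrelevant. *)
Definition is_curvature_operator (R : realType) (n m : nat)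
    (M : manifold R n) (X : vfield M) (V : tangent_distribution M)
    (K : M -> 'End('rV[R]_n)) : Prop :=
  forall O (W : 'I_m -> vfield M) H0 H1,
    local_frame V O W -> structure_matrices X O W H0 H1 ->
    forall p j, O p ->
      K p (W j p) = \sum_i curvature_matrix X H0 H1 p i j *: W i p.

(* Smooth section of V along c over A. *)
Definition section_along (R : realType) (n : nat) (M : manifold R n)
    (V : tangent_distribution M) (c : R -> M) (A : set R) (Y : R -> 'rV[R]_n) : Prop :=
  (forall t, A t -> Y t \in V (c t)) /\
  (forall t, A t -> exists N : set R, [/\ open N, N t &
     smooth_curve_on (A `&` N)
       (fun s => in_chart (chart_at (c t)) (c s) (Y s))]).

(* w = (D_X Y)(t), with Y a section of V along c over A. *)
Definition cov_derive_along (R : realType) (n m : nat) (M : manifold R n)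
    (X : vfield M) (V : tangent_distribution M) (c : R -> M) (A : set R)
    (Y : R -> 'rV[R]_n) (t : R) (w : 'rV[R]_n) : Prop :=
  exists O (W : 'I_m -> vfield M) H0 H1 (f : 'I_m -> R -> R^o) (f' : 'I_m -> R),
    [/\ O (c t), local_frame V O W, structure_matrices X O W H0 H1,
        (forall s, A s -> O (c s) -> Y s = \sum_j f j s *: W j (c s)) &
        (forall j, has_deriv_within A (f j) t (f' j)) /\
        w = \sum_j f' j *: W j (c t) +
            2^-1 *: \sum_i \sum_j (f j t * H1 (c t) i j) *: W i (c t)].

Record metric_along (R : realType) (n : nat) (M : manifold R n)
    (V : tangent_distribution M) (c : R -> M) (I : set R)
    (g : R -> 'rV[R]_n -> 'rV[R]_n -> R^o) : Prop := MetricAlong {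
  metric_linear : forall t a u v w, I t ->
    u \in V (c t) -> v \in V (c t) -> w \in V (c t) ->
    g t (a *: u + v) w = a * g t u w + g t v w;
  metric_sym : forall t u v, I t ->
    u \in V (c t) -> v \in V (c t) -> g t u v = g t v u;
  metric_pos : forall t v, I t ->
    v \in V (c t) -> v != 0 -> 0 < g t v v;
  metric_smooth : forall (N : set R) Y Z, open N ->
    section_along V c (I `&` N) Y -> section_along V c (I `&` N) Z ->
    smooth_curve_on (I `&` N) (fun t => g t (Y t) (Z t))
}.

(* X (g (Y, Z)) = g (D_X Y, Z) + g (Y, D_X Z) for local sections Y, Z. *)
Definition invariant_metric (R : realType) (n m : nat) (M : manifold R n)
    (X : vfield M) (V : tangent_distribution M) (c : R -> M) (I : set R)
    (g : R -> 'rV[R]_n -> 'rV[R]_n -> R^o) : Prop :=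
  metric_along V c I g /\
  forall (N : set R) Y Z, open N ->
    section_along V c (I `&` N) Y -> section_along V c (I `&` N) Z ->
    forall t y z, (I `&` N) t ->
      cov_derive_along m X V c (I `&` N) Y t y ->
      cov_derive_along m X V c (I `&` N) Z t z ->
      has_deriv_within (I `&` N) (fun s => g s (Y s) (Z s)) t
        (g t y (Z t) + g t (Y t) z).

Definition directional_curvature (R : realType) (n : nat) (M : manifold R n)
    (c : R -> M) (g : R -> 'rV[R]_n -> 'rV[R]_n -> R^o)
    (K : M -> 'End('rV[R]_n)) (t : R) (v : 'rV[R]_n) : R :=
  g t (K (c t) v) v / g t v v.

Definition closed_orbit (R : realType) (n : nat) (M : manifold R n)
    (T : R) (c : R -> M) : Prop := c 0 = c T.

(* exp(tX)_* V(c(0)) and V(c(t)) intersect nontrivially. *)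
Definition conjugate_time (R : realType) (n : nat) (M : manifold R n)
    (V : tangent_distribution M) (Phi : R -> M -> M) (T : R) (c : R -> M) (t : R)
    : Prop :=
  0 < t <= T /\
  exists v w, [/\ v \in V (c 0), w = pushforward (Phi t) (c 0) v,
                  w \in V (c t) & w != 0].

(* Main.v *)
Require Import Defs.
From HB Require Import structures.
From mathcomp Require Import all_boot all_order all_algebra.
From mathcomp Require Import all_classical all_reals all_analysis.
From mathcomp Require Import ring lra.
Import Order.TTheory GRing.Theory Num.Theory numFieldNormedType.Exports.
Local Open Scope classical_set_scope.
Local Open Scope ring_scope.

(* Let J be the Lie transport of v in V(c(0)) along c. In a frame W of V it
   reads J = W x + [X, W] y: the components of J transverse to the span of
   (W, [X, W]) solve a linear homogeneous equation, so they vanish identically.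
   From [X, J] = 0 one gets x' = - H0 y and y' = - x - H1 y, which says that the
   section Y = W y satisfies D_X D_X Y = - K Y. This Y does not depend on the
   frame, and it vanishes exactly when J is in V. With f = g(Y, Y) and
   p = g(Y, D_X Y), invariance of g gives f' = 2 p and
   p' = g(D_X Y, D_X Y) - g(K Y, Y). If u' = - mu - u^2 and mu >= lambda, then
   (p - u f)' >= g(D_X Y - u Y, D_X Y - u Y) >= 0. Taking u = S'/S, with
   S = cos (sqrt lambda (s - t/2)) or S = 1, two zeros of Y at 0 and t force
   Y = 0 in between, hence J = 0. *)

Set Implicit Arguments.
Unset Strict Implicit.
Unset Printing Implicit Defensive.

(** * Differentiability *)

Section Calculus.
Context {R : realType}.
Implicit Types E F G : normedModType R.

(** Frames, charts and the coordinates x, y exist only near a given time, whereas the comparison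
    needs one pair f, p on all of [0, t]. The local fields Y are glued pointwise: Y is the image of
    J under D / V = V, where no frame enters, so two local choices agree. No such argument is made
    for D_X Y; p is recovered instead as half the derivative of f. Membership of J in D is carried
    along the curve by connectedness, since each local step only relates nearby times. Symmetry of
    second derivatives is needed twice: it makes the bracket independent of the chart, and it yields
    [X, J] = 0 for the differential of the flow. The metric lives on [0, T] only, so the derivatives
    of f and p are one-sided at the ends of [0, T]; the comparison uses two-sided derivatives inside
    and continuity up to the ends. Working with the scalars f and p avoids parallel frames and
    existence theorems for differential equations: uniqueness for linear equations, by a Gronwall
    estimate, is enough. *)

Lemma near_eq_differentiable E F (f g : E -> F) x :
  (\near x, f x = g x) -> differentiable f x -> differentiable g x.
Proof.
move=> fg df.
(* The difference vanishes near x, so it is differentiable with differential 0; adding it to f then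
   gives g. *)
have d0 : differentiable (g - f) x.
  apply/diff_locallyP.
  have h0 : (g - f) \o shift x = cst ((g - f) x) + (\0 : {linear E -> F}) +o_ 0 id.
    apply/eqaddoP => _/posnumP[e].
    have gf : \forall h \near 0, f (h + x) = g (h + x).
      by move: fg; rewrite (near_shift 0); apply: filterS => h /=; rewrite subr0.
    near=> h => /=.
    have -> : ((g - f) \o shift x - (cst ((g - f) x) + (\0 : {linear E -> F}))) h = 0.
      rewrite !fctE /= addr0 (near gf h) // (nbhs_singleton fg) //.
      by rewrite !subrr.
    by rewrite normr0 mulr_ge0.
  have e0 : 'd (g - f) x = (\0 : {linear E -> F}) :> (E -> F).
    by apply: diff_unique => //; exact: cst_continuous.
  by rewrite e0; split => //; exact: cst_continuous.
by have := differentiableD df d0; rewrite addrC subrK.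
Unshelve. all: by end_near. Qed.

Lemma derive_comp E F G (h : E -> F) (f : F -> G) x v :
  differentiable h x -> differentiable f (h x) ->
  'D_v (f \o h) x = 'D_('D_v h x) f (h x).
Proof.
move=> dh df; rewrite (deriveE v (differentiable_comp dh df)) (deriveE _ df) (deriveE _ dh).
by rewrite diff_comp.
Qed.

Lemma derive_lin E F (f : E -> F) x v w (a : R) : differentiable f x ->
  'D_(a *: v + w) f x = a *: 'D_v f x + 'D_w f x.
Proof. by move=> df; rewrite !(deriveE _ df) linearP. Qed.

Lemma derive_suml E F (f : E -> F) x (I : finType) (a : I -> R) (v : I -> E) :
  differentiable f x ->
  'D_(\sum_i a i *: v i) f x = \sum_i a i *: 'D_(v i) f x.
Proof.
move=> df; rewrite (deriveE _ df) linear_sum; apply: eq_bigr => i _.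
by rewrite linearZ /= (deriveE _ df).
Qed.

Lemma differentiable_mxP E m n (f : E -> 'M[R]_(m, n)) x :
  differentiable f x <-> forall i j, differentiable (fun y => f y i j : R^o) x.
Proof.
split=> [df i j|df].
  exact: (differentiable_comp df (differentiable_coord _ i j)).
have -> : f = \sum_(p < m) \sum_(q < n) (fun y => f y p q *: delta_mx p q).
  apply/funext => y; rewrite {1}(matrix_sum_delta (f y)).
  by rewrite fct_sumE; apply: eq_bigr => i _; rewrite fct_sumE.
by do 2 (apply: differentiable_sum => ?); exact: differentiableZl.
Qed.

Lemma derive_coord E m n (f : E -> 'M[R]_(m, n)) x v i j : differentiable f x ->
  ('D_v f x) i j = 'D_v (fun y => f y i j : R^o) x.
Proof. by move=> df; rewrite derive_mx ?mxE //; exact: diff_derivable. Qed.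

Lemma cvg_mxP (T : Type) (F : set_system T) (FF : Filter F) m n
    (f : T -> 'M[R]_(m, n)) (l : 'M[R]_(m, n)) :
  f t @[t --> F] --> l <-> forall i j, (f t i j : R^o) @[t --> F] --> (l i j : R^o).
Proof.
split=> [fl i j|fl].
  exact: (cvg_comp _ _ fl (@coord_continuous _ _ _ i j l)).
apply/cvgrPdist_le => e e0; near=> t.
rewrite /Num.Def.normr/= mx_normrE (bigmax_le _ (ltW e0))//= => i _.
rewrite !mxE/=; move: i; near: t; apply: filter_forall => /= i.
exact: (cvgrPdist_le _ _).1 (fl i.1 i.2) _ e0.
Unshelve. all: by end_near. Qed.

End Calculus.

(** * Smooth functions on open sets *)

Section Ck_theory.
Context {R : realType}.
Implicit Types E F G : normedModType R.

(** [Ck] refers to ['D_v f] as a total function whose values off U carry no information. As U is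
    open, agreement on U passes to all derivatives, so the closure properties below reduce to
    identities on U. *)
Lemma Ck_ext E F k (U : set E) (f g : E -> F) : open U ->
  (forall x, U x -> f x = g x) -> Ck k U f -> Ck k U g.
Proof.
move=> Uo; have nU x : U x -> nbhs x U by move=> Ux; apply: open_nbhs_nbhs.
elim: k f g => [|k IH] f g fg /=.
  move=> cf x Ux; rewrite /prop_for /continuous_at -(fg x Ux); apply: cvg_trans (cf x Ux).
  by apply: near_eq_cvg; apply: filterS (nU x Ux) => y /fg.
move=> [df cf]; split=> [x Ux|v].
  apply: near_eq_differentiable (df x Ux).
  by apply: filterS (nU x Ux) => y /fg.
apply: IH (cf v) => x Ux; apply: near_eq_derive.
by apply: filterS (nU x Ux) => y /fg.
Qed.

Lemma Ck_sub E F k (U U' : set E) (f : E -> F) : U' `<=` U -> Ck k U f -> Ck k U' f.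
Proof.
move=> sU; elim: k f => [|k IH] f /=; first by move=> cf x /sU; exact: cf.
by move=> [df cf]; split=> [x /sU|v]; [exact: df|exact: IH].
Qed.

Lemma CkW E F k (U : set E) (f : E -> F) : Ck k.+1 U f -> Ck k U f.
Proof.
elim: k f => [|k IH] f.
  by move=> [df _] x Ux; apply: differentiable_continuous; exact: df.
by move=> [df cf]; split=> // v; exact: IH.
Qed.

Lemma Ck_cst E F k (U : set E) (a : F) : Ck k U (cst a : E -> F).
Proof.
elim: k a => [|k IH] a; first by move=> x _; exact: cvg_cst.
split=> [x _|v]; first exact: differentiable_cst.
have -> : 'D_v (cst a : E -> F) = cst 0; last exact: IH.
by apply/funext => x; rewrite derive_cst.
Qed.

Lemma CkD E F k (U : set E) (f g : E -> F) : open U ->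
  Ck k U f -> Ck k U g -> Ck k U (fun x => f x + g x).
Proof.
move=> Uo; elim: k f g => [|k IH] f g.
  by move=> cf cg x Ux; apply: cvgD; [exact: cf|exact: cg].
move=> [df cf] [dg cg]; split=> [x Ux|v].
  by apply: differentiableD; [exact: df|exact: dg].
apply: (Ck_ext Uo _ (IH _ _ (cf v) (cg v))) => x Ux.
by rewrite [RHS]deriveD //; apply: diff_derivable; [exact: df|exact: dg].
Qed.

Lemma CkM E k (U : set E) (f g : E -> R^o) : open U ->
  Ck k U f -> Ck k U g -> Ck k U (fun x => f x * g x : R^o).
Proof.
move=> Uo; elim: k f g => [|k IH] f g.
  by move=> cf cg x Ux; apply: (@cvgM R); [exact: cf|exact: cg].
move=> Cf Cg; have [df cf] := Cf; have [dg cg] := Cg; split=> [x Ux|v].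
  by apply: differentiableM; [exact: df|exact: dg].
apply: (Ck_ext Uo _ (CkD Uo (IH _ _ (CkW Cf) (cg v)) (IH _ _ (CkW Cg) (cf v)))).
move=> x Ux.
by rewrite [RHS]deriveM //; apply: diff_derivable; [exact: df|exact: dg].
Qed.

Lemma CkV E k (U : set E) (f : E -> R^o) : open U -> (forall x, U x -> f x != 0) ->
  Ck k U f -> Ck k U (fun x => (f x)^-1 : R^o).
Proof.
move=> Uo f0; elim: k => [|k IH].
  by move=> cf x Ux; apply: (@cvgV R); [exact: f0|exact: cf].
move=> Cf; have [df cf] := Cf; split=> [x Ux|v].
  by apply: differentiableV; [exact: df|exact: f0].
have := CkM Uo (Ck_cst k U (-1 : R^o)) (CkM Uo (CkM Uo (IH (CkW Cf)) (IH (CkW Cf))) (cf v)).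
apply: Ck_ext => // x Ux.
rewrite [RHS]deriveV ?f0 //; last by apply: diff_derivable; exact: df.
by rewrite /cst /= /GRing.scale /= -exprVn expr2 mulN1r mulNr.
Qed.

Lemma Ck_sum E F k (U : set E) (I : Type) (r : seq I) (P : pred I) (f : I -> E -> F) :
  open U -> (forall i, Ck k U (f i)) -> Ck k U (fun x => \sum_(i <- r | P i) f i x).
Proof.
move=> Uo cf; elim: r => [|i r IH].
  by apply: (Ck_ext Uo _ (Ck_cst k U 0)) => x _; rewrite big_nil.
apply: (Ck_ext Uo (f := fun x => (if P i then f i x else 0) + \sum_(i <- r | P i) f i x)).
  by move=> x _; rewrite big_cons; case: (P i); rewrite ?add0r.
apply: CkD => //; case: (P i) => //; exact: (Ck_cst k U 0).
Qed.

Lemma Ck_prod E k (U : set E) (I : Type) (r : seq I) (P : pred I) (f : I -> E -> R^o) :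
  open U -> (forall i, Ck k U (f i)) -> Ck k U (fun x => \prod_(i <- r | P i) f i x : R^o).
Proof.
move=> Uo cf; elim: r => [|i r IH].
  by apply: (Ck_ext Uo _ (Ck_cst k U (1 : R^o))) => x _; rewrite big_nil.
apply: (Ck_ext Uo (f := fun x => (if P i then f i x else 1) * \prod_(i <- r | P i) f i x)).
  by move=> x _; rewrite big_cons; case: (P i); rewrite ?mul1r.
apply: CkM => //; case: (P i) => //; exact: (Ck_cst k U (1 : R^o)).
Qed.

Lemma Ck_mxP E k (U : set E) m n (f : E -> 'M[R]_(m, n)) : open U ->
  Ck k U f <-> forall i j, Ck k U (fun x => f x i j : R^o).
Proof.
move=> Uo; elim: k f => [|k IH] f.
  split=> cf.
    move=> i j x Ux.
    exact: (continuous_comp (cf x Ux) (@coord_continuous _ _ _ i j (f x))).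
  by move=> x Ux; apply/cvg_mxP => i j; exact: cf.
split=> [[df cf] i j|cf].
  split=> [x Ux|v]; first exact: (differentiable_mxP _ _).1 (df x Ux) i j.
  apply: (Ck_ext Uo _ ((IH _).1 (cf v) i j)) => x Ux.
  by rewrite derive_coord //; exact: df.
have df x : U x -> differentiable f x.
  by move=> Ux; apply/differentiable_mxP => i j; exact: (cf i j).1.
split=> // v; apply/IH => i j; apply: (Ck_ext Uo _ ((cf i j).2 v)) => x Ux.
by rewrite derive_coord //; exact: df.
Qed.

(** The differential w of h is constant, so a derivative of [f \o h] is again a derivative of f
    composed with h, and the induction needs no products. This serves the slices s |-> (s, x0),
    which take values in a product and not in a space of rows. *)
Lemma Ck_affine E F G k (U : set F) (h : E -> F) (w : E -> F) (f : F -> G) (U' : set E) :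
  open U' -> (forall x, differentiable h x) -> (forall x v, 'D_v h x = w v) ->
  (forall x, U' x -> U (h x)) -> Ck k U f -> Ck k U' (f \o h).
Proof.
move=> Uo dh hw UU; elim: k f => [|k IH] f.
  move=> cf x Ux; apply: (continuous_comp (differentiable_continuous (dh x))).
  by apply: cf; exact: UU.
move=> [df cf]; split=> [x Ux|v].
  by apply: differentiable_comp => //; apply: df; exact: UU.
apply: (Ck_ext Uo _ (IH _ (cf (w v)))) => x Ux /=.
by rewrite [RHS](derive_comp v (dh x)) ?hw //; apply: df; exact: UU.
Qed.

Lemma derive_rV n F (f : 'rV[R]_n -> F) x v : differentiable f x ->
  'D_v f x = \sum_i v 0 i *: 'D_(delta_mx 0 i) f x.
Proof. by move=> df; rewrite {1}(row_sum_delta v) derive_suml. Qed.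

(** In coordinates the chain rule reads D_v (f o h) = sum_i (D_v h)_i (d_i f o h): a sum of products
    of scalar functions of one class less, to which the induction hypothesis applies. *)
Lemma Ck_comp_scalar E n k (U : set E) (U' : set 'rV[R]_n) (h : E -> 'rV[R]_n)
    (f : 'rV[R]_n -> R^o) :
  open U -> (forall x, U x -> U' (h x)) -> Ck k U h -> Ck k U' f -> Ck k U (f \o h).
Proof.
move=> Uo UU; elim: k f => [|k IH] f.
  move=> ch cf x Ux; apply: continuous_comp; first exact: ch.
  by apply: cf; exact: UU.
move=> Ch Cf; have [dh ch] := Ch; have [df cf] := Cf; split=> [x Ux|v].
  by apply: differentiable_comp; [exact: dh|apply: df; exact: UU].
have Cc i := (Ck_mxP _ _ Uo).1 (ch v) 0 i.
apply: (Ck_ext Uo _ (Ck_sum _ predT Uo (fun i =>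
  CkM Uo (Cc i) (IH _ (CkW Ch) (cf (delta_mx 0 i)))))).
move=> x Ux; rewrite [RHS]derive_comp; [|exact: dh|by apply: df; exact: UU].
by rewrite [RHS]derive_rV //; apply: df; exact: UU.
Qed.

Lemma Ck_comp E n p q k (U : set E) (U' : set 'rV[R]_n) (h : E -> 'rV[R]_n)
    (f : 'rV[R]_n -> 'M[R]_(p, q)) :
  open U -> open U' -> (forall x, U x -> U' (h x)) -> Ck k U h -> Ck k U' f -> Ck k U (f \o h).
Proof.
move=> Uo U'o UU ch /(Ck_mxP _ _ U'o) cf; apply/Ck_mxP => // i j.
exact: (Ck_comp_scalar Uo UU ch (cf i j)).
Qed.

Lemma smooth_on_differentiable E F (U : set E) (f : E -> F) x :
  smooth_on U f -> U x -> differentiable f x.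
Proof. by move=> /(_ 1%N) [df _]; exact: df. Qed.

Lemma smooth_on_derive E F (U : set E) (f : E -> F) v :
  smooth_on U f -> smooth_on U ('D_v f).
Proof. by move=> sf k; exact: (sf k.+1).2. Qed.

Lemma smooth_on_continuous E F (U : set E) (f : E -> F) x :
  smooth_on U f -> U x -> {for x, continuous f}.
Proof. by move=> sf Ux; exact: (sf 0%N). Qed.

(** The direction varies with the point, so this is not an iterated ['D_v]; expanding the direction
    in the standard basis reduces it to fixed directions. Brackets of fields are of this form. *)
Lemma smooth_on_derive_along n (U : set 'rV[R]_n) (p q : nat) (f : 'rV[R]_n -> 'M[R]_(p, q))
    (h : 'rV[R]_n -> 'rV[R]_n) :
  open U -> smooth_on U f -> smooth_on U h -> smooth_on U (fun y => 'D_(h y) f y).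
Proof.
move=> Uo sf sh k; apply/Ck_mxP => // i j.
have Ch := (Ck_mxP _ _ Uo).1 (sh k) 0.
have Cf l := (Ck_mxP _ _ Uo).1 (smooth_on_derive (delta_mx 0 l) sf k) i j.
apply: (Ck_ext Uo _ (Ck_sum _ predT Uo (fun l => CkM Uo (Ch l) (Cf l)))).
move=> x Ux; rewrite [in RHS]derive_rV; last exact: smooth_on_differentiable sf Ux.
by rewrite summxE; apply: eq_bigr => l _; rewrite mxE.
Qed.

End Ck_theory.

(** * Symmetry of second derivatives *)

Section Schwarz.
Context {R : realType}.
Implicit Types E F G : normedModType R.

Lemma is_derive_line E F (f : E -> F) (u a : E) (s : R) :
  differentiable f (s *: u + a) ->
  is_derive s 1 (fun s => f (s *: u + a)) ('D_u f (s *: u + a)).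
Proof.
move=> df.
have dl : differentiable (fun s : R^o => s *: u + a) s.
  apply: (@differentiableD _ _ _ (fun s : R^o => s *: u) (cst a)).
    exact: differentiableZl.
  exact: differentiable_cst.
have -> : 'D_u f (s *: u + a) = 'D_1 (f \o (fun s : R^o => s *: u + a)) s.
  rewrite (derive_comp _ dl df); congr ('D__ f _).
  rewrite (@deriveD _ _ _ (fun s : R^o => s *: u) (cst a)); last 2 first.
  - by apply/diff_derivable; exact: differentiableZl.
  - exact: derivable_cst.
  rewrite derive_cst addr0 deriveE; last exact: differentiableZl.
  rewrite diffZl //= (@diff_lin _ _ _ idfun); first by rewrite /= scale1r.
  by move=> z; exact: cvg_id.
apply: derivableP; apply: diff_derivable.
exact: (differentiable_comp dl df).
Qed.

(* Exchanging u and v leaves the left-hand side of the equation unchanged. *)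
Lemma mean_value_square E (f : E -> R^o) (x u v : E) (r : R) : 0 < r ->
  (forall s t, 0 <= s <= r -> 0 <= t <= r -> differentiable f (s *: u + (t *: v + x))) ->
  (forall s t, 0 <= s <= r -> 0 <= t <= r ->
     differentiable ('D_u f) (s *: u + (t *: v + x))) ->
  exists s t, [/\ 0 <= s <= r, 0 <= t <= r &
    f (r *: u + (r *: v + x)) - f (r *: u + x) - f (r *: v + x) + f x =
    r ^+ 2 * 'D_v ('D_u f) (s *: u + (t *: v + x))].
Proof.
move=> r0 df ddf.
have rr : 0 <= r <= r by rewrite lexx ltW.
have r00 : 0 <= (0 : R) <= r by rewrite lexx ltW.
have df0 s : 0 <= s <= r -> differentiable f (s *: u + x).
  by move=> sr; have := df s 0 sr r00; rewrite scale0r add0r.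
(* The second difference is the increment of [phi] over [0, r]. One mean value in s turns it into an
   increment of ['D_u f] in the direction v, and a second one in t finishes. *)
pose phi s := f (s *: u + (r *: v + x)) - f (s *: u + x).
pose dphi s := 'D_u f (s *: u + (r *: v + x)) - 'D_u f (s *: u + x).
have phid s : 0 <= s <= r -> is_derive s 1 phi (dphi s).
  move=> sr; apply: is_deriveB; apply: is_derive_line; [exact: df|exact: df0].
have [s sr es] : exists2 s, s \in `]0, r[%R & phi r - phi 0 = dphi s * (r - 0).
  apply: (@MVT R phi dphi 0 r r0) => [s|].
    by rewrite in_itv /= => /andP[? ?]; apply: phid; rewrite !ltW.
  apply: derivable_within_continuous => s; rewrite in_itv /= => /phid.
  by case.
have {}sr : 0 <= s <= r by move: sr; rewrite in_itv /= => /andP[? ?]; rewrite !ltW.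
pose psi t := 'D_u f (t *: v + (s *: u + x)).
have psid t : 0 <= t <= r -> is_derive t 1 psi ('D_v ('D_u f) (t *: v + (s *: u + x))).
  by move=> tr; apply: is_derive_line; rewrite addrCA; exact: ddf.
have [t tr et] : exists2 t, t \in `]0, r[%R &
    psi r - psi 0 = 'D_v ('D_u f) (t *: v + (s *: u + x)) * (r - 0).
  apply: (@MVT R psi (fun t => 'D_v ('D_u f) (t *: v + (s *: u + x))) 0 r r0) => [t|].
    by rewrite in_itv /= => /andP[? ?]; apply: psid; rewrite !ltW.
  apply: derivable_within_continuous => t; rewrite in_itv /= => /psid.
  by case.
exists s, t; split => //.
  by move: tr; rewrite in_itv /= => /andP[? ?]; rewrite !ltW.
have ephi : dphi s = psi r - psi 0 by rewrite /dphi /psi scale0r add0r addrCA.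
rewrite [X in 'D_v _ X]addrCA expr2 -mulrA mulrC -[in RHS](subr0 r).
rewrite [X in _ = X * _]mulrC -et -ephi -es /phi !scale0r !add0r.
by rewrite opprB -[LHS]addrA [- f (r *: v + x) + f x]addrC.
Qed.

(** Both mixed derivatives, taken at suitable points near x, equal the same second difference
    divided by r^2. Continuity of the two at x then bounds their distance at x by any e > 0. *)
Lemma derive_sym E (U : set E) (f : E -> R^o) (x u v : E) : open U -> U x ->
  Ck 2 U f -> 'D_u ('D_v f) x = 'D_v ('D_u f) x.
Proof.
move=> Uo Ux Cf; have [df Cdf] := Cf.
have dd w y : U y -> differentiable ('D_w f) y by exact: (Cdf w).1.
have cc w z : {for x, continuous ('D_z ('D_w f))} by apply: ((Cdf w).2 z).
apply/eqP; rewrite -subr_eq0 -normr_le0; apply/ler_addgt0Pr => e e0; rewrite add0r.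
have e2 : 0 < e / 2 by rewrite divr_gt0.
have := (cvgrPdist_le _ _).1 (cc v u) _ e2; have := (cvgrPdist_le _ _).1 (cc u v) _ e2.
have Un : nbhs x U by apply: open_nbhs_nbhs.
move=> n1 n2; have : nbhs x [set y | U y /\
    (`|'D_v ('D_u f) x - 'D_v ('D_u f) y| <= e / 2 /\
     `|'D_u ('D_v f) x - 'D_u ('D_v f) y| <= e / 2)].
  exact: (filterI Un (filterI (n1 _) (n2 _))).
move=> /nbhs_ballP[d /= d0 dP].
pose c := `|u| + `|v| + 1.
have c0 : 0 < c by rewrite ltr_wpDl // addr_ge0.
(* With this r the parallelogram x + s u + t v, 0 <= s, t <= r, stays within r c = d / 2 of x. *)
pose r := d / (2 * c).
have r0 : 0 < r by rewrite divr_gt0 // mulr_gt0.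
have inb s t : 0 <= s <= r -> 0 <= t <= r -> ball x d (s *: u + (t *: v + x)).
  move=> /andP[s0 sr] /andP[t0 tr].
  rewrite -ball_normE /= distrC addrA addrK.
  apply: (@le_lt_trans _ _ (r * c)); last first.
    by rewrite /r invfM mulrA mulfVK ?gt_eqF // ltr_pdivrMr // ltr_pMr // ltr1n.
  apply: (le_trans (ler_normD _ _)); rewrite !normrZ !ger0_norm //.
  rewrite /c -addrA mulrDr lerD ?ler_wpM2r // mulrDr mulr1.
  by rewrite (le_trans (ler_wpM2r _ tr)) // lerDl ltW.
have H s t (sr : 0 <= s <= r) (tr : 0 <= t <= r) := dP _ (inb s t sr tr).
have [s [t [sr tr E1]]] : exists s t, [/\ 0 <= s <= r, 0 <= t <= r &
    f (r *: u + (r *: v + x)) - f (r *: u + x) - f (r *: v + x) + f x =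
    r ^+ 2 * 'D_v ('D_u f) (s *: u + (t *: v + x))].
  apply: mean_value_square => // s t sr tr; have [Us _] := H s t sr tr; first exact: df.
  exact: dd.
have [t' [s' [tr' sr' E2]]] : exists t s, [/\ 0 <= t <= r, 0 <= s <= r &
    f (r *: v + (r *: u + x)) - f (r *: v + x) - f (r *: u + x) + f x =
    r ^+ 2 * 'D_u ('D_v f) (t *: v + (s *: u + x))].
  apply: mean_value_square => // t' s' tr' sr'; have [Us _] := H s' t' sr' tr'.
    by rewrite addrCA; exact: df.
  by rewrite addrCA; exact: dd.
have E12 : 'D_v ('D_u f) (s *: u + (t *: v + x)) = 'D_u ('D_v f) (s' *: u + (t' *: v + x)).
  apply: (@mulfI _ (r ^+ 2)); first by rewrite expf_neq0 ?gt_eqF.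
  have eP : s' *: u + (t' *: v + x) = t' *: v + (s' *: u + x) by rewrite addrCA.
  have eQ : r *: u + (r *: v + x) = r *: v + (r *: u + x) by rewrite addrCA.
  have sw (y1 y2 y3 y4 : R) : y1 - y2 - y3 + y4 = y1 - y3 - y2 + y4.
    by rewrite (addrAC y1).
  rewrite eP; apply: (etrans (esym E1)); apply: etrans E2; rewrite -eQ; exact: sw.
have [_ [/= A1 A2]] := H s t sr tr.
have [_ [/= B1 B2]] := H s' t' sr' tr'.
apply: (le_trans (ler_distD ('D_u ('D_v f) (s' *: u + (t' *: v + x))) _ _)).
rewrite (splitr e); apply: lerD; first exact: B2.
by rewrite -E12 distrC; exact: A1.
Qed.

Lemma derive_sym_mx E m n (U : set E) (f : E -> 'M[R]_(m, n)) (x u v : E) :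
  open U -> U x -> smooth_on U f -> 'D_u ('D_v f) x = 'D_v ('D_u f) x.
Proof.
move=> Uo Ux sf; have nU : nbhs x U by exact: open_nbhs_nbhs.
have sd w := smooth_on_derive w sf.
apply/matrixP => i j.
have Cf := (Ck_mxP _ _ Uo).1 (sf 2%N) i j.
have e w z : ('D_z ('D_w f) x) i j = 'D_z ('D_w (fun y => f y i j : R^o)) x.
  apply: (etrans (derive_coord z i j (smooth_on_differentiable (sd w) Ux))).
  apply: near_eq_derive; apply: filterS nU => y Uy.
  by apply: derive_coord; exact: smooth_on_differentiable sf Uy.
apply: (etrans (e v u)); apply: etrans (esym (e u v)).
exact: derive_sym Uo Ux Cf.
Qed.

End Schwarz.

(** * Algebra of smooth maps, inverse matrices and coordinates in a smooth frame *)

Section SmoothOn.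
Context {R : realType}.
Implicit Types E F G : normedModType R.

Lemma smooth_on_ext E F (U : set E) (f g : E -> F) : open U ->
  (forall x, U x -> f x = g x) -> smooth_on U f -> smooth_on U g.
Proof. by move=> Uo fg sf k; exact: Ck_ext (sf k). Qed.

Lemma smooth_on_sub E F (U U' : set E) (f : E -> F) :
  U' `<=` U -> smooth_on U f -> smooth_on U' f.
Proof. by move=> UU sf k; exact: Ck_sub (sf k). Qed.

Lemma smooth_on_cst E F (U : set E) (a : F) : smooth_on U (cst a : E -> F).
Proof. by move=> k; exact: Ck_cst. Qed.

Lemma smooth_onD E F (U : set E) (f g : E -> F) : open U ->
  smooth_on U f -> smooth_on U g -> smooth_on U (fun x => f x + g x).
Proof. by move=> Uo sf sg k; exact: CkD. Qed.

Lemma smooth_onM E (U : set E) (f g : E -> R^o) : open U ->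
  smooth_on U f -> smooth_on U g -> smooth_on U (fun x => f x * g x : R^o).
Proof. by move=> Uo sf sg k; exact: CkM. Qed.

Lemma smooth_on_sum E F (U : set E) (I : Type) (r : seq I) (P : pred I) (f : I -> E -> F) :
  open U -> (forall i, smooth_on U (f i)) ->
  smooth_on U (fun x => \sum_(i <- r | P i) f i x).
Proof. by move=> Uo sf k; apply: Ck_sum => // i; exact: sf. Qed.

Lemma smooth_on_prod E (U : set E) (I : Type) (r : seq I) (P : pred I) (f : I -> E -> R^o) :
  open U -> (forall i, smooth_on U (f i)) ->
  smooth_on U (fun x => \prod_(i <- r | P i) f i x : R^o).
Proof. by move=> Uo sf k; apply: Ck_prod => // i; exact: sf. Qed.

Lemma smooth_on_mxP E (U : set E) m n (f : E -> 'M[R]_(m, n)) : open U ->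
  smooth_on U f <-> forall i j, smooth_on U (fun x => f x i j : R^o).
Proof.
move=> Uo; split=> [sf i j k|sf k]; first exact: (Ck_mxP _ _ Uo).1.
by apply/Ck_mxP => // i j; exact: sf.
Qed.

Lemma smooth_on_comp E n p q (U : set E) (U' : set 'rV[R]_n) (h : E -> 'rV[R]_n)
    (f : 'rV[R]_n -> 'M[R]_(p, q)) :
  open U -> open U' -> (forall x, U x -> U' (h x)) ->
  smooth_on U h -> smooth_on U' f -> smooth_on U (f \o h).
Proof. by move=> Uo U'o UU sh sf k; exact: (Ck_comp Uo U'o UU (sh k) (sf k)). Qed.

Lemma smooth_on_mulmx E (U : set E) m n p (f : E -> 'M[R]_(m, n))
    (g : E -> 'M[R]_(n, p)) : open U -> smooth_on U f -> smooth_on U g ->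
  smooth_on U (fun x => f x *m g x).
Proof.
move=> Uo /(smooth_on_mxP _ Uo) sf /(smooth_on_mxP _ Uo) sg.
apply/smooth_on_mxP => // i j.
apply: (smooth_on_ext Uo (f := fun x => \sum_l (f x i l * g x l j : R^o))).
  by move=> x _; rewrite mxE.
apply: smooth_on_sum => // l.
exact: smooth_onM.
Qed.

Lemma smooth_onZ E (U : set E) m n (a : E -> R^o) (f : E -> 'M[R]_(m, n)) : open U ->
  smooth_on U a -> smooth_on U f -> smooth_on U (fun x => a x *: f x).
Proof.
move=> Uo sa /(smooth_on_mxP _ Uo) sf; apply/smooth_on_mxP => // i j.
apply: (smooth_on_ext Uo (f := fun x => (a x * f x i j : R^o))).
  by move=> x _; rewrite mxE.
exact: smooth_onM.
Qed.

Lemma smooth_on_scale E F (U : set E) (b : R) (f : E -> F) : open U ->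
  smooth_on U f -> smooth_on U (fun x => b *: f x).
Proof.
move=> Uo sf k; elim: k f sf => [|k IH] f sf.
  by move=> x Ux; apply: cvgZl_tmp; exact: smooth_on_continuous sf Ux.
split=> [x Ux|v].
  by apply: differentiableZ; exact: smooth_on_differentiable sf Ux.
apply: (Ck_ext Uo _ (IH _ (smooth_on_derive v sf))) => x Ux.
apply: (esym (deriveZ _ _)); apply: diff_derivable.
exact: smooth_on_differentiable sf Ux.
Qed.

Lemma smooth_onB E F (U : set E) (f g : E -> F) : open U ->
  smooth_on U f -> smooth_on U g -> smooth_on U (fun x => f x - g x).
Proof.
move=> Uo sf sg.
apply: (smooth_on_ext Uo _ (smooth_onD Uo sf (smooth_on_scale (-1) Uo sg))).
by move=> x _; rewrite scaleN1r.
Qed.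

Lemma smooth_on_det E (U : set E) n (A : E -> 'M[R]_n) : open U ->
  smooth_on U A -> smooth_on U (fun x => \det (A x) : R^o).
Proof.
move=> Uo /(smooth_on_mxP _ Uo) sA; apply: smooth_on_sum => // s.
apply: smooth_onM => //; first exact: smooth_on_cst.
by apply: smooth_on_prod => // i.
Qed.

Lemma smooth_on_invmx E (U : set E) n (A : E -> 'M[R]_n) : open U ->
  (forall x, U x -> A x \in unitmx) ->
  smooth_on U A -> smooth_on U (fun x => invmx (A x)).
Proof.
move=> Uo uA sA.
apply: (smooth_on_ext Uo (f := fun x => ((\det (A x))^-1 : R^o) *: \adj (A x))).
  by move=> x Ux; rewrite /invmx uA.
apply: smooth_onZ => //.
  move=> k; apply: CkV => //; last exact: smooth_on_det.
  by move=> x Ux; have := uA x Ux; rewrite unitmxE unitfE.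
apply/smooth_on_mxP => // i j.
apply: (smooth_on_ext Uo (f := fun x => ((-1) ^+ (j + i) : R^o) * \det (row' j (col' i (A x))))).
  by move=> x Ux; rewrite mxE.
apply: smooth_onM => //; first exact: smooth_on_cst.
apply: smooth_on_det => //; apply/smooth_on_mxP => // p q.
apply: (smooth_on_ext Uo _ ((smooth_on_mxP _ Uo).1 sA (lift j p) (lift i q))).
by move=> x _; rewrite !mxE.
Qed.

(** A right inverse L of A x0 is kept fixed: det (A x L) equals 1 at x0 and is continuous, so A x L
    stays invertible nearby. *)
Lemma row_free_nbhs E (U : set E) k n (A : E -> 'M[R]_(k, n)) x0 :
  open U -> U x0 -> smooth_on U A -> row_free (A x0) ->
  exists (U' : set E) (L : 'M[R]_(n, k)), [/\ open U', U' x0, U' `<=` U &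
    forall x, U' x -> A x *m L \in unitmx].
Proof.
move=> Uo Ux sA /row_freeP[L AL].
have sd : smooth_on U (fun x => \det (A x *m L) : R^o).
  by apply: smooth_on_det => //; apply: smooth_on_mulmx => //; exact: smooth_on_cst.
exists (U `&` [set x | \forall y \near x, A y *m L \in unitmx])%classic, L; split.
- by apply: openI => //; exact: open_interior.
- split => //=.
  have := smooth_on_continuous sd Ux; rewrite /prop_for /continuous_at AL det1 => c.
  have : \forall y \near x0, \det (A y *m L) != 0.
    apply: (c [set z | z != 0]).
    by apply: open_nbhs_nbhs; split; [exact: open_neq|exact: oner_neq0].
  by apply: filterS => y; rewrite unitmxE unitfE.
- by move=> x [].
- by move=> x [_ /nbhs_singleton].
Qed.

(** Nothing is assumed on the regularity of h, which usually comes from a choice of coordinates at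
    each point: h = b L (A L)^-1 forces it to be smooth. *)
Lemma smooth_on_coords E (U : set E) k l n (A : E -> 'M[R]_(k, n)) (L : 'M[R]_(n, k))
    (b : E -> 'M[R]_(l, n)) (h : E -> 'M[R]_(l, k)) :
  open U -> (forall x, U x -> A x *m L \in unitmx) -> smooth_on U A ->
  smooth_on U b -> (forall x, U x -> b x = h x *m A x) -> smooth_on U h.
Proof.
move=> Uo uA sA sb bh.
apply: (smooth_on_ext Uo (f := fun x => (b x *m L) *m invmx (A x *m L))).
  by move=> x Ux; rewrite bh // -(mulmxA (h x)) mulmxK // uA.
have sL : smooth_on U (cst L : E -> _) by exact: smooth_on_cst.
apply: smooth_on_mulmx => //; first exact: smooth_on_mulmx.
by apply: smooth_on_invmx => //; exact: smooth_on_mulmx.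
Qed.

End SmoothOn.

(** * Functions of one variable *)

Section OneVariable.
Context {R : realType}.
Implicit Types (F : normedModType R) (A : set R).

Lemma has_deriv_withinP F A (f : R -> F) t l : has_deriv_within A f t l <->
  forall e, 0 < e -> exists2 d, 0 < d & forall s, A s -> s != t -> `|s - t| < d ->
    `|l - (s - t)^-1 *: (f s - f t)| <= e.
Proof.
split=> [H e e0|H].
  move/cvgrPdist_le : H => /(_ e e0) /nbhs_ballP[d /= d0 dP].
  exists d => // s As st sd; apply: dP => //.
  by rewrite -ball_normE /= distrC.
apply/cvgrPdist_le => e e0; have [d d0 dP] := H e e0.
suff : nbhs t [set s | s != t -> A s -> `|l - (s - t)^-1 *: (f s - f t)| <= e] by [].
apply/nbhs_ballP; exists d => // s; rewrite -ball_normE /= => sd st As.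
by apply: dP => //; rewrite distrC.
Qed.

Lemma is_derive_deriv_within F A (f : R -> F) (t : R) l :
  is_derive t 1 f l -> has_deriv_within A f t l.
Proof.
move=> df; apply/has_deriv_withinP => e e0.
have fl : h^-1 *: (f (h *: 1 + t) - f t) @[h --> 0^'] --> l.
  have [dv <-] := df; exact: dv.
move/cvgrPdist_le : fl => /(_ e e0) /nbhs_ballP[d /= d0 dP].
exists d => // s As st sd; have := dP (s - t); rewrite -ball_normE /= sub0r normrN.
have -> : (s - t) *: 1 + t = s by rewrite -[RHS](subrK t); congr (_ + t); exact: mulr1.
by apply => //; rewrite subr_eq0.
Qed.

Lemma deriv_within_is_derive F A (f : R -> F) (t : R) l : nbhs t A ->
  has_deriv_within A f t l -> is_derive t 1 f l.
Proof.
move=> /nbhs_ballP[r /= r0 rA] /has_deriv_withinP H.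
have fl : h^-1 *: (f (h *: 1 + t) - f t) @[h --> 0^'] --> l.
  apply/cvgrPdist_le => e e0; have [d d0 dP] := H e e0.
  suff : nbhs 0 [set h | h != 0 -> `|l - h^-1 *: (f (h *: 1 + t) - f t)| <= e] by [].
  apply/nbhs_ballP; exists (Num.min d r); first by rewrite /= lt_min d0.
  move=> h; rewrite -ball_normE /= sub0r normrN lt_min => /andP[hd hr] h0.
  have := dP (h + t); have -> : h *: 1 + t = h + t by congr (_ + t); exact: mulr1.
  rewrite addrK; apply => //.
    by apply: rA; rewrite -ball_normE /= distrC addrK.
  by rewrite -subr_eq0 addrK.
apply: DeriveDef; first by apply/cvg_ex; exists l.
exact: cvg_lim fl.
Qed.

Lemma has_deriv_within_sub F A B (f g : R -> F) t l (N : set R) : nbhs t N ->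
  (forall s, N s -> B s -> A s) -> (forall s, N s -> B s -> f s = g s) -> f t = g t ->
  has_deriv_within A f t l -> has_deriv_within B g t l.
Proof.
move=> /nbhs_ballP[r /= r0 rN] NAB fg fgt /has_deriv_withinP H.
apply/has_deriv_withinP => e e0; have [d d0 dP] := H e e0.
exists (Num.min d r); first by rewrite lt_min d0.
move=> s Bs st; rewrite lt_min => /andP[sd sr].
have Ns : N s by apply: rN; rewrite -ball_normE /= distrC.
by rewrite -fgt -fg //; apply: dP => //; exact: NAB.
Qed.

Lemma has_deriv_within_continuous F A (f : R -> F) t l : A t ->
  has_deriv_within A f t l -> f s @[s --> within A (nbhs t)] --> f t.
Proof.
move=> At /has_deriv_withinP H; have [d d0 dP] := H 1 ltr01.
pose c := `|l| + 1; have c0 : 0 < c by rewrite ltr_wpDl.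
apply/cvgrPdist_le => e e0.
suff : nbhs t [set s | A s -> `|f t - f s| <= e] by [].
apply/nbhs_ballP.
exists (Num.min d (e / c)); first by rewrite /= lt_min d0 divr_gt0.
move=> s; rewrite -ball_normE /= lt_min => /andP[sd se] As.
have [->|st] := eqVneq s t; first by rewrite subrr normr0 ltW.
have st0 : s - t != 0 by rewrite subr_eq0.
have B : `|(s - t)^-1 *: (f s - f t)| <= c.
  rewrite -[X in `|X|]opprK -[X in - X](addKr l) opprD opprK.
  apply: (le_trans (ler_normB _ _)); rewrite lerD2l.
  by apply: dP => //; rewrite distrC.
have -> : f t - f s = - ((s - t) *: ((s - t)^-1 *: (f s - f t))).
  by rewrite scalerA divff // scale1r opprB.
rewrite normrN normrZ distrC (le_trans (ler_wpM2l _ B)) //.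
by rewrite -ler_pdivlMr // ltW.
Qed.

Lemma has_deriv_within_unique F A (f : R -> F) t l l' :
  (forall d, 0 < d -> exists s, [/\ A s, s != t & `|s - t| < d]) ->
  has_deriv_within A f t l -> has_deriv_within A f t l' -> l = l'.
Proof.
move=> lim /has_deriv_withinP H /has_deriv_withinP H'.
apply/eqP; rewrite -subr_eq0 -normr_le0; apply/ler_addgt0Pr => e e0; rewrite add0r.
have e2 : 0 < e / 2 by rewrite divr_gt0.
have [d d0 dP] := H _ e2; have [d' d'0 dP'] := H' _ e2.
have [|s [As st]] := lim (Num.min d d'); first by rewrite lt_min d0.
rewrite lt_min => /andP[sd sd'].
have B := dP s As st sd; have B' := dP' s As st sd'.
rewrite (le_trans (ler_distD ((s - t)^-1 *: (f s - f t)) _ _)) //.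
by rewrite (splitr e) lerD // distrC.
Qed.

(** Makes one-sided derivatives unique at the ends of a segment: the witness lies to the right of s,
    except at s = b, where it lies to the left. *)
Lemma segment_limit_point (a b s d : R) : a < b -> a <= s <= b -> 0 < d ->
  exists s', [/\ a <= s' <= b, s' != s & `|s' - s| < d].
Proof.
move=> ab /andP[as_ sb] d0.
have half (e : R) : 0 < e -> 0 < Num.min e (d / 2) /\ Num.min e (d / 2) < d.
  move=> e0; split; first by rewrite lt_min e0 divr_gt0.
  by rewrite gt_min ltr_pdivrMr // ltr_pMr // ltr1n orbT.
have [sb'|bs] := ltP s b.
  have [e0 ed] : 0 < Num.min (b - s) (d / 2) /\ Num.min (b - s) (d / 2) < d.
    by apply: half; rewrite subr_gt0.
  exists (s + Num.min (b - s) (d / 2)); split.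
  - rewrite (le_trans as_) ?lerDl ?(ltW e0) //=.
    by rewrite -lerBrDl ge_min lexx.
  - by rewrite gt_eqF // ltrDl.
  - by rewrite addrAC subrr add0r gtr0_norm.
have {}bs : s = b by apply/eqP; rewrite eq_le sb bs.
have [e0 ed] : 0 < Num.min (b - a) (d / 2) /\ Num.min (b - a) (d / 2) < d.
  by apply: half; rewrite subr_gt0.
exists (s - Num.min (b - a) (d / 2)); split.
- apply/andP; split; last by rewrite (le_trans _ sb) // gerBl ltW.
  by rewrite bs lerBrDl -lerBrDr ge_min lexx.
- by rewrite lt_eqF // gtrBl.
- by rewrite addrAC subrr add0r normrN gtr0_norm.
Qed.

Lemma smooth_on_curve F (N A : set R) (f : R^o -> F) : A `<=` N ->
  smooth_on N f -> smooth_curve_on A f.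
Proof.
move=> AN sf.
pose D k := iter k (fun h : R^o -> F => 'D_1 h) f.
have sD k : smooth_on N (D k).
  by elim: k => [|k IH] //=; exact: smooth_on_derive.
exists D; split=> // k t At; apply: is_derive_deriv_within.
apply: derivableP; apply: diff_derivable; apply: smooth_on_differentiable (sD k) _.
exact: AN.
Qed.

Lemma smooth_on_is_derive F (N : set R) (f : R^o -> F) (s : R) :
  smooth_on N f -> N s -> is_derive s 1 f ('D_1 f s).
Proof.
by move=> sf Ns; apply: derivableP; apply: diff_derivable; exact: smooth_on_differentiable sf Ns.
Qed.

Lemma is_derive_mxP (E : normedModType R) m n (f : E -> 'M[R]_(m, n)) (x v : E)
    (l : 'M[R]_(m, n)) :
  is_derive x v f l <-> forall i j, is_derive x v (fun t => f t i j : R^o) (l i j).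
Proof.
split=> [df i j|df].
  apply: DeriveDef; first by apply: (derivable_mxP f x v).1; case: df.
  by have [dv <-] := df; rewrite derive_mx // mxE.
have dv : derivable f x v by apply/derivable_mxP => i j; case: (df i j).
apply: DeriveDef => //; rewrite derive_mx //; apply/matrixP => i j.
by rewrite mxE; case: (df i j).
Qed.

Lemma is_derive_mulmx (E : normedModType R) m n p (f : E -> 'M[R]_(m, n))
    (g : E -> 'M[R]_(n, p)) (x v : E) f' g' :
  is_derive x v f f' -> is_derive x v g g' ->
  is_derive x v (fun t => f t *m g t) (f' *m g x + f x *m g').
Proof.
move=> /is_derive_mxP df /is_derive_mxP dg; apply/is_derive_mxP => i j.
have H := is_derive_sum (fun l => is_deriveM (df i l) (dg l j)); rewrite !mxE.
have -> : (fun t => (f t *m g t) i j) =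
    \sum_(l < n) ((fun t => f t i l : R^o) * (fun t => g t l j : R^o)).
  by apply/funext => t; rewrite mxE fct_sumE.
apply: is_derive_eq; rewrite -big_split /=; apply: eq_bigr => l _.
by rewrite addrC [f' i l * _]mulrC.
Qed.

(** Gronwall in both directions: e' <= C e makes exp(- C s) e nonincreasing, which settles the times
    after s1, and e' >= - C e makes exp(C s) e nondecreasing, which settles those before. *)
Lemma le_derive_eq0 (e : R -> R) (e' : R -> R) (a b C s1 : R) :
  (forall s, a < s < b -> is_derive s 1 e (e' s)) ->
  (forall s, a < s < b -> 0 <= e s) ->
  (forall s, a < s < b -> `|e' s| <= C * e s) ->
  a < s1 < b -> e s1 = 0 -> forall s, a < s < b -> e s = 0.
Proof.
move=> de e0 ee s1ab es1 s sab.
have key (k : R) t : a < t < b ->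
    is_derive t 1 (fun t => expR (k * t) * e t) (expR (k * t) * (e' t + k * e t)).
  move=> tab; have := de t tab => ?.
  have ? : is_derive t 1 (fun t => expR (k * t)) (expR (k * t) * k).
    have -> : (fun t => expR (k * t)) = expR \o ( *%R k) by [].
    apply: is_derive1_comp; apply: is_derive_eq; exact: mulr1.
  have ? := is_deriveM _ _.
  apply: is_derive_eq; rewrite /GRing.scale /=; ring.
have sub x y z : x \in `]y, z[%R -> a < y -> z < b -> a < x < b.
  by rewrite in_itv /= => /andP[yx xz] ay zb; rewrite (lt_trans ay yx) (lt_trans xz zb).
have subc x y z : x \in `[y, z]%R -> a < y -> z < b -> a < x < b.
  by rewrite in_itv /= => /andP[yx xz] ay zb; rewrite (lt_le_trans ay yx) (le_lt_trans xz zb).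
have [as1 s1b] := andP s1ab; have [as_ sb] := andP sab.
apply/eqP; rewrite eq_le e0 // andbT.
have cont k y z : a < y -> z < b -> {within `[y, z], continuous (fun t => expR (k * t) * e t)}.
  move=> ay zb; apply: derivable_within_continuous => t tyz.
  by case: (key k t (subc _ _ _ tyz ay zb)).
have [s1s|ss1] := leP s1 s.
- have : expR (- C * s) * e s <= expR (- C * s1) * e s1.
    apply: (@ler0_derive1_nincr _ (fun t => expR (- C * t) * e t) s1 s) => // t tI.
    + by case: (key (- C) t (sub _ _ _ tI as1 sb)).
    + have tab := sub _ _ _ tI as1 sb.
      rewrite derive1E; have [_ ->] := key (- C) t tab.
      rewrite pmulr_rle0 ?expR_gt0 // mulNr subr_le0.
      exact: le_trans (ler_norm _) (ee t tab).
    + exact: cont.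
  by rewrite es1 mulr0 pmulr_rle0 ?expR_gt0.
- have : expR (C * s) * e s <= expR (C * s1) * e s1.
    apply: (@ger0_derive1_ndecr _ (fun t => expR (C * t) * e t) s s1) => //.
    + by move=> t tI; case: (key C t (sub _ _ _ tI as_ s1b)).
    + move=> t tI; have tab := sub _ _ _ tI as_ s1b.
      rewrite derive1E; have [_ ->] := key C t tab.
      rewrite pmulr_rge0 ?expR_gt0 //.
      have := le_trans (ler_norm (- e' t)) (eq_ind_r (fun z => z <= _) (ee t tab) (normrN _)).
      by rewrite lerNl -subr_ge0 opprK.
    + exact: cont.
    + exact: ltW.
  by rewrite es1 mulr0 pmulr_rle0 ?expR_gt0.
Qed.

Lemma norm_mul2_le (x y : R) : `|x * y *+ 2| <= x ^+ 2 + y ^+ 2.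
Proof.
rewrite ler_norml; apply/andP; split.
  have := sqr_ge0 (x + y); rewrite sqrrD; lra.
have := sqr_ge0 (x - y); rewrite sqrrB; lra.
Qed.

Lemma linear_ode_eq0 n (r : R -> 'rV[R]_n) (Q : R -> 'M[R]_n) (a b B s1 : R) :
  (forall s, a < s < b -> is_derive s 1 r (r s *m Q s)) ->
  (forall s i j, a < s < b -> `|Q s i j| <= B) ->
  a < s1 < b -> r s1 = 0 -> forall s, a < s < b -> r s = 0.
Proof.
move=> dr QB s1ab rs1 s sab.
pose e t := \sum_i (r t 0 i) ^+ 2.
pose e' t := \sum_i (r t *m Q t) 0 i * r t 0 i *+ 2.
have e0 t : 0 <= e t by apply: sumr_ge0 => i _; exact: sqr_ge0.
have B0 : forall i j : 'I_n, 0 <= B by move=> i j; exact: le_trans (normr_ge0 _) (QB s i j sab).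
suff es : e s = 0.
  apply/rowP => i; rewrite mxE; apply/eqP; rewrite -sqrf_eq0 eq_le sqr_ge0 andbT.
  by rewrite -es /e (bigD1 i) //= lerDl sumr_ge0 // => j _; exact: sqr_ge0.
(* The constant comes from |2 q x y| <= B (x^2 + y^2) for each entry q: summed over all pairs (i,
   j), each of the two squares contributes n B e. *)
apply: (@le_derive_eq0 e e' a b (2 * n%:R * B) s1) => //.
- move=> t tab; have /is_derive_mxP dt := dr t tab.
  have H := is_derive_sum (fun i => is_deriveX 1 (dt 0 i)).
  have -> : e = \sum_(i < n) ((fun t => r t 0 i : R^o) ^+ 2).
    by apply/funext => u; rewrite fct_sumE.
  apply: is_derive_eq; apply: eq_bigr => i _.
  rewrite /GRing.scale /=; ring.
- move=> t tab.
  have H i : `|(r t *m Q t) 0 i * r t 0 i *+ 2| <=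
      \sum_j B * (r t 0 j ^+ 2 + r t 0 i ^+ 2).
    rewrite mxE mulr_suml -sumrMnl (le_trans (ler_norm_sum _ _ _)) // ler_sum // => j _.
    have := QB t j i tab; move: (r t 0 j) (r t 0 i) (Q t j i) => x y q qB.
    rewrite (_ : x * q * y *+ 2 = q * (x * y *+ 2)); last by ring.
    by rewrite normrM ler_pM // norm_mul2_le.
  rewrite (le_trans (ler_norm_sum _ _ _)) // (le_trans (ler_sum _ (fun i _ => H i))) //.
  have E i : \sum_j B * (r t 0 j ^+ 2 + r t 0 i ^+ 2) = B * e t + n%:R * B * r t 0 i ^+ 2.
    rewrite -mulr_sumr big_split /= mulrDr sumr_const card_ord -/(e t) -mulr_natl; ring.
  rewrite (eq_bigr _ (fun i _ => E i)) big_split /= sumr_const card_ord -mulr_sumr -/(e t).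
  rewrite -mulr_natl le_eqVlt; apply/orP; left; apply/eqP; ring.
- by rewrite /e rs1 big1 // => i _; rewrite mxE expr2 mulr0.
Qed.

(** The local hypothesis is symmetric in s1 and s2, so P is locally constant on the segment: P and
    its negation are both relatively open, and connectedness concludes. *)
Lemma segment_ind (P : R -> Prop) (a b : R) : a <= b ->
  (forall s, a <= s <= b -> exists2 d, 0 < d & forall s1 s2, a <= s1 <= b -> a <= s2 <= b ->
     `|s1 - s| < d -> `|s2 - s| < d -> P s1 -> P s2) ->
  P a -> forall s, a <= s <= b -> P s.
Proof.
move=> ab loc Pa s sab.
pose good u d := 0 < d /\ forall s1 s2, a <= s1 <= b -> a <= s2 <= b ->
     `|s1 - u| < d -> `|s2 - u| < d -> P s1 -> P s2.
(* The union of the good balls that meet S is open. On [a, b] it coincides with S, both for S = P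
   and for the negation of P, so P is cut out by an open set and by a closed one. *)
pose C (S : R -> Prop) := \bigcup_(ud in [set ud : R * R | [/\ a <= ud.1 <= b, good ud.1 ud.2 &
    exists s1, [/\ a <= s1 <= b, `|s1 - ud.1| < ud.2 & S s1]]]) ball ud.1 ud.2.
have Co S : open (C S) by apply: bigcup_open => -[u d] _; exact: ball_open.
have inC (S : R -> Prop) u : a <= u <= b -> S u -> C S u.
  move=> uab Su; have [d d0 H] := loc u uab.
  exists (u, d); last exact: ballxx.
  by split=> //; exists u; split; rewrite ?subrr ?normr0.
have Cin u : C P u -> a <= u <= b -> P u.
  move=> [[v d] /= [vab [d0 H] [s1 [s1ab s1v Ps1]]]]; rewrite -ball_normE /= distrC => uv uab.
  exact: H s1ab uab s1v uv Ps1.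
have CNin u : C (fun x => ~ P x) u -> a <= u <= b -> ~ P u.
  move=> [[v d] /= [vab [d0 H] [s1 [s1ab s1v Ps1]]]]; rewrite -ball_normE /= distrC => uv uab Pu.
  by apply: Ps1; exact: H uab s1ab uv s1v Pu.
suff : `[a, b]%classic `&` P = `[a, b]%classic.
  by move=> /seteqP[_ /(_ s)]; rewrite /= in_itv /= => /(_ sab)[].
apply: (@segment_connected R a b).
- by exists a; split => //=; rewrite in_itv /= lexx.
- have abE u : `[a, b]%classic u <-> a <= u <= b by rewrite /= in_itv.
  exists (C P); first exact: Co.
  apply/seteqP; split=> u [/abE uab Pu]; split; try exact/abE; [exact: inC|exact: Cin].
- have abE u : `[a, b]%classic u <-> a <= u <= b by rewrite /= in_itv.
  exists (~` C (fun x => ~ P x)); first exact: open_closedC.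
  apply/seteqP; split=> u [/abE uab Pu]; split; try exact/abE.
    by move=> Cu; exact: CNin Cu uab Pu.
  by apply: contrapT => nP; apply: Pu; exact: inC.
Qed.

End OneVariable.

(** * Sturm comparison *)

Section Sturm.
Context {R : realType}.

Lemma is_derive_inv (S : R -> R) (s l : R) : S s != 0 -> is_derive s 1 S l ->
  is_derive s 1 (fun t => (S t)^-1) (- (S s) ^- 2 * l).
Proof.
move=> S0 [dS <-]; apply: DeriveDef; first exact: derivableV.
exact: deriveV.
Qed.

Lemma is_derive_within_continuous (f f' : R -> R) (a b : R) :
  (forall s : R, is_derive s 1 f (f' s)) -> {within `[a, b], continuous f}.
Proof.
by move=> df; apply: derivable_within_continuous => s _; case: (df s).
Qed.

(** The quotient u = dS / S solves the Riccati equation u' = - mu - u^2, and [phi] = p - u f is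
    monotone. As it vanishes at both ends, it vanishes identically; then f' = 2 u f, an equation
    also solved by S^2, and f 0 = 0 leaves only f = 0. *)
Lemma riccati_comparison (f p q S dS : R -> R) (t mu : R) : 0 < t ->
  (forall s : R, is_derive s 1 S (dS s)) ->
  (forall s : R, is_derive s 1 dS (- mu * S s)) ->
  (forall s, 0 <= s <= t -> 0 < S s) ->
  (forall s, 0 < s < t -> is_derive (s : R) 1 f (2 * p s)) ->
  (forall s, 0 < s < t -> is_derive (s : R) 1 p (q s)) ->
  {within `[0, t], continuous f} -> {within `[0, t], continuous p} ->
  (forall s x, 0 < s < t -> 0 <= q s - 2 * x * p s + x ^+ 2 * f s + mu * f s) ->
  f 0 = 0 -> p 0 = 0 -> f t = 0 -> p t = 0 ->
  forall s, 0 <= s <= t -> f s = 0.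
Proof.
move=> t0 DS DdS S0 Df Dp Cf Cp ineq f0 p0 ft pt.
have itv s : s \in `]0, t[%R -> 0 < s < t by rewrite in_itv.
have oc s : 0 < s < t -> 0 <= s <= t by move=> /andP[? ?]; rewrite !ltW.
pose I s := (S s)^-1.
have DI s : 0 <= s <= t -> is_derive (s : R) 1 I (- (S s) ^- 2 * dS s).
  by move=> st; apply: is_derive_inv; rewrite ?gt_eqF ?S0.
have CS : {within `[0, t], continuous dS} by exact: is_derive_within_continuous.
have CI : {within `[0, t], continuous I}.
  by apply: derivable_within_continuous => s; rewrite in_itv /= => /DI; case.
have CM (u v : R -> R) : {within `[0, t], continuous u} -> {within `[0, t], continuous v} ->
    {within `[0, t], continuous (fun s => u s * v s)}.
  by move=> cu cv x; apply: (@continuousM R); [exact: cu|exact: cv].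
(* The derivative of [phi] is the left side of [ineq] at x = dS / S; this is why [ineq] is asked for
   every x. *)
pose phi s := p s - dS s * I s * f s.
have Dphi s : 0 < s < t -> is_derive (s : R) 1 phi
    (q s - 2 * (dS s * I s) * p s + (dS s * I s) ^+ 2 * f s + mu * f s).
  move=> st; have ? := Df s st; have ? := Dp s st; have ? := DI s (oc s st).
  have ? := DdS s; have S1 : S s != 0 by rewrite gt_eqF // S0 // oc.
  apply: is_derive_eq; rewrite /GRing.scale /= /I; field.
  exact: S1.
have Cphi : {within `[0, t], continuous phi}.
  have -> : phi = p - (fun s => dS s * I s * f s) by [].
  have CN : {within `[0, t], continuous (fun s => dS s * I s * f s)}.
    by apply: (CM (fun s => dS s * I s) f) => //; exact: CM.
  by move=> x; apply: (@continuousB R R^o (subspace `[0, t]%classic)); [exact: Cp|exact: CN].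
have mono : forall x y, 0 <= x -> x <= y -> y <= t -> phi x <= phi y.
  apply: ger0_derive1_ndecr => // [s /itv st|s /itv st].
    by case: (Dphi s st).
  by rewrite derive1E; have [_ ->] := Dphi s st; exact: ineq.
have phi0 s : 0 <= s <= t -> phi s = 0.
  move=> /andP[s0 st]; apply/eqP; rewrite eq_le.
  have := mono 0 s (lexx _) s0 st; have := mono s t s0 st (lexx _).
  have -> : phi 0 = 0 by rewrite /phi f0 p0 mulr0 subr0.
  have -> : phi t = 0 by rewrite /phi ft pt mulr0 subr0.
  by move=> -> ->.
(* Once p = u f holds, f / S^2 has derivative 0. *)
pose h s := f s * I s ^+ 2.
have Dh s : 0 < s < t -> is_derive (s : R) 1 h 0.
  move=> st; have ? := Df s st; have ? := DI s (oc s st).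
  have S1 : S s != 0 by rewrite gt_eqF // S0 // oc.
  have E := phi0 s (oc s st); apply: is_derive_eq; rewrite /GRing.scale /=.
  have -> : p s = dS s * I s * f s by apply/eqP; rewrite -subr_eq0; apply/eqP; exact: E.
  rewrite /I; field; exact: S1.
have Ch : {within `[0, t], continuous h}.
  apply: (CM f (fun s => I s ^+ 2)) => //.
  by rewrite (_ : (fun s => I s ^+ 2) = (fun s => I s * I s)) //; exact: CM.
move=> s st; have [s0 st'] := andP st.
have h1 : h 0 <= h s.
  apply: (@ger0_derive1_ndecr _ h 0 t) => // [u /itv ut|u /itv ut].
    by case: (Dh u ut).
  by rewrite derive1E; have [_ ->] := Dh u ut.
have h2 : h s <= h 0.
  apply: (@ler0_derive1_nincr _ h 0 t) => // [u /itv ut|u /itv ut].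
    by case: (Dh u ut).
  by rewrite derive1E; have [_ ->] := Dh u ut.
have /eqP : h s = 0.
  have h0 : h 0 = 0 by rewrite /h f0 mul0r.
  by apply/eqP; rewrite eq_le; move: h1 h2; rewrite h0 => -> ->.
by rewrite mulf_eq0 expf_eq0 /= invr_eq0 (gt_eqF (S0 s st)) orbF => /eqP.
Qed.

Lemma sturm_comparison (f p q : R -> R) (t lam : R) : 0 < t ->
  lam <= 0 \/ (0 < lam /\ t < pi / Num.sqrt lam) ->
  (forall s, 0 < s < t -> is_derive (s : R) 1 f (2 * p s)) ->
  (forall s, 0 < s < t -> is_derive (s : R) 1 p (q s)) ->
  {within `[0, t], continuous f} -> {within `[0, t], continuous p} ->
  (forall s, 0 < s < t -> 0 <= f s) ->
  (forall s x, 0 < s < t -> 0 <= q s - 2 * x * p s + x ^+ 2 * f s + lam * f s) ->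
  f 0 = 0 -> p 0 = 0 -> f t = 0 -> p t = 0 ->
  forall s, 0 <= s <= t -> f s = 0.
Proof.
move=> t0 [lam0|[lam0 tl]] Df Dp Cf Cp fge0 ineq f0 p0 ft pt.
  apply: (@riccati_comparison f p q (cst 1) (cst 0) t 0) => //.
    by move=> s; apply: is_derive_eq; rewrite oppr0 mul0r.
  move=> s x st; rewrite mul0r addr0 (le_trans (ineq s x st)) // gerDl.
  by rewrite mulr_le0_ge0 // fge0.
pose w := Num.sqrt lam.
have w0 : 0 < w by rewrite sqrtr_gt0.
have w2 : w ^+ 2 = lam by rewrite sqr_sqrtr // ltW.
(* Centring at t / 2 makes the argument of the cosine run over [- w t / 2, w t / 2]. The cosine must
   be positive at both ends as well, which amounts to w t < pi. *)
pose a s := w * (s - t / 2).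
have Da (s : R) : is_derive s 1 a w.
  by rewrite /a; apply: is_derive_eq; rewrite /GRing.scale /=; ring.
have Dc (s : R) : is_derive s 1 (fun s => cos (a s)) (- sin (a s) * w).
  exact: (@is_derive1_comp _ cos a).
have Ds (s : R) : is_derive s 1 (fun s => sin (a s)) (cos (a s) * w).
  exact: (@is_derive1_comp _ sin a).
apply: (@riccati_comparison f p q (fun s => cos (a s)) (fun s => - sin (a s) * w) t lam) => //.
  move=> s; have ? := Ds s; apply: is_derive_eq; rewrite /GRing.scale /= -w2; ring.
move=> s /andP[s0 st]; apply: cos_gt0_pihalf.
have wt : w * t < pi by rewrite mulrC -ltr_pdivlMr.
have ws0 : 0 <= w * s by rewrite mulr_ge0 // ltW.
have wst : w * s <= w * t by rewrite ler_pM2l.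
rewrite /a mulrBr mulrA; apply/andP; split; lra.
Qed.

End Sturm.

(** * Charts and the Lie bracket *)

Section EuclideanBracket.
Context {R : realType}.

Lemma derive_along_mul n m (f : 'rV[R]_n -> 'rV[R]_m) (y v : 'rV[R]_n) :
  differentiable f y -> 'D_v f y = v *m \matrix_i 'D_(delta_mx 0 i) f y.
Proof.
move=> df; rewrite derive_rV // mulmx_sum_row; apply: eq_bigr => i _.
by rewrite rowK.
Qed.

(** D_(h z) f z is the row h z times the Jacobian matrix of f at z, so the product rule separates
    the variation of the direction from that of the derivative. *)
Lemma derive_derive_along n m (U : set 'rV[R]_n) (f : 'rV[R]_n -> 'rV[R]_m)
    (h : 'rV[R]_n -> 'rV[R]_n) (y v : 'rV[R]_n) : open U -> U y ->
  smooth_on U f -> differentiable h y ->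
  'D_v (fun z => 'D_(h z) f z) y = 'D_('D_v h y) f y + 'D_v ('D_(h y) f) y.
Proof.
move=> Uo Uy sf dh; have nU : nbhs y U by exact: open_nbhs_nbhs.
have df z : U z -> differentiable f z by exact: smooth_on_differentiable.
pose J z := \matrix_i 'D_(delta_mx 0 i) f z.
pose J' := \matrix_i 'D_v ('D_(delta_mx 0 i) f) y.
have dJ : is_derive y v J J'.
  apply/is_derive_mxP => i j; rewrite mxE.
  have := smooth_on_differentiable (smooth_on_derive (delta_mx 0 i) sf) Uy.
  move=> /(diff_derivable (v := v))/derivableP/is_derive_mxP /(_ 0 j).
  by congr is_derive; apply/funext => z; rewrite mxE.
have dh' : is_derive y v h ('D_v h y) by exact/derivableP/diff_derivable.
have E1 : is_derive y v (fun z => 'D_(h z) f z) ('D_v h y *m J y + h y *m J').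
  apply: near_eq_is_derive (is_derive_mulmx dh' dJ).
  by apply: filterS nU => z Uz; rewrite -derive_along_mul //; exact: df.
(* The same computation with the direction frozen at h y identifies the remaining term as a second
   derivative of f. *)
have E2 : is_derive y v ('D_(h y) f) (0 *m J y + h y *m J').
  apply: near_eq_is_derive (is_derive_mulmx (is_derive_cst (h y) y v) dJ).
  by apply: filterS nU => z Uz; rewrite -derive_along_mul //; exact: df.
case: E1 => _ ->; case: E2 => _ ->; rewrite mul0mx add0r.
by congr (_ + _); rewrite -derive_along_mul //; exact: df.
Qed.

(** Naturality of the bracket for [phi]-related fields. Each of the two terms on the right produces
    a second derivative of [phi] in the directions Xa y and Ya y, in opposite orders; these cancel
    by symmetry. *)
Lemma bracket_conj n (U U' : set 'rV[R]_n) (phi Xa Ya Xb Yb : 'rV[R]_n -> 'rV[R]_n) y :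
  open U -> U y -> smooth_on U phi -> (forall z, U z -> U' (phi z)) ->
  smooth_on U Xa -> smooth_on U Ya -> smooth_on U' Xb -> smooth_on U' Yb ->
  (forall z, U z -> Xb (phi z) = 'D_(Xa z) phi z) ->
  (forall z, U z -> Yb (phi z) = 'D_(Ya z) phi z) ->
  'D_('D_(Xa y) Ya y - 'D_(Ya y) Xa y) phi y =
  'D_(Xb (phi y)) Yb (phi y) - 'D_(Yb (phi y)) Xb (phi y).
Proof.
move=> Uo Uy sphi UU sXa sYa sXb sYb hX hY.
have nU : nbhs y U by exact: open_nbhs_nbhs.
have dphi : differentiable phi y by exact: smooth_on_differentiable sphi Uy.
have key (P Q P' Q' : 'rV[R]_n -> 'rV[R]_n) : smooth_on U Q -> smooth_on U' Q' ->
    (forall z, U z -> P' (phi z) = 'D_(P z) phi z) ->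
    (forall z, U z -> Q' (phi z) = 'D_(Q z) phi z) ->
    'D_(P' (phi y)) Q' (phi y) = 'D_('D_(P y) Q y) phi y + 'D_(P y) ('D_(Q y) phi) y.
  move=> sQ sQ' hP hQ; rewrite hP //.
  rewrite -(derive_comp (P y) dphi); last exact: smooth_on_differentiable sQ' (UU _ Uy).
  rewrite -(derive_derive_along (P y) Uo Uy sphi (smooth_on_differentiable sQ Uy)).
  by apply: near_eq_derive; apply: filterS nU => z Uz; exact: hQ.
rewrite (key Xa Ya Xb Yb) // (key Ya Xa Yb Xb) //.
have cancel (P Q P' Q' : 'rV[R]_n) : Q = Q' -> P - P' = P + Q - (P' + Q').
  by move=> ->; rewrite opprD addrACA subrr addr0.
apply: etrans (cancel _ _ _ _ (derive_sym_mx (Xa y) (Ya y) Uo Uy sphi)).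
by rewrite !(deriveE _ dphi) linearB.
Qed.

End EuclideanBracket.

Section Charts.
Context {R : realType} {n : nat}.

Section OneChart.
Context {M : topologicalType}.
Implicit Types a b : chart R n M.

Lemma cinv_dom a y : (cmap a @` cdom a) y -> cdom a (cinv a y).
Proof. by case=> p ap <-; rewrite cmapK. Qed.

Lemma cinvK a y : (cmap a @` cdom a) y -> cmap a (cinv a y) = y.
Proof. by case=> p ap <-; rewrite cmapK. Qed.

Lemma chart_imageP a (O : set M) y :
  (cmap a @` (cdom a `&` O)) y <-> (cmap a @` cdom a) y /\ O (cinv a y).
Proof.
split=> [[p [ap Op] <-]|[ay Oy]].
  by split; [exists p|rewrite cmapK].
by exists (cinv a y); [split=> //; exact: cinv_dom|exact: cinvK].
Qed.

Lemma open_chart_image a (O : set M) : open O -> open (cmap a @` (cdom a `&` O)).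
Proof.
move=> Oo; rewrite openE => y /chart_imageP[ay Oy].
have n1 : nbhs y (cmap a @` cdom a).
  by apply: open_nbhs_nbhs; split => //; exact: open_cimg.
have n2 : nbhs y (cinv a @^-1` O).
  by apply: (cinv_continuous ay); exact: open_nbhs_nbhs.
by apply: filterS (filterI n1 n2) => z [az Oz]; apply/chart_imageP.
Qed.

End OneChart.

Context {M : manifold R n}.
Implicit Types (a b : chart R n M) (p : M) (X Y : vfield M) (O : set M).

Lemma transition_smooth a b : atlas a -> atlas b ->
  smooth_on (cmap a @` (cdom a `&` cdom b)) (cmap b \o cinv a).
Proof. exact: (@atlas_compatible _ _ M). Qed.

Lemma transition_differentiable a b p : atlas a -> atlas b -> cdom a p -> cdom b p ->
  differentiable (cmap b \o cinv a) (cmap a p).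
Proof.
move=> Aa Ab ap bp; apply: smooth_on_differentiable (transition_smooth Aa Ab) _.
by exists p.
Qed.

Lemma nbhs_chart_image a O p : cdom a p -> open O -> O p ->
  nbhs (cmap a p) (cmap a @` (cdom a `&` O)).
Proof.
by move=> ap Oo Op; apply: open_nbhs_nbhs; split; [exact: open_chart_image|exists p].
Qed.

Lemma in_chart_self p v : in_chart (chart_at p) p v = v.
Proof.
have cp := chart_at_dom p; rewrite /in_chart.
rewrite -[RHS](derive_id (cmap (chart_at p) p) v); apply: near_eq_derive.
have := nbhs_chart_image cp openT I; apply: filterS => y /chart_imageP[cy _].
exact: cinvK.
Qed.

(** Continuity of F is a separate hypothesis: [cmap a] is total, so regularity of [cmap a \o F]
    alone would not keep F inside the domain of a. *)
Lemma derive_chart_change (E : normedModType R) (F : E -> M) a b z v :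
  atlas a -> atlas b -> {for z, continuous F} -> cdom a (F z) -> cdom b (F z) ->
  differentiable (cmap a \o F) z ->
  differentiable (cmap b \o F) z /\
  'D_v (cmap b \o F) z = 'D_('D_v (cmap a \o F) z) (cmap b \o cinv a) (cmap a (F z)).
Proof.
move=> Aa Ab cF aF bF dF.
have nz : \forall z' \near z, ((cmap b \o cinv a) \o (cmap a \o F)) z' = (cmap b \o F) z'.
  have : nbhs (F z) (cdom a) by apply: open_nbhs_nbhs; split=> //; exact: open_cdom.
  move=> /cF az; have {}az : nbhs z (F @^-1` cdom a) by exact: az.
  by apply: filterS az => z' az' /=; rewrite cmapK.
have dt := transition_differentiable Aa Ab aF bF; split.
  exact: near_eq_differentiable nz (differentiable_comp dF dt).
rewrite -(near_eq_derive v nz); exact: derive_comp.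
Qed.

Lemma in_chart_change a b p v : atlas a -> atlas b -> cdom a p -> cdom b p ->
  in_chart b p v = 'D_(in_chart a p v) (cmap b \o cinv a) (cmap a p).
Proof.
move=> Aa Ab ap bp; have cp := chart_at_dom p; have Ap := chart_at_atlas p.
have e : cinv (chart_at p) (cmap (chart_at p) p) = p by rewrite cmapK.
have H := @derive_chart_change _ (cinv (chart_at p)) a b (cmap (chart_at p) p) v Aa Ab.
rewrite e in H; apply: (H _ ap bp _).2; last exact: transition_differentiable.
by apply: cinv_continuous; exists p.
Qed.

Lemma in_chart_sum a p (I : finType) (k : I -> R) (u : I -> 'rV[R]_n) :
  atlas a -> cdom a p ->
  in_chart a p (\sum_i k i *: u i) = \sum_i k i *: in_chart a p (u i).
Proof.
move=> Aa ap; apply: derive_suml; apply: transition_differentiable => //.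
- exact: chart_at_atlas.
- exact: chart_at_dom.
Qed.

Lemma in_chart0 a p : in_chart a p 0 = 0.
Proof. exact: derive0. Qed.

Lemma in_chart_inj a p : atlas a -> cdom a p -> injective (in_chart a p).
Proof.
move=> Aa ap u v uv.
rewrite -(in_chart_self p u) -(in_chart_self p v).
have Ap := chart_at_atlas p; have cp := chart_at_dom p.
by rewrite !(in_chart_change _ Aa Ap ap cp) uv.
Qed.

Lemma vrep_cmap a X p : cdom a p -> vrep a X (cmap a p) = in_chart a p (X p).
Proof. by move=> ap; rewrite /vrep cmapK. Qed.

Lemma vrep_change a b X y : atlas a -> atlas b ->
  (cmap a @` (cdom a `&` cdom b)) y ->
  vrep b X ((cmap b \o cinv a) y) = 'D_(vrep a X y) (cmap b \o cinv a) y.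
Proof.
move=> Aa Ab [p [ap bp] <-].
have -> : (cmap b \o cinv a) (cmap a p) = cmap b p by rewrite /= cmapK.
rewrite (vrep_cmap X ap) (vrep_cmap X bp).
exact: in_chart_change.
Qed.

(** [bracket] is computed in the preferred chart of p, which may jump with p. Only after passing to
    one chart a around all nearby points can the bracket be differentiated again. *)
Lemma bracket_in_chart a O X Y p : atlas a -> open O -> O p -> cdom a p ->
  smooth_vfield O X -> smooth_vfield O Y ->
  in_chart a p (bracket X Y p) =
  'D_(vrep a X (cmap a p)) (vrep a Y) (cmap a p) -
  'D_(vrep a Y (cmap a p)) (vrep a X) (cmap a p).
Proof.
move=> Aa Oo Op ap sX sY; set c := chart_at p.
have Ac : atlas c by exact: chart_at_atlas.
have cp : cdom c p by exact: chart_at_dom.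
have vX Z : Z p = vrep c Z (cmap c p) by rewrite vrep_cmap // in_chart_self.
rewrite (in_chart_change _ Ac Aa cp ap) in_chart_self /bracket -/c.
rewrite {1}(vX X) {1}(vX Y).
pose O' := cdom a `&` O; have O'o : open O' by apply: openI => //; exact: open_cdom.
pose U := cmap c @` (cdom c `&` O').
have Uo : open U by exact: open_chart_image.
have Up : U (cmap c p) by exists p.
have UO : U `<=` cmap c @` (cdom c `&` O) by move=> _ [q [cq [_ Oq]] <-]; exists q.
have Ua : U `<=` cmap c @` (cdom c `&` cdom a) by move=> _ [q [cq [aq _]] <-]; exists q.
have E := @bracket_conj R n U (cmap a @` (cdom a `&` O)) (cmap a \o cinv c)
  (vrep c X) (vrep c Y) (vrep a X) (vrep a Y) (cmap c p) Uo Up.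
have e : (cmap a \o cinv c) (cmap c p) = cmap a p by rewrite /= cmapK.
rewrite e in E; apply: E.
- exact: smooth_on_sub Ua (transition_smooth Ac Aa).
- by move=> _ [q [cq [aq Oq]] <-] /=; exists q; rewrite ?cmapK.
- exact: smooth_on_sub UO (sX c Ac).
- exact: smooth_on_sub UO (sY c Ac).
- exact: sX.
- exact: sY.
- by move=> z /Ua; exact: vrep_change.
- by move=> z /Ua; exact: vrep_change.
Qed.

Lemma smooth_bracket O X Y : open O -> smooth_vfield O X -> smooth_vfield O Y ->
  smooth_vfield O (bracket X Y).
Proof.
move=> Oo sX sY a Aa; have Uo : open (cmap a @` (cdom a `&` O)) by exact: open_chart_image.
have := smooth_onB Uo (smooth_on_derive_along Uo (sY a Aa) (sX a Aa))
  (smooth_on_derive_along Uo (sX a Aa) (sY a Aa)).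
apply: smooth_on_ext => // _ [p [ap Op] <-].
rewrite [RHS]vrep_cmap //; apply: esym.
exact: (bracket_in_chart Aa Oo Op ap sX sY).
Qed.

Lemma smooth_vfield_sub O O' X : O' `<=` O -> smooth_vfield O X -> smooth_vfield O' X.
Proof.
move=> OO sX a Aa; apply: smooth_on_sub (sX a Aa).
by move=> _ [p [ap O'p] <-]; exists p => //; split=> //; exact: OO.
Qed.

End Charts.

(** * Frames *)

Section LocalSmoothness.
Context {R : realType}.
Implicit Types E F : normedModType R.

Lemma Ck_local E F k (U : set E) (f : E -> F) :
  (forall x, U x -> exists U' : set E, U' x /\ Ck k U' f) -> Ck k U f.
Proof.
elim: k f => [|k IH] f H.
  by move=> x /H[U' [U'x cf]]; exact: (cf x U'x).
split=> [x /H[U' [U'x [df _]]]|v]; first exact: df.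
apply: IH => x /H[U' [U'x [_ cf]]].
by exists U'; split=> //; exact: cf.
Qed.

Lemma smooth_on_local E F (U : set E) (f : E -> F) :
  (forall x, U x -> exists U' : set E, U' x /\ smooth_on U' f) -> smooth_on U f.
Proof.
move=> H k; apply: Ck_local => x /H[U' [U'x sf]].
by exists U'; split=> //; exact: sf.
Qed.

(** A right inverse works only near the point where it is chosen, so smoothness is proved point by
    point, each time with another L. *)
Lemma smooth_on_row_coords E (U : set E) k l n (A : E -> 'M[R]_(k, n))
    (b : E -> 'M[R]_(l, n)) (h : E -> 'M[R]_(l, k)) :
  open U -> smooth_on U A -> (forall x, U x -> row_free (A x)) ->
  smooth_on U b -> (forall x, U x -> b x = h x *m A x) -> smooth_on U h.
Proof.
move=> Uo sA fA sb bh; apply: smooth_on_local => x Ux.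
have [U' [L [U'o U'x UU uL]]] := row_free_nbhs Uo Ux sA (fA x Ux).
exists U'; split => //; apply: (smooth_on_coords U'o uL).
- exact: smooth_on_sub UU sA.
- exact: smooth_on_sub UU sb.
- by move=> y /UU; exact: bh.
Qed.

End LocalSmoothness.

Section Families.
Context {R : realType}.

Lemma memv_span_family (vT : vectType R) k (w : 'I_k -> vT) v :
  v \in <<[seq w j | j : 'I_k]>>%VS <-> exists u : 'rV[R]_k, v = \sum_j u 0 j *: w j.
Proof.
have e : [seq w j | j : 'I_k] = mktuple w by [].
split=> [|[u ->]]; last first.
  apply: memv_suml => j _; apply: memvZ; apply: memv_span.
  by apply: map_f; rewrite mem_enum.
rewrite e => vS; exists (\row_j coord (mktuple w) j v).
rewrite {1}(coord_span vS); apply: eq_bigr => j _.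
by rewrite mxE -tnth_nth tnth_mktuple.
Qed.

Lemma free_family (vT : vectType R) k (w : 'I_k -> vT) :
  free [seq w j | j : 'I_k] ->
  forall u : 'rV[R]_k, \sum_j u 0 j *: w j = 0 -> u = 0.
Proof.
have -> : [seq w j | j : 'I_k] = mktuple w by [].
move=> /freeP H u u0; apply/rowP => j; rewrite mxE; apply: (H (fun j => u 0 j)).
by rewrite -[RHS]u0; apply: eq_bigr => i _; rewrite -tnth_nth tnth_mktuple.
Qed.

Lemma row_free_ker k n (A : 'M[R]_(k, n)) :
  (forall u : 'rV_k, u *m A = 0 -> u = 0) -> row_free A.
Proof.
move=> H; rewrite -kermx_eq0; apply/eqP/row_matrixP => i; rewrite row0.
by apply: H; rewrite -row_mul mulmx_ker row0.
Qed.

End Families.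

Section Frames.
Context {R : realType} {n m : nat} {M : manifold R n}.
Implicit Types (a b : chart R n M) (p : M) (X Y : vfield M) (O : set M).
Implicit Type (V : tangent_distribution M).

Definition frame_mx k a (W : 'I_k -> vfield M) (y : 'rV[R]_n) : 'M[R]_(k, n) :=
  \matrix_j vrep a (W j) y.

Lemma in_chart_frame k a (W : 'I_k -> vfield M) p (u : 'rV[R]_k) :
  atlas a -> cdom a p ->
  in_chart a p (\sum_j u 0 j *: W j p) = u *m frame_mx a W (cmap a p).
Proof.
move=> Aa ap; rewrite in_chart_sum // mulmx_sum_row; apply: eq_bigr => j _.
by rewrite rowK vrep_cmap.
Qed.

Lemma smooth_frame_mx k a (W : 'I_k -> vfield M) O : atlas a -> open O ->
  (forall j, smooth_vfield O (W j)) -> smooth_on (cmap a @` (cdom a `&` O)) (frame_mx a W).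
Proof.
move=> Aa Oo sW; have Uo : open (cmap a @` (cdom a `&` O)) by exact: open_chart_image.
 apply/smooth_on_mxP => // i j.
apply: (smooth_on_ext Uo _ ((smooth_on_mxP _ Uo).1 (sW i a Aa) 0 j)) => y _.
by rewrite mxE.
Qed.

Lemma row_free_frame_mx k a (W : 'I_k -> vfield M) p : atlas a -> cdom a p ->
  (forall u : 'rV[R]_k, \sum_j u 0 j *: W j p = 0 -> u = 0) ->
  row_free (frame_mx a W (cmap a p)).
Proof.
move=> Aa ap H; apply: row_free_ker => u u0; apply: H.
by apply: (in_chart_inj Aa ap); rewrite in_chart_frame // u0 in_chart0.
Qed.

Lemma frame_memv V O (W : 'I_m -> vfield M) p v : local_frame V O W -> O p ->
  v \in V p <-> exists u : 'rV[R]_m, v = \sum_j u 0 j *: W j p.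
Proof.
by move=> [_ _ H] /H/andP[/eqP <- _]; exact: memv_span_family.
Qed.

Lemma frame_free V O (W : 'I_m -> vfield M) p : local_frame V O W -> O p ->
  forall u : 'rV[R]_m, \sum_j u 0 j *: W j p = 0 -> u = 0.
Proof. by move=> [_ _ H] /H/andP[_]; exact: free_family. Qed.

(* Modulo V, the bracket [X, Z] at p depends only on the value of Z at p. *)
Lemma bracket_section V X O O' (W : 'I_m -> vfield M) Z p :
  smooth_vfield setT X -> local_frame V O W ->
  local_section (fun q => [set` V q]) O' Z -> O p -> O' p ->
  exists u e : 'rV[R]_m, Z p = \sum_j u 0 j *: W j p /\
    bracket X Z p = \sum_j u 0 j *: bracket X (W j) p + \sum_j e 0 j *: W j p.
Proof.
move=> sX frW [ O'o sZ ZV] Op O'p; have [ Oo sW _] := frW.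
set a := chart_at p; have Aa : atlas a by exact: chart_at_atlas.
have ap : cdom a p by exact: chart_at_dom.
pose O2 := O `&` O'; have O2o : open O2 by exact: openI.
pose U := cmap a @` (cdom a `&` O2); have Uo : open U by exact: open_chart_image.
have Uy : U (cmap a p) by exists p.
have sA : smooth_on U (frame_mx a W).
  by apply: (smooth_frame_mx Aa O2o) => j; apply: smooth_vfield_sub (sW j) => q [].
have sZU : smooth_on U (vrep a Z).
  by apply: (@smooth_vfield_sub _ _ _ O' O2) => // q [].
have sXU : smooth_on U (vrep a X) by apply: (@smooth_vfield_sub _ _ _ setT O2).
have fA y : U y -> row_free (frame_mx a W y).
  by move=> [q [aq [ Oq _]] <-]; apply: row_free_frame_mx => //; exact: frame_free frW Oq.
have [h Zh] : exists h : 'rV[R]_n -> 'rV[R]_m,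
    forall y, U y -> vrep a Z y = h y *m frame_mx a W y.
  suff H y : exists u : 'rV[R]_m, U y -> vrep a Z y = u *m frame_mx a W y.
    by have [h hP] := choice H; exists h.
  have [[q [aq [ Oq O'q]] <-]|nU] := pselect (U y); last by exists 0.
  have [u uE] := (frame_memv _ frW Oq).1 (ZV q O'q).
  by exists u => _; rewrite vrep_cmap // uE in_chart_frame.
have sh : smooth_on U h by exact: smooth_on_row_coords Uo sA fA sZU Zh.
pose y := cmap a p; pose v := vrep a X y.
have dd k1 k2 (f : 'rV[R]_n -> 'M[R]_(k1, k2)) : smooth_on U f -> is_derive y v f ('D_v f y).
  by move=> sf; apply/derivableP/diff_derivable; exact: smooth_on_differentiable sf Uy.
(* From Z = h W one gets [X, Z] = h [X, W] + X(h) W: the witnesses are the coordinates of Z and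
   their derivative along X. *)
exists (h y), ('D_v h y); split.
  apply: (in_chart_inj Aa ap).
  by rewrite (in_chart_frame W (h y) Aa ap) -(Zh _ Uy) (vrep_cmap Z ap).
have dX := smooth_on_differentiable sXU Uy.
have nU : nbhs y U by exact: open_nbhs_nbhs.
have E1 : 'D_v (vrep a Z) y = 'D_v h y *m frame_mx a W y + h y *m 'D_v (frame_mx a W) y.
  have H := is_derive_mulmx (dd _ _ _ sh) (dd _ _ _ sA).
  have : is_derive y v (vrep a Z) ('D_v h y *m frame_mx a W y + h y *m 'D_v (frame_mx a W) y).
    apply: near_eq_is_derive H; apply: filterS nU => z Uz.
    by rewrite Zh.
  by case.
have dW j : 'D_v (vrep a (W j)) y = row j ('D_v (frame_mx a W) y).
  have /is_derive_mxP H := dd _ _ _ sA.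
  have : is_derive y v (vrep a (W j)) (row j ('D_v (frame_mx a W) y)).
    apply/is_derive_mxP => i l; rewrite mxE; have := H j l.
    by congr is_derive; apply/funext => z; rewrite mxE ord1.
  by case.
have bE Y : smooth_vfield O2 Y -> bracket X Y p =
    'D_v (vrep a Y) y - 'D_(vrep a Y y) (vrep a X) y.
  move=> sY; rewrite -(in_chart_self p (bracket X Y p)).
  exact: (bracket_in_chart Aa O2o _ ap (smooth_vfield_sub _ sX) sY).
have sW2 j : smooth_vfield O2 (W j) by apply: smooth_vfield_sub (sW j) => q [].
have sZ2 : smooth_vfield O2 Z by apply: smooth_vfield_sub sZ => q [].
rewrite (bE _ sZ2) E1 (Zh _ Uy) -addrA addrC.
have WE j : vrep a (W j) y = W j p by rewrite (vrep_cmap (W j) ap) in_chart_self.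
congr (_ + _); last first.
  by rewrite mulmx_sum_row; apply: eq_bigr => j _; rewrite rowK WE.
rewrite !mulmx_sum_row (derive_suml _ _ dX) -sumrB; apply: eq_bigr => j _.
by rewrite -scalerBr (bE _ (sW2 j)) dW rowK.
Qed.

End Frames.

(** * The frame (W, [X, W]) of D and the structure matrices *)

Section DoubledFrame.
Context {R : realType} {n m : nat} {M : manifold R n}.
Implicit Types (X : vfield M) (W : 'I_m -> vfield M).

(** The two halves of a coordinate row of length m + m, read off by [lsubmx] and [rsubmx], are the
    coefficients x of W and y of [X, W]. *)
Definition double_frame X W : 'I_(m + m) -> vfield M :=
  fun i => match fintype.split i with inl j => W j | inr j => bracket X (W j) end.

Lemma double_frame_lshift X W j :
  double_frame X W (lshift m j) = W j.
Proof. by rewrite /double_frame (unsplitK (inl j)). Qed.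

Lemma double_frame_rshift X W j :
  double_frame X W (rshift m j) = bracket X (W j).
Proof. by rewrite /double_frame (unsplitK (inr j)). Qed.

Lemma double_frame_sum X W (u : 'rV[R]_(m + m)) p :
  \sum_i u 0 i *: double_frame X W i p =
  \sum_j u 0 (lshift m j) *: W j p + \sum_j u 0 (rshift m j) *: bracket X (W j) p.
Proof.
rewrite big_split_ord /=; congr (_ + _); apply: eq_bigr => j _.
  by rewrite double_frame_lshift.
by rewrite double_frame_rshift.
Qed.

Variables (X : vfield M) (V : tangent_distribution M).
Hypothesis hXV : dynamic_pair m X V.
Hypothesis hreg : regular_pair m X V.
Variables (O : set M) (W : 'I_m -> vfield M).
Hypothesis frW : local_frame V O W.

Lemma smooth_double_frame i : smooth_vfield O (double_frame X W i).
Proof.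
have [Oo sW _] := frW; rewrite /double_frame; case: (fintype.split i) => j //.
by apply: smooth_bracket => //; apply: smooth_vfield_sub hXV.1.
Qed.

Lemma frame_section j : local_section (fun q => [set` V q]) O (W j).
Proof.
have [Oo sW bW] := frW; split=> // p Op; apply/(frame_memv _ frW Op).
exists (delta_mx 0 j); rewrite (bigD1 j) //= mxE !eqxx scale1r big1 ?addr0 // => i ij.
by rewrite mxE (negbTE ij) andbF scale0r.
Qed.

(** D is defined from all local sections through p; by [bracket_section] each of them contributes
    only combinations of W and [X, W]. *)
Lemma bracket_span_frame p v : O p ->
  bracket_span X V p v <-> exists u : 'rV[R]_(m + m), v = \sum_i u 0 i *: double_frame X W i p.
Proof.
move=> Op; split=> [[s [sV vs]]|[u uE]].
  apply/memv_span_family; move: v vs; apply/subvP/span_subvP => w ws.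
  have [ O' [Y [ O'p sY wE]]] := sV w ws.
  have [k [e [Ek Ee]]] := bracket_section hXV.1 frW sY Op O'p.
  apply/memv_span_family; case: wE => ->.
    exists (row_mx k 0); rewrite double_frame_sum Ek [X in _ = _ + X]big1.
      by rewrite addr0; apply: eq_bigr => j _; rewrite row_mxEl.
    by move=> j _; rewrite row_mxEr mxE scale0r.
  exists (row_mx e k); rewrite double_frame_sum Ee addrC.
  by congr (_ + _); apply: eq_bigr => j _; rewrite ?row_mxEl ?row_mxEr.
exists [seq double_frame X W i p | i : 'I_(m + m)]; split; last first.
  by apply/memv_span_family; exists u.
move=> w /mapP[i _ ->]; rewrite /double_frame; case: (fintype.split i) => j.
  by exists O, (W j); split; [|exact: frame_section|left].
by exists O, (W j); split; [|exact: frame_section|right].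
Qed.

(** A dimension count: the 2 m vectors span D at p, which has dimension 2 m by regularity. *)
Lemma double_frame_free p (u : 'rV[R]_(m + m)) : O p ->
  \sum_i u 0 i *: double_frame X W i p = 0 -> u = 0.
Proof.
move=> Op; apply: free_family; have [_ /(_ p)[U dU UE] _] := hreg.
suff -> : free [seq double_frame X W i p | i : 'I_(m + m)] =
    (\dim U == size [seq double_frame X W i p | i : 'I_(m + m)]).
  by rewrite dU size_image card_ord mul2n addnn.
rewrite /free; congr (\dim _ == _); apply/vspaceP => w.
apply/idP/idP => [/memv_span_family /(bracket_span_frame _ Op)|wU]; first by rewrite UE.
by apply/memv_span_family/(bracket_span_frame _ Op); rewrite UE.
Qed.

Lemma double_frame_row_free a p : atlas a -> cdom a p -> O p ->
  row_free (frame_mx a (double_frame X W) (cmap a p)).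
Proof.
by move=> Aa ap Op; apply: row_free_frame_mx => // u; exact: double_frame_free.
Qed.

(** [X, W_j] is itself a local section of D, so [X, D] in D provides coordinates of its bracket with
    X at each point. They are merely chosen; freeness of the doubled frame makes them smooth
    afterwards. In the row convention H is the pair of transposes of H0 and H1. *)
Lemma exists_structure_matrices : exists H : M -> 'M[R]_(m, m + m),
  (forall p j, O p -> bracket X (bracket X (W j)) p =
     \sum_i H p j i *: double_frame X W i p) /\
  forall a, atlas a -> smooth_on (cmap a @` (cdom a `&` O)) (H \o cinv a).
Proof.
have [Oo sW _] := frW.
have sX : smooth_vfield O X by apply: smooth_vfield_sub hXV.1.
have sB j : smooth_vfield O (bracket X (W j)) by exact: (smooth_bracket Oo sX (sW j)).
have sBB j : smooth_vfield O (bracket X (bracket X (W j))).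
  by exact: (smooth_bracket Oo sX (sB j)).
have ex p j : exists u : 'rV[R]_(m + m), O p -> bracket X (bracket X (W j)) p =
     \sum_i u 0 i *: double_frame X W i p.
  have [ Op|nOp] := pselect (O p); last by exists 0.
  have [_ _ H] := hreg.
  have sec : local_section (bracket_span X V) O (bracket X (W j)).
    split; [exact: Oo|exact: sB|move=> q Oq]; exists [:: bracket X (W j) q].
    split; last exact: memv_span1.
    move=> u; rewrite inE => /eqP ->; exists O, (W j).
    by split; [|exact: frame_section|right].
  have [u uE] := (bracket_span_frame _ Op).1 (H O _ p sec Op).
  by exists u.
have ex2 p : exists f : 'I_m -> 'rV[R]_(m + m), forall j, O p ->
    bracket X (bracket X (W j)) p = \sum_i f j 0 i *: double_frame X W i p.
  by have [f fP] := choice (ex p); exists f.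
have [h hP] := choice ex2.
exists (fun p => \matrix_(j, i) h p j 0 i); split=> [p j Op|a Aa].
  by rewrite hP //; apply: eq_bigr => i _; rewrite mxE.
have Uo : open (cmap a @` (cdom a `&` O)) by exact: open_chart_image.
apply: (smooth_on_row_coords Uo (smooth_frame_mx Aa Oo smooth_double_frame) _
  (smooth_frame_mx Aa Oo sBB)).
  by move=> _ [p [ap Op] <-]; exact: double_frame_row_free.
move=> _ [p [ap Op] <-]; apply/row_matrixP => j.
rewrite row_mul rowK (vrep_cmap _ ap) /= cmapK // (hP _ _ Op).
rewrite (in_chart_frame _ _ Aa ap); congr (_ *m _).
by apply/rowP => i; rewrite !mxE.
Qed.

End DoubledFrame.

(** * Flows and Lie transport *)

Section Slices.
Context {R : realType}.
Implicit Types E F G : normedModType R.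

Lemma differentiable_slice1 E F (x0 : F) (s : E) : differentiable (fun s => (s, x0)) s.
Proof.
by apply: differentiable_pair;
  [exact: (@ex_diff _ _ _ _ _ id)|exact: differentiable_cst].
Qed.

Lemma differentiable_slice2 E F (s0 : E) (x : F) : differentiable (fun x => (s0, x)) x.
Proof.
by apply: differentiable_pair;
  [exact: differentiable_cst|exact: (@ex_diff _ _ _ _ _ id)].
Qed.

Lemma derive_slice1 E F (x0 : F) (s v : E) : 'D_v (fun s => (s, x0)) s = (v, 0 : F).
Proof.
rewrite (deriveE _ (differentiable_slice1 _ _)) diff_pair.
- rewrite (diff_cst x0); congr (_, _).
  by rewrite diff_val.
- exact: (@ex_diff _ _ _ _ _ id).
- exact: differentiable_cst.
Qed.

Lemma derive_slice2 E F (s0 : E) (x v : F) : 'D_v (fun x => (s0, x)) x = (0 : E, v).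
Proof.
rewrite (deriveE _ (differentiable_slice2 _ _)) diff_pair.
- rewrite (diff_cst s0); congr (_, _).
  by rewrite diff_val.
- exact: differentiable_cst.
- exact: (@ex_diff _ _ _ _ _ id).
Qed.

Lemma derive_partial1 E F G (f : E * F -> G) s x v : differentiable f (s, x) ->
  'D_v (fun s => f (s, x)) s = 'D_(v, 0) f (s, x).
Proof.
move=> df; have := derive_comp v (differentiable_slice1 x s) df.
by rewrite derive_slice1.
Qed.

Lemma derive_partial2 E F G (f : E * F -> G) s x v : differentiable f (s, x) ->
  'D_v (fun x => f (s, x)) x = 'D_(0, v) f (s, x).
Proof.
move=> df; have := derive_comp v (differentiable_slice2 s x) df.
by rewrite derive_slice2.
Qed.

End Slices.

Section Flow.
Context {R : realType} {n : nat} {M : manifold R n}.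
Variables (X : vfield M) (dom : set (R * M)) (Phi : R -> M -> M).
Hypothesis sX : smooth_vfield setT X.
Hypothesis hPhi : is_flow X dom Phi.

Lemma pair_continuous (s : R) (p : M) : {for s, continuous (fun s => (s, p))}.
Proof. exact: (@cvg_pair R R M (nbhs s) (nbhs s) (nbhs p) _ _ _ id (cst p) cvg_id (cvg_cst p)). Qed.

Lemma open_flow_times p : open [set s | dom (s, p)].
Proof.
have -> : [set s | dom (s, p)] = (fun s => (s, p)) @^-1` dom by [].
by apply: open_comp (flow_open hPhi) => s _; exact: pair_continuous.
Qed.

Lemma orbit_continuous s p : dom (s, p) -> {for s, continuous (Phi ^~ p)}.
Proof.
move=> ds; have -> : Phi ^~ p = (fun z : R * M => Phi z.1 z.2) \o (fun s => (s, p)) by [].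
apply: continuous_comp; first exact: pair_continuous.
exact: (flow_continuous hPhi ds).
Qed.

(** The integral curve condition uses the preferred chart of the current point, which moves with s;
    here the chart a is fixed. The derivative is two-sided because the times of definition form an
    open set. *)
Lemma orbit_is_derive a s p : atlas a -> dom (s, p) -> cdom a (Phi s p) ->
  is_derive s 1 (fun s => cmap a (Phi s p)) (vrep a X (cmap a (Phi s p))).
Proof.
move=> Aa ds as_; have [_ H] := flow_curve hPhi ds.
set b := chart_at (Phi s p) in H.
have Ab : atlas b by exact: chart_at_atlas.
have bs : cdom b (Phi s p) by exact: chart_at_dom.
have nI : nbhs s [set s | dom (s, p)].
  by apply: open_nbhs_nbhs; split=> //; exact: open_flow_times.
have D := deriv_within_is_derive nI H.
have df : differentiable (cmap b \o Phi ^~ p) s by apply/derivable1_diffP; case: D.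
have [da E] := @derive_chart_change R n M R^o (Phi ^~ p) b a s 1 Ab Aa
  (orbit_continuous ds) bs as_ df.
apply: DeriveDef; first by apply/derivable1_diffP; exact: da.
rewrite -/(cmap a \o Phi ^~ p) E.
have -> : 'D_1 (cmap b \o Phi ^~ p) s = X (Phi s p) by case: D.
by rewrite (vrep_cmap _ as_) (in_chart_change _ Ab Aa bs as_) in_chart_self.
Qed.

Lemma open_orbit_times (a : chart R n M) p : open [set s | dom (s, p) /\ cdom a (Phi s p)].
Proof.
rewrite openE => s [ds as_]; apply: filterI.
  by apply: open_nbhs_nbhs; split=> //; exact: open_flow_times.
apply: (orbit_continuous ds); apply: open_nbhs_nbhs; split=> //.
exact: open_cdom.
Qed.

(** Bootstrapping: the velocity is X evaluated along the orbit, so an orbit of class C^k has a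
    velocity of class C^k. *)
Lemma orbit_smooth (a : chart R n M) p : atlas a ->
  smooth_on ([set s | dom (s, p) /\ cdom a (Phi s p)] : set R^o)
    (fun s => cmap a (Phi s p)).
Proof.
move=> Aa; set I := (X in smooth_on X).
have Io : open I by exact: open_orbit_times.
have df s : I s -> differentiable (fun s => cmap a (Phi s p)) s.
  by move=> [ds as_]; apply/derivable1_diffP; case: (orbit_is_derive Aa ds as_).
elim=> [s Is|k IH].
  exact: differentiable_continuous (df s Is).
split=> [s|v]; first exact: df.
have Uo : open (cmap a @` (cdom a `&` setT)) by apply: open_chart_image; exact: openT.
have sXv := smooth_on_scale v Uo (sX Aa).
have : Ck k I ((fun y => v *: vrep a X y) \o (fun s => cmap a (Phi s p))).
  apply: (Ck_comp Io Uo _ IH (sXv k)) => s [_ as_].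
  by exists (Phi s p).
apply: Ck_ext => // s Is; have [ds as_] := Is.
have [_ E] := orbit_is_derive Aa ds as_.
(* [Ck] quantifies over directions v, which are scalars here: D_v is v times the ordinary
   derivative. *)
have ev : v = v *: 1 + 0 by rewrite addr0; apply: esym; exact: mulr1.
apply: (etrans (congr1 ( *:%R v) (esym E))).
by rewrite [in RHS]ev (derive_lin _ _ _ (df s Is)) derive0 addr0.
Qed.

(** The variational equation. With [Psi] the flow read in charts, J is D_(0, v) [Psi] at (s, x0),
    and D_(1, 0) [Psi] = X o [Psi]; exchanging the two derivatives gives J' = D_J X, that is [X, J]
    = 0 in the chart a. *)
Lemma jacobi_field p (v : 'rV[R]_n) s0 : dom (s0, p) -> let a := chart_at (Phi s0 p) in
  exists N : set R, [/\ open N, N s0,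
    forall s, N s -> dom (s, p) /\ cdom a (Phi s p),
    smooth_on (N : set R^o) (fun s => in_chart a (Phi s p) (Defs.pushforward (Phi s) p v)) &
    forall s, N s -> is_derive s 1 (fun s => in_chart a (Phi s p) (Defs.pushforward (Phi s) p v))
      ('D_(in_chart a (Phi s p) (Defs.pushforward (Phi s) p v)) (vrep a X) (cmap a (Phi s p)))].
Proof.
move=> ds0 a; set b := chart_at p; pose x0 := cmap b p.
have Aa : atlas a by exact: chart_at_atlas.
have as0 : cdom a (Phi s0 p) by exact: chart_at_dom.
have Ab : atlas b by exact: chart_at_atlas.
have bp : cdom b p by exact: chart_at_dom.
have bx0 : cinv b x0 = p by rewrite cmapK.
have ix0 : (cmap b @` cdom b) x0 by exists p.
have [U [Uo Us0 sPsi]] := flow_smooth hPhi ds0.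
pose Psi (z : R * 'rV[R]_n) := cmap a (Phi z.1 (cinv b z.2)).
(* The set U only carries smoothness of the formula for [Psi]. On Z the formula also has its
   meaning: the inverse chart is genuine, the flow is defined and its value lies in the chart a. *)
pose Z : set (R * 'rV[R]_n) := [set z | [/\ (cmap b @` cdom b) z.2,
  dom (z.1, cinv b z.2) & cdom a (Phi z.1 (cinv b z.2))]].
have nZ : nbhs (s0, x0) Z.
  have cG : {for (s0, x0), continuous (fun z : R * 'rV[R]_n => (z.1, cinv b z.2))}.
    apply: (@cvg_pair _ _ _ _ (nbhs s0) (nbhs (cinv b x0))); first exact: cvg_fst.
    apply: (cvg_comp _ _ cvg_snd); exact: cinv_continuous.
  have ds0' : dom (s0, cinv b x0) by rewrite bx0.
  have n1 : nbhs (s0, x0) [set z | (cmap b @` cdom b) z.2].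
    by apply: cvg_snd; apply: open_nbhs_nbhs; split=> //; exact: open_cimg.
  have n2 : nbhs (s0, x0) [set z : R * 'rV[R]_n | dom (z.1, cinv b z.2)].
    by apply: cG; apply: open_nbhs_nbhs; split=> //; exact: (flow_open hPhi).
  have n3 : nbhs (s0, x0) [set z : R * 'rV[R]_n | cdom a (Phi z.1 (cinv b z.2))].
    have cP := continuous_comp cG (flow_continuous hPhi ds0').
    by apply: cP; apply: open_nbhs_nbhs; split=> /=; rewrite ?bx0 //; exact: open_cdom.
  by apply: filterS (filterI n1 (filterI n2 n3)) => z [? [? ?]].
pose U1 := U `&` Z°.
have U1o : open U1 by apply: openI => //; exact: open_interior.
have U1s0 : U1 (s0, x0) by [].
have sPsi1 : smooth_on U1 Psi by apply: smooth_on_sub sPsi => z [].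
have U1Z z : U1 z -> Z z by move=> [_ /nbhs_singleton].
pose N : set R := [set s | U1 (s, x0)].
have No : open N.
  have -> : N = (fun s => (s, x0)) @^-1` U1 by [].
  apply: open_comp => // s _.
  exact: differentiable_continuous (differentiable_slice1 _ _).
pose w : R * 'rV[R]_n := (0, v).
have dPsi z : U1 z -> differentiable Psi z by exact: smooth_on_differentiable.
(* [pushforward] is written in the preferred chart of [Phi s p], which changes with s. The change of
   chart is used in both directions: from a to it for differentiability, then back for the value. *)
have JE s : N s -> in_chart a (Phi s p) (Defs.pushforward (Phi s) p v) = 'D_w Psi (s, x0).
  move=> Ns; have [_ ds as_] := U1Z _ Ns; rewrite /= bx0 in ds as_.
  rewrite -(derive_partial2 v (dPsi _ Ns)).
  pose F x := Phi s (cinv b x).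
  have Fx0 : F x0 = Phi s p by rewrite /F bx0.
  set b' := chart_at (Phi s p).
  have Ab' : atlas b' by exact: chart_at_atlas.
  have b's : cdom b' (Phi s p) by exact: chart_at_dom.
  have cF : {for x0, continuous F}.
    have ds' : dom (s, cinv b x0) by rewrite bx0.
    have cG : {for x0, continuous (fun x => (s, cinv b x))}.
      exact: (@cvg_pair _ _ _ (nbhs x0) (nbhs s) (nbhs (cinv b x0)) _ _ _
        (cst s) (cinv b) (cvg_cst s) (cinv_continuous ix0)).
    exact: (continuous_comp cG (flow_continuous hPhi ds')).
  have dF : differentiable (cmap a \o F) x0.
    exact: (differentiable_comp (differentiable_slice2 s x0) (dPsi _ Ns)).
  have H1 := @derive_chart_change R n M _ F a b' x0 v Aa Ab' cF.
  have H2 := @derive_chart_change R n M _ F b' a x0 v Ab' Aa cF.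
  rewrite Fx0 in H1 H2.
  have [dF' _] := H1 as_ b's dF; have [_ E] := H2 b's as_ dF'.
  by rewrite [RHS]E.
have DPsi z : U1 z -> 'D_((1, 0) : R * 'rV[R]_n) Psi z = vrep a X (Psi z).
  case: z => s x Uz; have [_ ds as_] := U1Z _ Uz.
  rewrite -(@derive_partial1 R R^o _ _ Psi s x 1 (dPsi _ Uz)).
  by case: (orbit_is_derive Aa ds as_).
exists N; split; [exact: No|exact: U1s0| | |].
- by move=> s /U1Z[_ /=]; rewrite bx0.
- have sD := smooth_on_derive w sPsi1.
  have : smooth_on (N : set R^o) ('D_w Psi \o (fun s => (s, x0))).
    move=> k; apply: (@Ck_affine R R^o _ _ k U1 (fun s => (s, x0)) (fun v => (v, 0))) => //.
    by move=> s u; exact: (@derive_slice1 R R^o 'rV[R]_n x0 s u).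
  apply: (smooth_on_ext (No : open (N : set R^o))) => s Ns.
  exact: (esym (JE s Ns)).
- move=> s Ns; have Ns' : nbhs s N by exact: open_nbhs_nbhs.
  have dd : differentiable ('D_w Psi) (s, x0).
    exact: smooth_on_differentiable (smooth_on_derive w sPsi1) Ns.
  have H : is_derive s 1 (fun s => 'D_w Psi (s, x0))
      ('D_((1, 0) : R * 'rV[R]_n) ('D_w Psi) (s, x0)).
    rewrite -(@derive_partial1 R R^o _ _ ('D_w Psi) s x0 1 dd).
    apply: derivableP; apply: diff_derivable.
    exact: (differentiable_comp (differentiable_slice1 x0 s) dd).
  have -> : 'D_(in_chart a (Phi s p) (Defs.pushforward (Phi s) p v)) (vrep a X) (cmap a (Phi s p))
      = 'D_((1, 0) : R * 'rV[R]_n) ('D_w Psi) (s, x0).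
    rewrite (JE s Ns); apply: esym.
    (* The exchange of the time derivative with the derivative in the initial point. *)
    apply: (etrans (derive_sym_mx _ _ U1o Ns sPsi1)).
    have PE : Psi (s, x0) = cmap a (Phi s p) by rewrite /Psi /= bx0.
    have -> : 'D_w ('D_((1, 0) : R * 'rV[R]_n) Psi) (s, x0) = 'D_w (vrep a X \o Psi) (s, x0).
      apply: near_eq_derive; have : nbhs (s, x0) U1 by exact: open_nbhs_nbhs.
      by apply: filterS => z; exact: DPsi.
    have [_ ds as_] := U1Z _ Ns; rewrite /= bx0 in ds as_.
    have dX : differentiable (vrep a X) (Psi (s, x0)).
      apply: smooth_on_differentiable (sX Aa) _; rewrite PE.
      by exists (Phi s p).
    by rewrite (derive_comp w (dPsi _ Ns) dX) PE.
  apply: near_eq_is_derive H; apply: filterS Ns' => u Nu.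
  exact: (esym (JE u Nu)).
Qed.

End Flow.

(** * Moving frames along a curve *)

Section MovingFrame.
Context {R : realType} {n k : nat}.
Variables (N : set R) (E : R -> 'M[R]_(k, n)) (Q : R -> 'M[R]_n) (S : R -> 'M[R]_k).
Variable (J : R -> 'rV[R]_n).
Hypothesis No : open N.
Hypothesis sE : smooth_on (N : set R^o) E.
Hypothesis sQ : smooth_on (N : set R^o) Q.
Hypothesis sJ : smooth_on (N : set R^o) J.
Hypothesis dE : forall s, N s -> is_derive (s : R) 1 E (S s *m E s + E s *m Q s).
Hypothesis dJ : forall s, N s -> is_derive (s : R) 1 J (J s *m Q s).

(** Differentiating J = h E gives J Q = h' E + h S E + h E Q. Since J Q = h E Q, the row h' + h S is
    killed by E, whose rows are independent. *)
Lemma moving_frame_coords (h : R -> 'rV[R]_k) s : N s -> row_free (E s) ->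
  smooth_on (N : set R^o) h -> (forall u, N u -> J u = h u *m E u) ->
  is_derive s 1 h (- (h s *m S s)).
Proof.
move=> Ns fE sh JE; have dh := smooth_on_is_derive sh Ns.
have dhE := is_derive_mulmx dh (dE Ns).
have dJ' : is_derive s 1 J ('D_1 h s *m E s + h s *m (S s *m E s + E s *m Q s)).
  apply: near_eq_is_derive dhE; have : nbhs s N by exact: open_nbhs_nbhs.
  by apply: filterS => u Nu; rewrite JE.
have EE : J s *m Q s = 'D_1 h s *m E s + h s *m (S s *m E s + E s *m Q s).
  by have [_ <-] := dJ Ns; case: dJ'.
suff <- : 'D_1 h s = - (h s *m S s) by [].
apply/eqP; rewrite -subr_eq0 opprK; apply/eqP/(row_free_inj fE).
rewrite mul0mx mulmxDl; move: EE; rewrite (JE _ Ns) mulmxDr !mulmxA addrA.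
by move/eqP; rewrite -[X in X == _]add0r => /eqP/addIr ->.
Qed.

(* The residual r = J - h E, with h = J L (E L)^-1 and L a right inverse of
   E s0, satisfies r L = 0, whence a linear homogeneous equation r' = r P. *)
Lemma moving_frame_span s0 : N s0 -> row_free (E s0) ->
  exists2 d, 0 < d & forall s1 s2, `|s1 - s0| < d -> `|s2 - s0| < d ->
    (exists u, J s1 = u *m E s1) -> exists u, J s2 = u *m E s2.
Proof.
move=> Ns0 fE.
have [U [L [Uo Us0 UN uL]]] := @row_free_nbhs R R^o N k n E s0 No Ns0 sE fE.
have sL (p q : nat) (A : 'M[R]_(p, q)) : smooth_on (U : set R^o) (cst A : R^o -> _).
  exact: smooth_on_cst.
have sEU : smooth_on U E by exact: smooth_on_sub UN sE.
have sQU : smooth_on U Q by exact: smooth_on_sub UN sQ.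
have sJU : smooth_on U J by exact: smooth_on_sub UN sJ.
pose I s := invmx (E s *m L).
have sI : smooth_on U I by exact: (smooth_on_invmx Uo uL (smooth_on_mulmx Uo sEU (sL _ _ L))).
pose h s := J s *m L *m I s.
have sh : smooth_on U h.
  exact: (smooth_on_mulmx Uo (smooth_on_mulmx Uo sJU (sL _ _ L)) sI).
pose r s := J s - h s *m E s.
(* Differentiation gives r' = r Q - G E with G = h' + h S. Since r L = 0 for all times, G E L = r Q
   L, so G = r Q L (E L)^-1; this eliminates both h' and S and leaves r' = r P. *)
pose P s := Q s - Q s *m L *m I s *m E s.
have sP : smooth_on U P.
  apply: smooth_onB => //; apply: (smooth_on_mulmx Uo _ sEU).
  exact: (smooth_on_mulmx Uo (smooth_on_mulmx Uo sQU (sL _ _ L)) sI).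
have rL s : U s -> r s *m L = 0.
  by move=> Us; rewrite mulmxBl -[X in _ - X]mulmxA mulmxKV ?subrr // uL.
have dr s : U s -> is_derive s 1 r (r s *m P s).
  move=> Us; have dh := smooth_on_is_derive sh Us.
  pose G := 'D_1 h s + h s *m S s.
  have D : is_derive s 1 r (r s *m Q s - G *m E s).
    have -> : r s *m Q s - G *m E s =
        J s *m Q s - ('D_1 h s *m E s + h s *m (S s *m E s + E s *m Q s)).
      rewrite /r /G mulmxBl mulmxDl mulmxDr !mulmxA -addrA; congr (_ + _).
      by rewrite addrA [in RHS]opprD addrC.
    exact: (is_deriveB (dJ (UN _ Us)) (is_derive_mulmx dh (dE (UN _ Us)))).
  have D0 : is_derive s 1 (fun s => r s *m L) 0.
    apply: near_eq_is_derive (is_derive_cst 0 s 1).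
    have : nbhs s U by exact: open_nbhs_nbhs.
    by apply: filterS => u Uu; rewrite rL.
  have D1 := is_derive_mulmx D (is_derive_cst L s 1).
  have GE : G *m (E s *m L) = r s *m Q s *m L.
    have : (r s *m Q s - G *m E s) *m L + r s *m 0 = 0.
      by have [_ <-] := D1; case: D0.
    rewrite mulmx0 addr0 mulmxBl => /eqP; rewrite subr_eq0 => /eqP ->.
    by rewrite mulmxA.
  have GE' : G = r s *m Q s *m L *m I s by rewrite -GE mulmxK // uL.
  suff -> : r s *m P s = r s *m Q s - G *m E s by [].
  by rewrite GE' /P mulmxBr !mulmxA.
have cP := smooth_on_continuous sP Us0.
(* A uniform bound on P near s0 is what the Gronwall estimate needs; its radius is the d of the
   statement. *)
have : nbhs s0 (U `&` [set s | `|P s| <= `|P s0| + 1]).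
  apply: filterI; first exact: open_nbhs_nbhs.
  move/cvgrPdist_le : cP => /(_ 1 ltr01); apply: filterS => s /= Hs.
  rewrite -[P s](subrK (P s0)) (le_trans (ler_normD _ _)) // addrC lerD2l.
  by rewrite distrC.
move=> /nbhs_ballP[d /= d0 dP]; exists d => // s1 s2 s1d s2d [u1 u1E].
have ab s : s0 - d < s < s0 + d -> `|s - s0| < d.
  by rewrite distrC ltr_distlC.
have ba s : `|s - s0| < d -> s0 - d < s < s0 + d.
  by rewrite distrC ltr_distlC.
have inU s : s0 - d < s < s0 + d -> U s /\ `|P s| <= `|P s0| + 1.
  by move=> /ab sd; apply: dP; rewrite -ball_normE /= distrC.
have r0 : forall s, s0 - d < s < s0 + d -> r s = 0.
  apply: (@linear_ode_eq0 _ _ r P _ _ (`|P s0| + 1) s1).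
  - by move=> s /inU[Us _]; exact: dr.
  - move=> s i j /inU[_]; apply: le_trans.
    rewrite [leRHS]/Num.Def.normr/= mx_normrE.
    exact: (le_bigmax _ (fun ij : 'I_n * 'I_n => `|P s ij.1 ij.2|) (i, j)).
  - exact: ba.
  - have [Us1 _] := inU _ (ba _ s1d).
    rewrite /r /h u1E -[u1 *m E s1 *m L]mulmxA mulmxK ?subrr //; exact: uL.
exists (h s2); apply/eqP; rewrite -subr_eq0; apply/eqP; apply: r0; exact: ba.
Qed.

End MovingFrame.

(** * Vector fields, functions and the doubled frame along an orbit *)

Section AlongOrbit.
Context {R : realType} {n m : nat} {M : manifold R n}.
Variables (X : vfield M) (V : tangent_distribution M).
Variables (dom : set (R * M)) (Phi : R -> M -> M) (p : M).
Hypothesis hXV : dynamic_pair m X V.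
Hypothesis hreg : regular_pair m X V.
Hypothesis hPhi : is_flow X dom Phi.

Let sX : smooth_vfield setT X := hXV.1.

(** In a chart [X, Y] = D_X Y - D_Y X, and the derivative of Y along the orbit is D_X Y. The term
    D_Y X is the linearization that also drives J, so it cancels when J is compared with the
    frame. *)
Lemma field_along_is_derive a O Y s : atlas a -> open O -> smooth_vfield O Y ->
  dom (s, p) -> cdom a (Phi s p) -> O (Phi s p) ->
  is_derive (s : R) 1 (fun s => vrep a Y (cmap a (Phi s p)))
    (in_chart a (Phi s p) (bracket X Y (Phi s p)) +
     'D_(vrep a Y (cmap a (Phi s p))) (vrep a X) (cmap a (Phi s p))).
Proof.
move=> Aa Oo sY ds as_ Os.
rewrite (bracket_in_chart Aa Oo Os as_ (smooth_vfield_sub (fun _ _ => I) sX) sY) subrK.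
have dY : differentiable (vrep a Y) (cmap a (Phi s p)).
  by apply: smooth_on_differentiable (sY a Aa) _; exists (Phi s p).
have H := orbit_is_derive hPhi Aa ds as_.
have dg : differentiable (fun s : R^o => cmap a (Phi s p)) s.
  by apply/derivable1_diffP; case: H.
have [_ E] := H.
rewrite -(etrans (derive_comp (1 : R^o) dg dY)
  (congr1 (fun v => 'D_v (vrep a Y) (cmap a (Phi s p))) E)).
apply: derivableP; apply: diff_derivable; exact: differentiable_comp dg dY.
Qed.

Lemma function_along_is_derive (O : set M) (f : M -> R^o) s :
  (forall a, atlas a -> smooth_on (cmap a @` (cdom a `&` O)) (f \o cinv a)) ->
  dom (s, p) -> O (Phi s p) ->
  is_derive (s : R) 1 (fun s => f (Phi s p)) (lie_derive X f (Phi s p)).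
Proof.
move=> sf ds Os; set a := chart_at (Phi s p).
have Aa : atlas a by exact: chart_at_atlas.
have as_ : cdom a (Phi s p) by exact: chart_at_dom.
have H := orbit_is_derive hPhi Aa ds as_; rewrite vrep_cmap // in_chart_self in H.
have dg : differentiable (fun s : R^o => cmap a (Phi s p)) s.
  by apply/derivable1_diffP; case: H.
have df : differentiable (f \o cinv a) (cmap a (Phi s p)).
  by apply: smooth_on_differentiable (sf a Aa) _; exists (Phi s p).
have [_ E] := H.
rewrite /lie_derive -/a -(etrans (derive_comp (1 : R^o) dg df)
  (congr1 (fun v => 'D_v (f \o cinv a) (cmap a (Phi s p))) E)).
have D : is_derive (s : R) 1 ((f \o cinv a) \o (fun s : R^o => cmap a (Phi s p)))
    ('D_1 ((f \o cinv a) \o (fun s : R^o => cmap a (Phi s p))) s).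
  apply: derivableP; apply: diff_derivable; exact: differentiable_comp dg df.
apply: near_eq_is_derive D.
have : nbhs s [set s | dom (s, p) /\ cdom a (Phi s p)].
  by apply: open_nbhs_nbhs; split=> //; exact: (open_orbit_times hPhi).
by apply: filterS => u [_ au] /=; rewrite cmapK.
Qed.

Lemma function_along_smooth a (O : set M) q r (f : M -> 'M[R]_(q, r)) (N : set R) :
  atlas a -> open O -> smooth_on (cmap a @` (cdom a `&` O)) (f \o cinv a) ->
  open N -> (forall s, N s -> [/\ dom (s, p), cdom a (Phi s p) & O (Phi s p)]) ->
  smooth_on (N : set R^o) (fun s => f (Phi s p)).
Proof.
move=> Aa Oo sf No NO.
have sg : smooth_on (N : set R^o) (fun s => cmap a (Phi s p)).
  apply: smooth_on_sub (orbit_smooth sX hPhi p Aa) => s /NO[ds as_ _].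
  by split.
have Uo : open (cmap a @` (cdom a `&` O)) by exact: open_chart_image.
apply: (smooth_on_ext (No : open (N : set R^o)) _ (smooth_on_comp No Uo _ sg sf)).
  by move=> s /NO[ds as_ Os] /=; rewrite cmapK.
by move=> s /NO[ds as_ Os]; exists (Phi s p).
Qed.

Lemma vrep_along_smooth a O Y (N : set R) :
  atlas a -> open O -> smooth_vfield O Y ->
  open N -> (forall s, N s -> [/\ dom (s, p), cdom a (Phi s p) & O (Phi s p)]) ->
  smooth_on (N : set R^o) (fun s => vrep a Y (cmap a (Phi s p))).
Proof.
move=> Aa Oo sY No NO.
have sg : smooth_on (N : set R^o) (fun s => cmap a (Phi s p)).
  apply: smooth_on_sub (orbit_smooth sX hPhi p Aa) => s /NO[ds as_ _].
  by split.
have Uo : open (cmap a @` (cdom a `&` O)) by exact: open_chart_image.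
apply: (smooth_on_comp No Uo _ sg (sY a Aa)).
by move=> s /NO[ds as_ Os]; exists (Phi s p).
Qed.

Section Local.
Variables (O : set M) (W : 'I_m -> vfield M) (a : chart R n M) (H : M -> 'M[R]_(m, m + m)).
Hypothesis frW : local_frame V O W.
Hypothesis Aa : atlas a.
Hypothesis HE : forall q j, O q -> bracket X (bracket X (W j)) q =
     \sum_i H q j i *: double_frame X W i q.

Definition frame_along s := frame_mx a (double_frame X W) (cmap a (Phi s p)).
(* Vectors are rows, so Lie transport along the orbit reads
   J' = J *m linearization_along. *)
Definition linearization_along s : 'M[R]_n :=
  \matrix_l 'D_(delta_mx 0 l) (vrep a X) (cmap a (Phi s p)).
(** The matrix of bracketing with X on the doubled frame: W goes to its second half [X, W], and
    [X, W] goes to the combination given by H. *)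
Definition structure_along s : 'M[R]_(m + m) :=
  col_mx (row_mx 0 1%:M) (H (Phi s p)).

Lemma linearization_alongE s u : dom (s, p) -> cdom a (Phi s p) ->
  'D_u (vrep a X) (cmap a (Phi s p)) = u *m linearization_along s.
Proof.
move=> ds as_; apply: derive_along_mul.
by apply: smooth_on_differentiable (sX Aa) _; exists (Phi s p).
Qed.

Lemma bracket_double_frame i q : O q -> bracket X (double_frame X W i) q =
  \sum_l (col_mx (row_mx 0 1%:M) (H q) : 'M[R]_(m + m)) i l *: double_frame X W l q.
Proof.
move=> Oq; case: (fintype.splitP i) => j ij.
  have -> : i = lshift m j by exact/val_inj.
  rewrite double_frame_lshift big_split_ord /= [X in X + _]big1 ?add0r; last first.
    by move=> l _; rewrite col_mxEu row_mxEl mxE scale0r.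
  rewrite (bigD1 j) //= col_mxEu row_mxEr mxE eqxx scale1r double_frame_rshift.
  rewrite big1 ?addr0 // => l lj.
  by rewrite col_mxEu row_mxEr mxE eq_sym (negbTE lj) scale0r.
have -> : i = rshift m j by exact/val_inj.
rewrite double_frame_rshift HE //; apply: eq_bigr => l _.
by rewrite col_mxEd.
Qed.

Lemma frame_along_is_derive s : dom (s, p) -> cdom a (Phi s p) -> O (Phi s p) ->
  is_derive (s : R) 1 frame_along
    (structure_along s *m frame_along s + frame_along s *m linearization_along s).
Proof.
move=> ds as_ Os; have [Oo sW _] := frW.
apply/is_derive_mxP => i j.
have sZ := smooth_double_frame hXV frW i.
have D := field_along_is_derive Aa Oo sZ ds as_ Os.
rewrite (linearization_alongE _ ds as_) (bracket_double_frame i Os) in D.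
have E : \sum_l (col_mx (row_mx 0 1%:M) (H (Phi s p)) : 'M[R]_(m + m)) i l *:
    double_frame X W l (Phi s p) =
    \sum_l (row i (structure_along s)) 0 l *: double_frame X W l (Phi s p).
  by apply: eq_bigr => l _; rewrite [in RHS]mxE.
rewrite E (in_chart_frame _ _ Aa as_) in D.
move/is_derive_mxP : D => /(_ 0 j).
have -> : (row i (structure_along s) *m frame_mx a (double_frame X W) (cmap a (Phi s p)) +
   vrep a (double_frame X W i) (cmap a (Phi s p)) *m linearization_along s) 0 j =
  (structure_along s *m frame_along s + frame_along s *m linearization_along s) i j.
  have -> : vrep a (double_frame X W i) (cmap a (Phi s p)) = row i (frame_along s).
    by rewrite rowK.
  by rewrite -!row_mul -raddfD mxE.
by congr is_derive; apply/funext => u; rewrite mxE.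
Qed.

Lemma double_frame_coords s v : cdom a (Phi s p) -> O (Phi s p) ->
  bracket_span X V (Phi s p) v <->
  exists u, in_chart a (Phi s p) v = u *m frame_along s.
Proof.
move=> as_ Os; split=> [/(bracket_span_frame hXV frW _ Os)[u ->]|[u uE]].
  by exists u; rewrite in_chart_frame.
apply/(bracket_span_frame hXV frW _ Os); exists u.
by apply: (in_chart_inj Aa as_); rewrite in_chart_frame.
Qed.

End Local.

End AlongOrbit.

(** * Coordinates of a Lie transported vector and its class modulo V *)

Section JacobiCoordinates.
Context {R : realType} {n m : nat} {M : manifold R n}.
Variables (X : vfield M) (V : tangent_distribution M).
Variables (dom : set (R * M)) (Phi : R -> M -> M) (p : M).
Hypothesis hXV : dynamic_pair m X V.
Hypothesis hreg : regular_pair m X V.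
Hypothesis hPhi : is_flow X dom Phi.

Let sX : smooth_vfield setT X := hXV.1.

(* y is the image of v under D / V = V, the inverse of W |-> [X, W] mod V. *)
Definition vertical_part q (v y : 'rV[R]_n) : Prop :=
  exists (O : set M) (W : 'I_m -> vfield M) (u : 'rV[R]_(m + m)),
    [/\ O q, local_frame V O W, v = \sum_i u 0 i *: double_frame X W i q &
        y = \sum_j u 0 (rshift m j) *: W j q].

(** The change from (w', b') to (w, b) is block triangular: b' involves w, but w' does not involve
    b. Hence the b-coordinates become l G, the e-terms go to the w-part only, and sum l w' = sum (l
    G) w. *)
Lemma change_of_frame (w b w' b' : 'I_m -> 'rV[R]_n) (G e : 'M[R]_m) :
  (forall j, w' j = \sum_i G j i *: w i) ->
  (forall j, b' j = \sum_i G j i *: b i + \sum_i e j i *: w i) ->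
  forall k l : 'rV[R]_m, \sum_j l 0 j *: w' j = \sum_i (l *m G) 0 i *: w i /\
    \sum_j k 0 j *: w' j + \sum_j l 0 j *: b' j =
    \sum_i (k *m G + l *m e) 0 i *: w i + \sum_i (l *m G) 0 i *: b i.
Proof.
move=> w'E b'E k l.
have comb (x : 'rV[R]_m) (A : 'M[R]_m) (F : 'I_m -> 'rV[R]_n) :
    \sum_j x 0 j *: (\sum_i A j i *: F i) = \sum_i (x *m A) 0 i *: F i.
  under eq_bigr do rewrite scaler_sumr.
  rewrite exchange_big /=; apply: eq_bigr => i _.
  by rewrite mxE scaler_suml; apply: eq_bigr => j _; rewrite scalerA.
have E (x : 'rV[R]_m) : \sum_j x 0 j *: w' j = \sum_i (x *m G) 0 i *: w i.
  by rewrite -comb; apply: eq_bigr => j _; rewrite w'E.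
split; first exact: E.
rewrite E; have -> : \sum_j l 0 j *: b' j =
    \sum_i (l *m G) 0 i *: b i + \sum_i (l *m e) 0 i *: w i.
  rewrite -(comb l G b) -(comb l e w) -big_split; apply: eq_bigr => j _ /=.
  by rewrite b'E scalerDr.
rewrite addrCA addrC; congr (_ + _); rewrite -big_split /=; apply: eq_bigr => i _.
by rewrite [(k *m G + l *m e) 0 i]mxE scalerDl.
Qed.

(** Modulo V both W |-> [X, W] and its inverse are linear at the point q, so the frame does not
    matter. This glues the local fields Y into one field along the curve. *)
Lemma vertical_part_unique q v y y' :
  vertical_part q v y -> vertical_part q v y' -> y = y'.
Proof.
move=> [ O [W [u [ Oq frW -> ->]]]] [ O' [W' [u' [ O'q frW' E ->]]]].
have sec j := bracket_section sX frW (frame_section frW' j) Oq O'q.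
have [G GP] := choice sec.
have [e eP] := choice GP.
pose w j := W j q; pose b j := bracket X (W j) q.
pose w' j := W' j q; pose b' j := bracket X (W' j) q.
have w'E j : w' j = \sum_i (\matrix_(j, i) G j 0 i : 'M[R]_m) j i *: w i.
  by have [H _] := eP j; rewrite /w' H; apply: eq_bigr => i _; rewrite mxE.
have b'E j : b' j = \sum_i (\matrix_(j, i) G j 0 i : 'M[R]_m) j i *: b i +
    \sum_i (\matrix_(j, i) e j 0 i : 'M[R]_m) j i *: w i.
  have [_ H] := eP j; rewrite /b' H.
  by congr (_ + _); apply: eq_bigr => i _; rewrite mxE.
have [E1 E2] := change_of_frame w'E b'E (lsubmx u') (rsubmx u').
have lE (u1 : 'rV[R]_(m + m)) j : u1 0 (lshift m j) = lsubmx u1 0 j by rewrite mxE.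
have rE (u1 : 'rV[R]_(m + m)) j : u1 0 (rshift m j) = rsubmx u1 0 j by rewrite mxE.
have dfE (W1 : 'I_m -> vfield M) (u1 : 'rV[R]_(m + m)) :
    \sum_i u1 0 i *: double_frame X W1 i q =
    \sum_j lsubmx u1 0 j *: W1 j q + \sum_j rsubmx u1 0 j *: bracket X (W1 j) q.
  rewrite double_frame_sum; congr (_ + _); apply: eq_bigr => j _.
    by rewrite lE.
  by rewrite rE.
have yE : \sum_j u' 0 (rshift m j) *: W' j q = \sum_j rsubmx u' 0 j *: w' j.
  by apply: eq_bigr => j _; rewrite rE.
apply: esym; apply: (etrans yE); apply: (etrans E1).
set k2 := lsubmx u' *m _ + _ in E2; set l2 := rsubmx u' *m _ in E2 *.
have uE : u = row_mx k2 l2.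
  apply/eqP; rewrite -subr_eq0; apply/eqP/(double_frame_free hXV hreg frW Oq).
  have -> : \sum_i (u - row_mx k2 l2) 0 i *: double_frame X W i q =
      \sum_i u 0 i *: double_frame X W i q -
      \sum_i (row_mx k2 l2) 0 i *: double_frame X W i q.
    by rewrite -sumrB; apply: eq_bigr => i _; rewrite -scalerBl; congr (_ *: _); rewrite !mxE.
  apply/eqP; rewrite subr_eq0; apply/eqP; apply: (etrans E).
  apply: (etrans (dfE W' u')); apply: (etrans E2); apply: esym; apply: (etrans (dfE W _)).
  congr (_ + _); apply: eq_bigr => i _.
    exact: (congr1 (fun A : 'rV[R]_m => A 0 i *: w i) (row_mxKl k2 l2)).
  exact: (congr1 (fun A : 'rV[R]_m => A 0 i *: b i) (row_mxKr k2 l2)).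
by apply: eq_bigr => j _; rewrite uE row_mxEr.
Qed.

Let J v s : 'rV[R]_n := Defs.pushforward (Phi s) p v.

(** One chart a and one frame W serve all times in N, so the frame along the orbit is a matrix
    function that can be differentiated; H collects its structure matrices. *)
Definition adapted_frame (a : chart R n M) (N : set R) (O : set M)
    (W : 'I_m -> vfield M) (H : M -> 'M[R]_(m, m + m)) : Prop :=
  [/\ open N,
      forall s, N s -> [/\ dom (s, p), cdom a (Phi s p) & O (Phi s p)],
      local_frame V O W,
      forall q j, O q -> bracket X (bracket X (W j)) q =
        \sum_i H q j i *: double_frame X W i q &
      forall b, atlas b -> smooth_on (cmap b @` (cdom b `&` O)) (H \o cinv b)].

Lemma adapted_frame_sub a N N' O W H : open N' -> N' `<=` N ->
  adapted_frame a N O W H -> adapted_frame a N' O W H.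
Proof. by move=> N'o NN [No NP frW HE sH]; split=> // s /NN; exact: NP. Qed.

Lemma exists_adapted_frame a (N0 : set R) s0 : open N0 -> N0 s0 ->
  (forall s, N0 s -> dom (s, p) /\ cdom a (Phi s p)) ->
  exists N O W H, [/\ adapted_frame a N O W H, N s0 & N `<=` N0].
Proof.
move=> N0o N0s0 N0d.
have [_ /(_ (Phi s0 p))[ O [W [ Os0 frW]]]] := hXV.
have [ Oo sW _] := frW.
have [H [HE sH]] := exists_structure_matrices hXV hreg frW.
exists (N0 `&` [set s | O (Phi s p)]), O, W, H; split; [|by []|by move=> s []].
split=> //; last by move=> s [/N0d[ds as_] Os].
rewrite openE => s [N0s Os]; apply: filterI; first exact: open_nbhs_nbhs.
have [ds _] := N0d s N0s.
by apply: (orbit_continuous hPhi ds); exact: open_nbhs_nbhs.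
Qed.

Section Adapted.
Variables (a : chart R n M) (N : set R) (O : set M).
Variables (W : 'I_m -> vfield M) (H : M -> 'M[R]_(m, m + m)).
Hypothesis Aa : atlas a.
Hypothesis adN : adapted_frame a N O W H.

Lemma smooth_frame_along : smooth_on (N : set R^o) (frame_along X Phi p W a).
Proof.
have [No NP frW _ _] := adN; have [ Oo sW _] := frW.
apply/(smooth_on_mxP _ (No : open (N : set R^o))) => i j.
have sZ := vrep_along_smooth hXV hPhi Aa Oo (smooth_double_frame hXV frW i) No NP.
apply: (smooth_on_ext (No : open (N : set R^o)) _
  ((smooth_on_mxP _ (No : open (N : set R^o))).1 sZ 0 j)).
by move=> s _; rewrite mxE.
Qed.

Lemma smooth_linearization_along : smooth_on (N : set R^o) (linearization_along X Phi p a).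
Proof.
have [No NP _ _ _] := adN.
have sg : smooth_on (N : set R^o) (fun s => cmap a (Phi s p)).
  by apply: smooth_on_sub (orbit_smooth sX hPhi p Aa) => s /NP[].
have Uo : open (cmap a @` (cdom a `&` setT)) by apply: open_chart_image; exact: openT.
apply/(smooth_on_mxP _ (No : open (N : set R^o))) => l j.
have sD := smooth_on_derive (delta_mx 0 l) (sX Aa).
have sDg : smooth_on (N : set R^o) ('D_(delta_mx 0 l) (vrep a X) \o (fun s => cmap a (Phi s p))).
  apply: (smooth_on_comp (No : open (N : set R^o)) Uo _ sg sD) => s /NP[_ as_ _].
  by exists (Phi s p).
apply: (smooth_on_ext (No : open (N : set R^o)) _
  ((smooth_on_mxP _ (No : open (N : set R^o))).1 sDg 0 j)).
by move=> s _; rewrite mxE.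
Qed.

Lemma smooth_structure_along : smooth_on (N : set R^o) (fun s => H (Phi s p)).
Proof.
have [No NP [ Oo _ _] _ sH] := adN.
exact: (function_along_smooth hXV hPhi Aa Oo (sH a Aa) No NP).
Qed.

Lemma frame_along_row_free s : N s -> row_free (frame_along X Phi p W a s).
Proof.
have [No NP frW _ _] := adN => /NP[ds as_ Os].
exact: (double_frame_row_free hXV hreg frW Aa as_ Os).
Qed.

Lemma adapted_frame_is_derive s : N s -> is_derive (s : R) 1 (frame_along X Phi p W a)
  (structure_along Phi p H s *m frame_along X Phi p W a s +
   frame_along X Phi p W a s *m linearization_along X Phi p a s).
Proof.
have [No NP frW HE _] := adN => /NP[ds as_ Os].
exact: (frame_along_is_derive hXV hPhi frW Aa HE ds as_ Os).
Qed.

End Adapted.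

(** The symmetric form in s1 and s2 is the one that [segment_ind] consumes: J neither leaves nor
    enters D near s0. *)
Lemma jacobi_span_local v s0 : dom (s0, p) ->
  exists2 d, 0 < d & forall s1 s2, `|s1 - s0| < d -> `|s2 - s0| < d ->
   bracket_span X V (Phi s1 p) (J v s1) ->  bracket_span X V (Phi s2 p) (J v s2).
Proof.
move=> ds0; set a := chart_at (Phi s0 p).
have Aa : atlas a by exact: chart_at_atlas.
have [N0 [N0o N0s0 N0d sJ dJ]] := jacobi_field sX hPhi v ds0.
have [N [ O [W [H [adN Ns0 NN0]]]]] := exists_adapted_frame N0o N0s0 N0d.
have [No NP frW HE sH] := adN.
have dJ' s : N s -> is_derive (s : R) 1 (fun s => in_chart a (Phi s p) (J v s))
   (in_chart a (Phi s p) (J v s) *m linearization_along X Phi p a s).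
  move=> Ns; have [ds as_ _] := NP s Ns.
  by rewrite -(linearization_alongE hXV Aa _ ds as_); exact: dJ (NN0 _ Ns).
have [d d0 dP] := moving_frame_span No (smooth_frame_along Aa adN)
  (smooth_linearization_along Aa adN) (smooth_on_sub NN0 sJ)
  (adapted_frame_is_derive Aa adN) dJ' Ns0 (frame_along_row_free Aa adN Ns0).
have /nbhs_ballP[r /= r0 rN] : nbhs s0 N by exact: open_nbhs_nbhs.
exists (Num.min d r); first by rewrite lt_min d0.
move=> s1 s2; rewrite !lt_min => /andP[s1d s1r] /andP[s2d s2r].
have inN s : `|s - s0| < r -> N s.
  by move=> sr; apply: rN; rewrite -ball_normE /= distrC.
have [_ a1 O1] := NP _ (inN _ s1r); have [_ a2 O2] := NP _ (inN _ s2r).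
move=> /(double_frame_coords hXV frW Aa _ a1 O1) H1.
by apply/(double_frame_coords hXV frW Aa _ a2 O2); exact: dP H1.
Qed.

(** With h = (x, y), the equation h' = - h S is the pair x' = - H0 y, y' = - x - H1 y, written for
    rows. *)
Lemma jacobi_coordinates v s0 : dom (s0, p) -> bracket_span X V (Phi s0 p) (J v s0) ->
  exists N O W H (h : R -> 'rV[R]_(m + m)), [/\ adapted_frame (chart_at (Phi s0 p)) N O W H,
    N s0, smooth_on (N : set R^o) h,
    forall s, N s -> J v s = \sum_i h s 0 i *: double_frame X W i (Phi s p) &
    forall s, N s -> is_derive s 1 h (- (h s *m structure_along Phi p H s))].
Proof.
move=> ds0 Js0; set a := chart_at (Phi s0 p).
have Aa : atlas a by exact: chart_at_atlas.
have [N0 [N0o N0s0 N0d sJ dJ]] := jacobi_field sX hPhi v ds0.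
have [N1 [ O [W [H [adN1 N1s0 N1N0]]]]] := exists_adapted_frame N0o N0s0 N0d.
have [d d0 dP] := jacobi_span_local v ds0.
(* On this ball J inherits membership in D from the time s0, so coordinates exist throughout N;
   outside N the choice below takes the value 0. *)
pose N := N1 `&` ball s0 d.
have NN1 : N `<=` N1 by move=> s [].
have [N1o _ _ _ _] := adN1.
have No : open N by apply: openI => //; exact: ball_open.
have adN := adapted_frame_sub No NN1 adN1; have [_ NP frW HE sH] := adN.
have Ns0 : N s0 by split=> //; exact: ballxx.
have dJ' s : N s -> is_derive (s : R) 1 (fun s => in_chart a (Phi s p) (J v s))
   (in_chart a (Phi s p) (J v s) *m linearization_along X Phi p a s).
  move=> Ns; have [ds as_ _] := NP s Ns.
  by rewrite -(linearization_alongE hXV Aa _ ds as_); exact: dJ (N1N0 _ (NN1 _ Ns)).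
have ex s : exists u : 'rV[R]_(m + m), N s ->
    in_chart a (Phi s p) (J v s) = u *m frame_along X Phi p W a s.
  have [Ns|nN] := pselect (N s); last by exists 0.
  have [_ as_ Os] := NP _ Ns.
  have sd : `|s - s0| < d by have [_] := Ns; rewrite -ball_normE /= distrC.
  have s0d : `|s0 - s0| < d by rewrite subrr normr0.
  have [u uE] := (double_frame_coords hXV frW Aa _ as_ Os).1 (dP s0 s s0d sd Js0).
  by exists u.
have [h hP] := choice ex.
have sJN : smooth_on (N : set R^o) (fun s => in_chart a (Phi s p) (J v s)).
  by apply: smooth_on_sub sJ => s /NN1/N1N0.
have sh : smooth_on (N : set R^o) h.
  exact: (smooth_on_row_coords (No : open (N : set R^o)) (smooth_frame_along Aa adN)
    (frame_along_row_free Aa adN) sJN hP).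
exists N, O, W, H, h; split=> // s Ns.
  have [_ as_ Os] := NP _ Ns; apply: (in_chart_inj Aa as_).
  by rewrite (in_chart_frame _ _ Aa as_); exact: hP.
exact: (moving_frame_coords No (adapted_frame_is_derive Aa adN) dJ' Ns
  (frame_along_row_free Aa adN Ns) sh hP).
Qed.

End JacobiCoordinates.

(** * The Jacobi equation *)

Section JacobiMetric.
Context {R : realType} {n m : nat} {M : manifold R n}.
Variables (X : vfield M) (V : tangent_distribution M).
Variables (dom : set (R * M)) (Phi : R -> M -> M) (T : R) (c : R -> M).
Hypothesis hXV : dynamic_pair m X V.
Hypothesis hreg : regular_pair m X V.
Hypothesis hPhi : is_flow X dom Phi.
Hypothesis hc : forall s, 0 <= s <= T -> dom (s, c 0) /\ c s = Phi s (c 0).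

Let p := c 0.

Lemma section_along_frame (N : set R) (O : set M) (W : 'I_m -> vfield M) (y : R -> 'rV[R]_m) :
  open N -> (forall s, N s -> dom (s, p) /\ O (Phi s p)) -> local_frame V O W ->
  smooth_on (N : set R^o) y ->
  section_along V c (`[0, T] `&` N) (fun s => \sum_j y s 0 j *: W j (Phi s p)).
Proof.
move=> No NP frW sy; have [ Oo sW _] := frW; split=> t [tT Nt].
  have t0T : 0 <= t <= T by move: tT; rewrite /= in_itv.
  have [_ ->] := hc t0T; have [_ Ot] := NP t Nt.
  by apply/(frame_memv _ frW Ot); exists (y t).
have t0T : 0 <= t <= T by move: tT; rewrite /= in_itv.
have [dt ct] := hc t0T; set a := chart_at (c t).
have Aa : atlas a by exact: chart_at_atlas.
have at_ : cdom a (Phi t p) by rewrite /p -ct; exact: chart_at_dom.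
(* [section_along] tests smoothness near t in the preferred chart of c t, which need not be the
   chart in which the frame was built; N is cut down to the times spent in it. *)
pose N' := N `&` [set s | dom (s, p) /\ cdom a (Phi s p)].
have N'o : open N' by apply: openI => //; exact: (open_orbit_times hPhi).
exists N'; split=> //.
have NP' s : N' s -> [/\ dom (s, p), cdom a (Phi s p) & O (Phi s p)].
  by move=> [Ns [ds as_]]; have [_ Os] := NP s Ns.
have sf : smooth_on (N' : set R^o)
    (fun s => \sum_j (y s 0 j : R^o) *: vrep a (W j) (cmap a (Phi s p))).
  apply: smooth_on_sum => // j; apply: (smooth_onZ (N'o : open (N' : set R^o))).
    have sy' : smooth_on (N' : set R^o) y by apply: smooth_on_sub sy => s [].
    exact: (smooth_on_mxP _ (N'o : open (N' : set R^o))).1 sy' 0 j.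
  exact: (vrep_along_smooth hXV hPhi Aa Oo (sW j) N'o NP').
have sub : `[0, T] `&` N `&` N' `<=` N' by move=> s [].
have [D [D0 D1]] := smooth_on_curve sub sf; exists D; split=> // s As.
rewrite D0 //; have [[sT Ns] N's] := As.
have s0T : 0 <= s <= T by move: sT; rewrite /= in_itv.
have [_ ->] := hc s0T; have [ds as_ Os] := NP' s N's.
rewrite (in_chart_sum _ _ Aa as_); apply: eq_bigr => j _.
by rewrite (vrep_cmap _ as_).
Qed.

Section Frame.
Variables (a : chart R n M) (N : set R) (O : set M).
Variables (W : 'I_m -> vfield M) (H : M -> 'M[R]_(m, m + m)).
Hypothesis adN : adapted_frame X V dom Phi p a N O W H.

(** The coordinates of [X, [X, W_j]] form row j of H, but column j of the structure matrices. *)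
Let H0 q := (lsubmx (H q))^T.
Let H1 q := (rsubmx (H q))^T.

Lemma adapted_structure_matrices : structure_matrices X O W H0 H1.
Proof.
move=> q j Oq; have [_ _ _ HE _] := adN; rewrite HE //.
have -> : \sum_i H q j i *: double_frame X W i q =
    \sum_i (row j (H q)) 0 i *: double_frame X W i q.
  by apply: eq_bigr => i _; rewrite [in RHS]mxE.
rewrite double_frame_sum.
by congr (_ + _); apply: eq_bigr => i _; rewrite !mxE.
Qed.

Lemma cov_derive_frame (y : R -> 'rV[R]_m) (y' : 'rV[R]_m) t :
  (`[0, T] `&` N) t -> is_derive (t : R) 1 y y' ->
  cov_derive_along m X V c (`[0, T] `&` N) (fun s => \sum_j y s 0 j *: W j (Phi s p)) t
    (\sum_i (y' + 2^-1 *: (y t *m rsubmx (H (Phi t p)))) 0 i *: W i (Phi t p)).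
Proof.
move=> [tT Nt] dy; have [No NP frW HE sH] := adN.
have t0T : 0 <= t <= T by move: tT; rewrite /= in_itv.
have [dt ct] := hc t0T; have [_ at_ Ot] := NP t Nt.
exists O, W, H0, H1, (fun j s => y s 0 j), (fun j => y' 0 j); split=> //.
- by rewrite ct.
- exact: adapted_structure_matrices.
- move=> s [sT Ns] _; have s0T : 0 <= s <= T by move: sT; rewrite /= in_itv.
  by have [_ ->] := hc s0T.
split=> [j|].
  by apply: is_derive_deriv_within; move/is_derive_mxP : dy => /(_ 0 j).
rewrite ct scaler_sumr -big_split /=; apply: eq_bigr => i _.
rewrite -scaler_suml scalerA -scalerDl; congr (_ *: _).
rewrite mxE; congr (_ + _); rewrite mxE; congr (_ * _).
by rewrite mxE; apply: eq_bigr => j _; congr (_ * _); rewrite /H1 [RHS]mxE.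
Qed.

(** The source of the term X(H1) in the curvature: it appears when the coordinates of D_X Y, which
    contain H1, are differentiated. *)
Lemma H1_along_is_derive t : N t ->
  is_derive (t : R) 1 (fun s => rsubmx (H (Phi s p)))
    (\matrix_(i, j) lie_derive X (fun q => H1 q i j) (Phi t p))^T.
Proof.
move=> Nt; have [No NP frW HE sH] := adN; have [dt at_ Ot] := NP t Nt.
have [ Oo _ _] := frW.
apply/is_derive_mxP => i j; rewrite !mxE.
have sf b : atlas b -> smooth_on (cmap b @` (cdom b `&` O)) ((fun q => H1 q j i : R^o) \o cinv b).
  move=> Ab; have Uo : open (cmap b @` (cdom b `&` O)) by exact: open_chart_image.
  apply: (smooth_on_ext Uo _ ((smooth_on_mxP _ Uo).1 (sH b Ab) i (rshift m j))).
  by move=> z _; rewrite /= /H1 !mxE.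
have := function_along_is_derive hPhi sf dt Ot.
by congr is_derive; apply/funext => s; rewrite /H1 mxE.
Qed.

Lemma curvature_frame (K : M -> 'End('rV[R]_n)) (y : 'rV[R]_m) t :
  is_curvature_operator m X V K -> N t ->
  K (Phi t p) (\sum_j y 0 j *: W j (Phi t p)) =
  \sum_i (y *m (curvature_matrix X H0 H1 (Phi t p))^T) 0 i *: W i (Phi t p).
Proof.
move=> hK Nt; have [No NP frW HE sH] := adN; have [dt at_ Ot] := NP t Nt.
rewrite linear_sum /=.
have E j : K (Phi t p) (y 0 j *: W j (Phi t p)) =
    \sum_i (y 0 j * curvature_matrix X H0 H1 (Phi t p) i j) *: W i (Phi t p).
  rewrite linearZ /= (hK O W H0 H1 frW adapted_structure_matrices _ j Ot) scaler_sumr.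
  by apply: eq_bigr => i _; rewrite scalerA.
rewrite (eq_bigr _ (fun j _ => E j)) exchange_big /=; apply: eq_bigr => i _.
rewrite -scaler_suml; congr (_ *: _); rewrite mxE; apply: eq_bigr => j _.
by rewrite [in RHS]mxE.
Qed.

End Frame.

End JacobiMetric.

(** * The Jacobi equation and the derivatives of g(Y, Y) and g(Y, D_X Y) *)

Section JacobiLocal.
Context {R : realType} {n m : nat} {M : manifold R n}.
Variables (X : vfield M) (V : tangent_distribution M).
Variables (dom : set (R * M)) (Phi : R -> M -> M) (T : R) (c : R -> M).
Hypothesis hXV : dynamic_pair m X V.
Hypothesis hreg : regular_pair m X V.
Hypothesis hPhi : is_flow X dom Phi.
Hypothesis hc : forall s, 0 <= s <= T -> dom (s, c 0) /\ c s = Phi s (c 0).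
Variable g : R -> 'rV[R]_n -> 'rV[R]_n -> R^o.
Hypothesis hg : invariant_metric m X V c `[0, T] g.
Variable K : M -> 'End('rV[R]_n).
Hypothesis hK : is_curvature_operator m X V K.

Let p := c 0.
Let J (v : 'rV[R]_n) s : 'rV[R]_n := Defs.pushforward (Phi s) p v.

Lemma is_derive_lsubmx k l (h : R -> 'rV[R]_(k + l)) s h' :
  is_derive (s : R) 1 h h' -> is_derive s 1 (fun s => lsubmx (h s)) (lsubmx h').
Proof.
move=> /is_derive_mxP dh; apply/is_derive_mxP => i j; rewrite mxE.
by have := dh i (lshift l j); congr is_derive; apply/funext => u; rewrite mxE.
Qed.

Lemma is_derive_rsubmx k l (h : R -> 'rV[R]_(k + l)) s h' :
  is_derive (s : R) 1 h h' -> is_derive s 1 (fun s => rsubmx (h s)) (rsubmx h').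
Proof.
move=> /is_derive_mxP dh; apply/is_derive_mxP => i j; rewrite mxE.
by have := dh i (rshift k j); congr is_derive; apply/funext => u; rewrite mxE.
Qed.

Lemma smooth_on_lsubmx k l q (N : set R) (h : R -> 'M[R]_(q, k + l)) : open N ->
  smooth_on (N : set R^o) h -> smooth_on (N : set R^o) (fun s => lsubmx (h s)).
Proof.
move=> No /(smooth_on_mxP _ (No : open (N : set R^o))) sh.
apply/(smooth_on_mxP _ (No : open (N : set R^o))) => i j.
by apply: (smooth_on_ext (No : open (N : set R^o)) _ (sh i (lshift l j))) => s _; rewrite mxE.
Qed.

Lemma smooth_on_rsubmx k l q (N : set R) (h : R -> 'M[R]_(q, k + l)) : open N ->
  smooth_on (N : set R^o) h -> smooth_on (N : set R^o) (fun s => rsubmx (h s)).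
Proof.
move=> No /(smooth_on_mxP _ (No : open (N : set R^o))) sh.
apply/(smooth_on_mxP _ (No : open (N : set R^o))) => i j.
by apply: (smooth_on_ext (No : open (N : set R^o)) _ (sh i (rshift k j))) => s _; rewrite mxE.
Qed.

(** Here A = y H0, B = x H1, C = y H1 H1 and D = y X(H1), for rows and transposed matrices. The left
    side is the coordinate row of D_X D_X Y; the terms B cancel, so x disappears and the curvature
    matrix remains. *)
Lemma jacobi_equation_algebra (A B C D : 'rV[R]_m) :
  - (- A + 2^-1 *: (- (B + C) + D)) + 2^-1 *: (- (B + 2^-1 *: C)) =
  - (- A + 2^-1 *: D - 4^-1 *: C).
Proof.
apply/rowP => i; rewrite !mxE.
have -> : (4^-1 : R) = 2^-1 * 2^-1 by rewrite -invfM -natrM.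
by lra.
Qed.

(** Everything later needed about J near s0, stated without frames. Z is D_X Y, so the two
    derivatives follow from invariance of g and D_X Z = - K Y. The last clause recovers J from Y: if
    y vanishes up to s0, so does its derivative - x - H1 y at s0, hence x as well. *)
Lemma jacobi_local v s0 : 0 < T -> 0 <= s0 <= T -> bracket_span X V (Phi s0 p) (J v s0) ->
  exists (N : set R) (Y Z : R -> 'rV[R]_n), [/\ open N, N s0,
    forall s, 0 <= s <= T -> N s ->
      [/\ vertical_part (m := m) X V (Phi s p) (J v s) (Y s), Y s \in V (c s) & Z s \in V (c s)],
    forall s, 0 <= s <= T -> N s ->
      has_deriv_within `[0, T] (fun s => g s (Y s) (Y s)) s (2 * g s (Y s) (Z s)) /\
      has_deriv_within `[0, T] (fun s => g s (Y s) (Z s)) s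
        (g s (Z s) (Z s) - g s (K (c s) (Y s)) (Y s)) &
    0 < s0 -> (forall s, 0 <= s <= s0 -> N s -> Y s = 0) -> J v s0 = 0].
Proof.
move=> T0 s0T Js0; have [ds0 cs0] := hc s0T.
have [N [ O [W [H [h [adN Ns0 sh JE dh]]]]]] := jacobi_coordinates hXV hreg hPhi ds0 Js0.
have [No NP frW HE sH] := adN; have [ Oo _ _] := frW.
have sHN : smooth_on (N : set R^o) (fun s => H (Phi s p)).
  exact: (smooth_structure_along hXV hPhi (chart_at_atlas _) adN).
pose x s := lsubmx (h s); pose y s := rsubmx (h s).
pose Hl s := lsubmx (H (Phi s p)); pose Hr s := rsubmx (H (Phi s p)).
have sx : smooth_on (N : set R^o) x by exact: smooth_on_lsubmx.
have sy : smooth_on (N : set R^o) y by exact: smooth_on_rsubmx.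
have sHr : smooth_on (N : set R^o) Hr by exact: smooth_on_rsubmx.
have hS s : h s *m structure_along Phi p H s = row_mx (y s *m Hl s) (x s + y s *m Hr s).
  rewrite -[h s]hsubmxK -/(x s) -/(y s) /structure_along mul_row_col mul_mx_row.
  by rewrite mulmx0 mulmx1 -[H _]hsubmxK mul_mx_row add_row_mx add0r.
have dx s : N s -> is_derive (s : R) 1 x (- (y s *m Hl s)).
  move=> Ns; have := is_derive_lsubmx (dh s Ns).
  by rewrite hS opp_row_mx row_mxKl.
have dy s : N s -> is_derive (s : R) 1 y (- (x s + y s *m Hr s)).
  move=> Ns; have := is_derive_rsubmx (dh s Ns).
  by rewrite hS opp_row_mx row_mxKr.
(* Coordinates of D_X Y: y' + (1/2) y H1 with y' = - x - y H1. *)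
pose z s := - (x s + 2^-1 *: (y s *m Hr s)).
have syHr : smooth_on (N : set R^o) (fun s => y s *m Hr s).
  exact: (smooth_on_mulmx (No : open (N : set R^o)) sy sHr).
have sz : smooth_on (N : set R^o) z.
  apply: (smooth_on_ext (No : open (N : set R^o)) _
    (smooth_on_scale (-1) (No : open (N : set R^o))
      (smooth_onD (No : open (N : set R^o)) sx
        (smooth_on_scale 2^-1 (No : open (N : set R^o)) syHr)))).
  by move=> s _; rewrite scaleN1r.
pose D s := (\matrix_(i, j) lie_derive X (fun q => (rsubmx (H q))^T i j) (Phi s p))^T.
have dHr s : N s -> is_derive (s : R) 1 Hr (D s) by exact: (H1_along_is_derive hPhi adN).
have dz s : N s -> is_derive (s : R) 1 z
    (- (- (y s *m Hl s) + 2^-1 *: (- (x s + y s *m Hr s) *m Hr s + y s *m D s))).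
  move=> Ns; apply: is_deriveN; apply: is_deriveD; first exact: dx.
  by apply: is_deriveZ; apply: is_derive_mulmx; [exact: dy|exact: dHr].
pose Y s := \sum_j y s 0 j *: W j (Phi s p).
pose Z s := \sum_j z s 0 j *: W j (Phi s p).
have NP' s : N s -> dom (s, p) /\ O (Phi s p) by move=> /NP[].
have secY := section_along_frame hXV hPhi hc No NP' frW sy.
have secZ := section_along_frame hXV hPhi hc No NP' frW sz.
have AN s : 0 <= s <= T -> N s -> (`[0, T] `&` N) s.
  by move=> sT Ns; split=> //; rewrite /= in_itv.
have covY s : 0 <= s <= T -> N s -> cov_derive_along m X V c (`[0, T] `&` N) Y s (Z s).
  move=> sT Ns; have := cov_derive_frame hc adN (AN s sT Ns) (dy s Ns).
  suff -> : - (x s + y s *m Hr s) + 2^-1 *: (y s *m rsubmx (H (Phi s p))) = z s by [].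
  rewrite /z -/(Hr s); move: (x s) (y s *m Hr s) => A B.
  by apply/rowP => i; rewrite !mxE; lra.
have covZ s : 0 <= s <= T -> N s ->
    cov_derive_along m X V c (`[0, T] `&` N) Z s (- K (c s) (Y s)).
  move=> sT Ns; have := cov_derive_frame hc adN (AN s sT Ns) (dz s Ns).
  have [_ ->] := hc sT.
  rewrite (curvature_frame adN (y s) hK Ns) -sumrN.
  set w := _ + _; set w' := y s *m _.
  suff -> : w = - w'.
    by congr cov_derive_along; apply: eq_bigr => i _; rewrite mxE scaleNr.
  rewrite /w /w' -/(Hr s) /z !mulNmx !mulmxDl -!scalemxAl jacobi_equation_algebra.
  (* Transposition reverses the product H1 H1, harmlessly since both factors are equal; the rest is
     entrywise. *)
  have -> : (curvature_matrix X (fun q => (lsubmx (H q))^T) (fun q => (rsubmx (H q))^T)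
      (Phi s p))^T = - Hl s + 2^-1 *: D s - 4^-1 *: (Hr s *m Hr s).
    apply/matrixP => i j; rewrite /curvature_matrix mxE.
    have tE q1 q2 (A : 'M[R]_(q1, q2)) i1 j1 : A^T i1 j1 = A j1 i1 by rewrite mxE.
    rewrite -[Hr s *m Hr s]trmxK trmx_mul /Hr.
    rewrite [LHS]mxE [RHS]mxE; congr (_ + _).
      rewrite [LHS]mxE [RHS]mxE; congr (_ + _).
        by rewrite [LHS]mxE [RHS]mxE tE.
      by rewrite [LHS]mxE [RHS]mxE [D s i j]tE.
    rewrite [LHS]mxE [RHS]mxE; congr (- _).
    by rewrite [LHS]mxE [RHS]mxE [in RHS]tE.
  rewrite mulmxBr mulmxDr mulmxN -!scalemxAr mulmxA.
  by [].
have fiber s : 0 <= s <= T -> N s ->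
    [/\ Y s \in V (c s), Z s \in V (c s) & K (c s) (Y s) \in V (c s)].
  move=> sT Ns; have [_ Os] := NP' s Ns; have [_ ->] := hc sT.
  split; apply/(frame_memv _ frW Os); [by exists (y s)|by exists (z s)|].
  by exists (y s *m (curvature_matrix X (fun q => (lsubmx (H q))^T)
    (fun q => (rsubmx (H q))^T) (Phi s p))^T); rewrite (curvature_frame adN (y s) hK Ns).
have [met inv] := hg.
exists N, Y, Z; split=> //.
- move=> s sT Ns; have [YV ZV _] := fiber s sT Ns; split=> //.
  have [_ Os] := NP' s Ns; exists O, W, (h s); split=> //; first exact: JE.
  by apply: eq_bigr => j _; rewrite mxE.
- move=> s sT Ns; have [YV ZV KV] := fiber s sT Ns.
  have nN : nbhs s N by exact: open_nbhs_nbhs.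
  have IT : `[0, T]%classic s by rewrite /= in_itv.
  have loc (f : R -> R^o) l : has_deriv_within (`[0, T] `&` N) f s l ->
      has_deriv_within `[0, T] f s l.
    by apply: (has_deriv_within_sub nN) => // u Nu uT.
  split; apply: loc.
    have := inv N Y Y No secY secY s (Z s) (Z s) (AN s sT Ns) (covY s sT Ns) (covY s sT Ns).
    by rewrite (Defs.metric_sym met IT ZV YV) mulr_natl mulr2n.
  have := inv N Y Z No secY secZ s (Z s) (- K (c s) (Y s)) (AN s sT Ns)
    (covY s sT Ns) (covZ s sT Ns).
  suff -> : g s (Y s) (- K (c s) (Y s)) = - g s (K (c s) (Y s)) (Y s) by [].
  rewrite (Defs.metric_sym met IT YV) ?rpredN //.
  have g0 : g s 0 (Y s) = 0.
    have := metric_linear met 1 IT (mem0v _) (mem0v _) YV.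
    rewrite scaler0 addr0 mul1r => /eqP; rewrite -[X in X == _]addr0.
    by rewrite (inj_eq (addrI _)) => /eqP.
  have := metric_linear met (-1) IT KV (mem0v _) YV.
  by rewrite g0 addr0 addr0 scaleN1r mulN1r.
- move=> s0p Yz.
  have y0 s : 0 <= s <= s0 -> N s -> y s = 0.
    move=> sT Ns; have [_ Os] := NP' s Ns.
    by apply: (frame_free frW Os); exact: Yz.
  have ys0 : y s0 = 0 by apply: y0 => //; rewrite lexx ltW.
  (* Y is known to vanish only up to s0, so the derivative is taken from the left; 0 < s0 makes s0 a
     limit point of the times used, and the derivative is unique. *)
  have dy0 : - (x s0 + y s0 *m Hr s0) = 0.
    have D1 : has_deriv_within (`[0, s0] `&` N) y s0 (- (x s0 + y s0 *m Hr s0)).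
      exact: is_derive_deriv_within (dy s0 Ns0).
    apply: (has_deriv_within_unique _ D1).
      move=> d d0; have : nbhs s0 N by exact: open_nbhs_nbhs.
      move=> /nbhs_ballP[r /= r0 rN].
      have dr0 : 0 < Num.min d r by rewrite lt_min d0.
      have s0s0 : 0 <= s0 <= s0 by rewrite lexx ltW.
      have [u [u0 us]] := segment_limit_point s0p s0s0 dr0.
      rewrite lt_min => /andP[ud ur]; exists u; split=> //.
      split; first by rewrite /= in_itv.
      by apply: rN; rewrite -ball_normE /= distrC.
    apply/has_deriv_withinP => e e0; exists 1 => // s [sT Ns] _ _.
    move: sT; rewrite /= in_itv /= => sT.
    by rewrite ys0 y0 // subrr scaler0 subrr normr0 ltW.
  have xs0 : x s0 = 0.
    by move/eqP: dy0; rewrite ys0 mul0mx addr0 oppr_eq0 => /eqP.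
  apply: (etrans (JE s0 Ns0)); apply: big1 => i _.
  have -> : h s0 = 0 by rewrite -[h s0]hsubmxK -/(x s0) -/(y s0) xs0 ys0 row_mx0.
  by rewrite mxE scale0r.
Qed.

End JacobiLocal.

(** * Conjugate times *)

Section Conjugate.
Context {R : realType} {n m : nat} {M : manifold R n}.
Variables (X : vfield M) (V : tangent_distribution M).
Variables (dom : set (R * M)) (Phi : R -> M -> M) (T : R) (c : R -> M).
Hypothesis hXV : dynamic_pair m X V.
Hypothesis hreg : regular_pair m X V.
Hypothesis hPhi : is_flow X dom Phi.
Hypothesis hc : forall s, 0 <= s <= T -> dom (s, c 0) /\ c s = Phi s (c 0).
Variable g : R -> 'rV[R]_n -> 'rV[R]_n -> R^o.
Hypothesis hg : invariant_metric m X V c `[0, T] g.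
Variable K : M -> 'End('rV[R]_n).
Hypothesis hK : is_curvature_operator m X V K.
Variable lam : R.
Hypothesis hlam : forall t v, 0 <= t <= T -> v \in V (c t) ->
  g t (K (c t) v) v <= lam * g t v v.

Let p := c 0.
Let J (v : 'rV[R]_n) s : 'rV[R]_n := Defs.pushforward (Phi s) p v.

Lemma vertical_coords q v : v \in V q ->
  exists (O : set M) (W : 'I_m -> vfield M) (u : 'rV[R]_(m + m)),
  [/\ O q, local_frame V O W, v = \sum_i u 0 i *: double_frame X W i q & rsubmx u = 0].
Proof.
move=> vV; have [_ /(_ q)[ O [W [ Oq frW]]]] := hXV.
have [k kE] := (frame_memv v frW Oq).1 vV.
exists O, W, (row_mx k 0); split=> //; last exact: row_mxKr.
rewrite double_frame_sum [X in _ = _ + X]big1 ?addr0.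
  by rewrite kE; apply: eq_bigr => j _; rewrite row_mxEl.
by move=> j _; rewrite row_mxEr mxE scale0r.
Qed.

Lemma vertical_part0 q v : v \in V q -> vertical_part (m := m) X V q v 0.
Proof.
move=> /vertical_coords[ O [W [u [ Oq frW uE u0]]]]; exists O, W, u; split=> //.
rewrite big1 // => j _.
have -> : u 0 (rshift m j) = rsubmx u 0 j by rewrite mxE.
by rewrite u0 mxE scale0r.
Qed.

Lemma vertical_bracket_span q v : v \in V q -> bracket_span X V q v.
Proof.
move=> /vertical_coords[ O [W [u [ Oq frW uE u0]]]].
by apply/(bracket_span_frame hXV frW _ Oq); exists u.
Qed.

Lemma metric0 t w : 0 <= t <= T -> w \in V (c t) -> g t 0 w = 0.
Proof.
move=> tT wV; have [met _] := hg.
have IT : `[0, T]%classic t by rewrite /= in_itv.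
have := metric_linear met 1 IT (mem0v _) (mem0v _) wV.
rewrite scaler0 addr0 mul1r => /eqP; rewrite -[X in X == _]addr0.
by rewrite (inj_eq (addrI _)) => /eqP.
Qed.

Lemma metric_square t (x : R) y z : 0 <= t <= T -> y \in V (c t) -> z \in V (c t) ->
  0 <= g t z z - 2 * x * g t y z + x ^+ 2 * g t y y.
Proof.
move=> tT yV zV; have [met _] := hg.
have IT : `[0, T]%classic t by rewrite /= in_itv.
pose w := - x *: y + z.
have wV : w \in V (c t) by rewrite rpredD ?rpredZ.
have -> : g t z z - 2 * x * g t y z + x ^+ 2 * g t y y = g t w w.
  rewrite {1}/w (metric_linear met _ IT yV zV wV).
  rewrite (Defs.metric_sym met IT yV wV) (Defs.metric_sym met IT zV wV) /w.
  rewrite (metric_linear met _ IT yV zV yV) (metric_linear met _ IT yV zV zV).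
  rewrite (Defs.metric_sym met IT zV yV).
  by ring.
have [->|w0] := eqVneq w 0; first by rewrite metric0 ?mem0v.
exact/ltW/(metric_pos met IT wV w0).
Qed.

Lemma pushforward0 v : J v 0 = v.
Proof.
have e : Phi 0 = id by apply/funext => q; exact: flow0 hPhi q.
by rewrite /J e -[RHS](in_chart_self p).
Qed.

(** At time 0 the field J is v, a vector of V and hence of D; local propagation and connectedness of
    [0, T] carry this to every time. *)
Lemma jacobi_in_span v : 0 < T -> v \in V (c 0) ->
  forall s, 0 <= s <= T -> bracket_span X V (Phi s p) (J v s).
Proof.
move=> T0 vV; apply: segment_ind; first exact: ltW.
  move=> s sT; have [ds _] := hc sT.
  have [d d0 dP] := jacobi_span_local hXV hreg hPhi v ds.
  by exists d; [exact: d0|move=> s1 s2 _ _; exact: dP].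
by rewrite pushforward0 (flow0 hPhi); exact: vertical_bracket_span.
Qed.

Lemma no_conjugate_time t : 0 < t <= T -> lam <= 0 \/ (0 < lam /\ t < pi / Num.sqrt lam) ->
  ~ conjugate_time V Phi T c t.
Proof.
move=> /andP[t0 tT] lamt [_ [v [w [vV wE wV w0]]]].
have T0 : 0 < T by exact: lt_le_trans tT.
have Jt : J v t != 0 by rewrite /J -wE.
have loc s (sT : 0 <= s <= T) := jacobi_local hXV hreg hPhi hc hg hK T0 sT
  (jacobi_in_span T0 vV sT).
have [met _] := hg.
(* Gluing: a value is chosen at each time, with default 0 outside [0, T], and uniqueness of the
   vertical part identifies it with every local Y. *)
have exY s : exists y, 0 <= s <= T -> vertical_part (m := m) X V (Phi s p) (J v s) y.
  have [sT|nsT] := boolP (0 <= s <= T); last by exists 0.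
  have [N [Y [Z [No Ns H _ _]]]] := loc s sT.
  by exists (Y s) => _; have [] := H s sT Ns.
have [Yg YgP] := choice exY.
have Yu s y : 0 <= s <= T -> vertical_part (m := m) X V (Phi s p) (J v s) y -> Yg s = y.
  by move=> sT; exact: (vertical_part_unique hXV hreg (YgP s sT)).
pose f s := g s (Yg s) (Yg s).
have nN (N : set R) s : open N -> N s -> nbhs s N by move=> No Ns; exact: open_nbhs_nbhs.
have itv s : `[0, T]%classic s <-> 0 <= s <= T by rewrite /= in_itv.
(* The local fields Z are not compared with each other. Half the derivative of f is chosen instead;
   uniqueness of derivatives within [0, T] later identifies it with g(Y, Z) for each local Z. *)
have exp s : exists l, 0 <= s <= T -> has_deriv_within `[0, T] (f : R -> R^o) s (2 * l).
  have [sT|nsT] := boolP (0 <= s <= T); last by exists 0.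
  have [N [Y [Z [No Ns H1 H2 _]]]] := loc s sT.
  exists (g s (Y s) (Z s)) => _; have [D _] := H2 s sT Ns.
  apply: (has_deriv_within_sub (nN N s No Ns) _ _ _ D) => // [u Nu /itv uT|].
    by have [vu _ _] := H1 u uT Nu; rewrite /f (Yu u (Y u)).
  by have [vu _ _] := H1 s sT Ns; rewrite /f (Yu s (Y s)).
have [pg pgP] := choice exp.
have main s : 0 <= s <= T -> exists q, [/\ has_deriv_within `[0, T] (pg : R -> R^o) s q,
    forall x, 0 <= q - 2 * x * pg s + x ^+ 2 * f s + lam * f s,
    0 <= f s, f s = 0 -> Yg s = 0 & Yg s = 0 -> f s = 0 /\ pg s = 0].
  move=> sT; have [N [Y [Z [No Ns H1 H2 _]]]] := loc s sT.
  have YE u : 0 <= u <= T -> N u -> Yg u = Y u.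
    by move=> uT Nu; have [vu _ _] := H1 u uT Nu; exact: Yu.
  have pE u : 0 <= u <= T -> N u -> pg u = g u (Y u) (Z u).
    move=> uT Nu; have [D _] := H2 u uT Nu.
    have D' : has_deriv_within `[0, T] (f : R -> R^o) u (2 * g u (Y u) (Z u)).
      apply: (has_deriv_within_sub (nN N u No Nu) _ _ _ D) => // [u' Nu' /itv u'T|].
        by rewrite /f YE.
      by rewrite /f YE.
    have two0 : (2 : R) != 0 by rewrite pnatr_eq0.
    apply: (mulfI two0); apply: (has_deriv_within_unique _ (pgP u uT) D') => d d0.
    have [u' [u'T u'u u'd]] := segment_limit_point T0 uT d0.
    by exists u'; split=> //; exact/itv.
  have [_ YV ZV] := H1 s sT Ns; have [_ D] := H2 s sT Ns.
  have fE : f s = g s (Y s) (Y s) by rewrite /f YE.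
  have IT : `[0, T]%classic s by exact/itv.
  exists (g s (Z s) (Z s) - g s (K (c s) (Y s)) (Y s)); split.
  - apply: (has_deriv_within_sub (nN N s No Ns) _ _ _ D) => // [u Nu /itv uT|].
      by rewrite pE.
    by rewrite pE.
  (* The sum of two nonnegative terms: g(Z - x Y, Z - x Y) and lam g(Y, Y) - g(K Y, Y). *)
  - move=> x; rewrite fE pE //.
    have := hlam sT YV; have := metric_square x sT YV ZV.
    rewrite -subr_ge0 => A; rewrite -subr_ge0 => B.
    have := addr_ge0 A B; congr (0 <= _); ring.
  - rewrite fE; have [->|Y0] := eqVneq (Y s) 0; first by rewrite metric0 ?mem0v.
    exact/ltW/(metric_pos met IT YV Y0).
  - rewrite fE YE // => f0; apply/eqP/negP => /negP Y0.
    by have := metric_pos met IT YV Y0; rewrite f0 ltxx.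
  - by rewrite fE pE // YE // => ->; rewrite !metric0 ?mem0v.
have exq s : exists q, 0 <= s <= T -> [/\ has_deriv_within `[0, T] (pg : R -> R^o) s q,
    forall x, 0 <= q - 2 * x * pg s + x ^+ 2 * f s + lam * f s,
    0 <= f s, f s = 0 -> Yg s = 0 & Yg s = 0 -> f s = 0 /\ pg s = 0].
  have [sT|nsT] := boolP (0 <= s <= T); last by exists 0.
  by have [q qP] := main s sT; exists q.
have [qg qgP] := choice exq.
have oT s : 0 < s < t -> 0 <= s <= T.
  by move=> /andP[s0 st]; rewrite ltW // (le_trans (ltW st)).
have cT s : 0 <= s <= t -> 0 <= s <= T.
  by move=> /andP[s0 st]; rewrite s0 (le_trans st).
have nT s : 0 < s < t -> nbhs s `[0, T]%classic.
  move=> /andP[s0 st]; apply: filterS (near_in_itvoo (_ : s \in `]0, T[%R)).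
    by move=> u; rewrite /= !in_itv /= => /andP[u0 uT]; rewrite !ltW.
  by rewrite in_itv /= s0 (lt_le_trans st).
(* Derivatives within [0, T] give continuity relative to [0, T], one-sided at 0 and possibly at t;
   restriction to [0, t] is the form the comparison asks for. *)
have cont (h : R -> R) (h' : R -> R) : (forall s, 0 <= s <= T ->
    has_deriv_within `[0, T] (h : R -> R^o) s (h' s)) -> {within `[0, t], continuous h}.
  move=> H; apply/subspace_continuousP => s /=; rewrite in_itv /= => st.
  have := has_deriv_within_continuous ((itv s).2 (cT s st)) (H s (cT s st)).
  move=> cvT A hA; have {}cvT : nbhs s [set u | `[0, T]%classic u -> A (h u)] := cvT A hA.
  suff : nbhs s [set u | `[0, t]%classic u -> A (h u)] by [].
  by apply: filterS cvT => u Hu; rewrite /= in_itv /= => /cT uT; apply: Hu; exact/itv.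
have t00 : 0 <= (0 : R) <= t by rewrite lexx ltW.
have ttt : 0 <= t <= t by rewrite lexx ltW.
have Y0 : Yg 0 = 0.
  apply: Yu (cT _ t00) _; rewrite pushforward0 (flow0 hPhi).
  exact: vertical_part0.
(* This is where conjugacy enters: J at time t is the vector w of V, whose class modulo V is 0. *)
have Yt : Yg t = 0.
  apply: Yu (cT _ ttt) _; have [_ ct] := hc (cT _ ttt).
  by rewrite /p -ct; apply: vertical_part0; rewrite /J /p -wE.
have [_ _ _ _ /(_ Y0)[f0 p0]] := qgP 0 (cT _ t00).
have [_ _ _ _ /(_ Yt)[ft pt]] := qgP t (cT _ ttt).
have fz : forall s, 0 <= s <= t -> f s = 0.
  apply: (@sturm_comparison _ f pg qg t lam) => //.
  - by move=> s st; exact: deriv_within_is_derive (nT s st) (pgP s (oT s st)).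
  - move=> s st; have [D _ _ _ _] := qgP s (oT s st).
    exact: deriv_within_is_derive (nT s st) D.
  - by apply: (cont f (fun s => 2 * pg s)) => s sT; exact: pgP.
  - by apply: (cont pg qg) => s sT; have [] := qgP s sT.
  - by move=> s st; have [] := qgP s (oT s st).
  - by move=> s x st; have [_ H _ _ _] := qgP s (oT s st); exact: H.
(* The last clause of [jacobi_local] at time t: Y vanishes up to t, so J vanishes at t, against w !=
   0. *)
have [N [Y [Z [No Nt H1 _ H3]]]] := loc t (cT _ ttt).
move/eqP : Jt; apply; apply: H3 => // s st Ns.
have sT := cT s st; have [vs _ _] := H1 s sT Ns.
rewrite -(Yu s (Y s) sT vs); have [_ _ _ H _] := qgP s sT.
exact: H (fz s st).
Qed.

End Conjugate.

Theorem theorem3p3 (R : realType) (n m : nat) (M : manifold R n)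
    (X : vfield M) (V : tangent_distribution M)
    (dom : set (R * M)) (Phi : R -> M -> M)
    (T : R) (c : R -> M) (g : R -> 'rV[R]_n -> 'rV[R]_n -> R^o)
    (K : M -> 'End('rV[R]_n)) (lambda : R)
    (hXV : dynamic_pair m X V) (hreg : regular_pair m X V)
    (hPhi : is_flow X dom Phi)
    (hT : 0 < T)
    (hc : integral_curve X `[0, T] c) (hopen : ~ closed_orbit T c)
    (hg : invariant_metric m X V c `[0, T] g)
    (hK : is_curvature_operator m X V K)
    (hlambda :
      (forall t v, 0 <= t <= T -> v \in V (c t) ->
         g t (K (c t) v) v <= lambda * g t v v) \/
      (forall t v, 0 <= t <= T -> v \in V (c t) -> v != 0 ->
         directional_curvature c g K t v <= lambda)) :
  (lambda <= 0 ->
     forall t, 0 < t <= T -> ~ conjugate_time V Phi T c t) /\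
  (0 < lambda ->
     forall t, 0 < t < Num.min T (pi / Num.sqrt lambda) ->
       ~ conjugate_time V Phi T c t).
Proof.
have itvT : is_interval `[0, T]%classic by exact: interval_is_interval.
(* Maximality of the flow includes uniqueness of integral curves: c is the orbit of c 0, defined at
   least on [0, T]. *)
have hc' s : 0 <= s <= T -> dom (s, c 0) /\ c s = Phi s (c 0).
  move=> sT; apply: (flow_maximal hPhi itvT _ _ hc) => //; rewrite /= in_itv //=.
  by rewrite lexx ltW.
(* The two estimates agree because g is positive definite; the vector 0, where the quotient says
   nothing, is settled by linearity of K and g. *)
have hl t v : 0 <= t <= T -> v \in V (c t) -> g t (K (c t) v) v <= lambda * g t v v.
  case: hlambda => [|H tT vV]; first exact.
  have IT : `[0, T]%classic t by rewrite /= in_itv.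
  have [->|v0] := eqVneq v 0.
    by rewrite linear0 !(metric0 hg tT) ?mem0v // mulr0.
  have vp := metric_pos hg.1 IT vV v0.
  by have := H t v tT vV v0; rewrite /directional_curvature ler_pdivrMr.
split=> [l0 t tT|l0 t /andP[t0]].
  by apply: (no_conjugate_time hXV hreg hPhi hc' hg hK hl tT); left.
rewrite lt_min => /andP[tT tl].
apply: (no_conjugate_time hXV hreg hPhi hc' hg hK hl); last by right.
by rewrite t0 ltW.
Qed.
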